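(* Let $q$ be a complex number with $0<|q|<1$. Then the following three identities hold (the sums run over all nonnegative integers $i,j,k$): $$\sum_{i,j,k\geq 0} \frac{q^{2i^2+2j^2+2k^2-2ij-2ik-2i+2j}}{(q^2;q^2)_i(q^2;q^2)_j(q^2;q^2)_k} =4 \frac{J_4^{6}J_{28}^{3}}{J_2^{6}J_{4,28}J_{6,28}J_{8,28}}-\frac{1}{2}\frac{J_{1}^{5}J_{7}J_{1,14}J_{3,14}}{J_{2}^{5}J_{2,14}J_{6,14}J_{14}}-\frac{1}{2}\frac{J_{2}^{11}J_{5,14}J_{4,28}}{J_1^{6}J_{4}^{6}J_{28}},$$ $$\sum_{i,j,k\geq 0} \frac{q^{2i^2+2j^2+2k^2-2ij-2ik}}{(q^2;q^2)_i(q^2;q^2)_j(q^2;q^2)_k} =\frac{1}{2}\frac{J_{2}^{11}J_{1,14}J_{12,28}}{J_1^{6}J_{4}^{6}J_{28}}+\frac{1}{2}\frac{J_{1}^{5}J_{7}J_{3,14}J_{5,14}}{J_{2}^{5}J_{4,14}J_{6,14}J_{14}}-4q^2 \frac{J_4^{6}J_{28}^{3}}{J_2^{6}J_{4,28}J_{10,28}J_{12,28}},$$ $$\sum_{i,j,k\geq 0} \frac{q^{2i^2+2j^2+2k^2-2ij-2ik-2i+2j+2k}}{(q^2;q^2)_i(q^2;q^2)_j(q^2;q^2)_k} =\frac{1}{2q}\frac{J_{2}^{11}J_{14}J_{3,28}J_{11,28}}{J_1^{6}J_{4}^{5}J_{28}J_{4,28}J_{12,28}}-\frac{1}{2q}\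frac{J_{1}^{5}J_{7}J_{1,14}J_{5,14}}{J_{2}^{5}J_{2,14}J_{4,14}J_{14}}-4\frac{J_4^{6}J_{28}^{3}}{J_2^{6}J_{2,28}J_{8,28}J_{12,28}}.$$
   Context: Notation: for $n\in\{0,1,2,\dots\}\cup\{\infty\}$, $(a;q)_n:=\prod_{k=0}^{n-1}(1-aq^k)$ and $(a_1,\dots,a_m;q)_n:=(a_1;q)_n\cdots(a_m;q)_n$. Further, $J_m:=(q^m;q^m)_\infty$ and $J_{a,m}:=(q^a,q^{m-a},q^m;q^m)_\infty$. *)

(* Defs.v *)
From HB Require Import structures.
From mathcomp Require Import all_boot all_order all_algebra finmap complex.
From mathcomp Require Import all_classical all_reals all_analysis.
From mathcomp Require Import summability.

Set Implicit Arguments.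
Unset Strict Implicit.
Unset Printing Implicit Defensive.

Import Order.TTheory GRing.Theory Num.Theory.
Import numFieldNormedType.Exports.
Local Open Scope classical_set_scope.
Local Open Scope ring_scope.

(* The casts to [R[i]^o] below only select the usual (norm) topology on
   [R[i]]: the type [R[i]] itself carries no topology in the library. *)

(* (a;q)_n for finite n *)
Definition qpoch (F : pzRingType) (a q : F) (n : nat) : F :=
  \prod_(k < n) (1 - a * q ^+ k).

(* (a;q)_oo; [lim] is total, the product converges whenever |q| < 1 *)
Definition qpochoo (R : realType) (a q : R[i]) : R[i] :=
  lim ((fun n : nat => qpoch a q n : R[i]^o) @ \oo).

(* J_m = (q^m; q^m)_oo *)
Definition J_ (R : realType) (q : R[i]) (m : nat) : R[i] :=
  qpochoo (q ^+ m) (q ^+ m).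

(* J_{a,m} = (q^a, q^(m-a), q^m; q^m)_oo; the subtraction is in [int] *)
Definition JJ (R : realType) (q : R[i]) (a m : nat) : R[i] :=
  qpochoo (q ^+ a) (q ^+ m) * qpochoo (q ^ (m%:Z - a%:Z)) (q ^+ m)
  * qpochoo (q ^+ m) (q ^+ m).

(* The triple series over all i, j, k >= 0 converges unconditionally, with
   sum l: [totally] is the filter of finite index sets ordered by inclusion. *)
Definition has_sum3 (R : realType) (f : nat -> nat -> nat -> R[i]) (l : R[i]) :
    Prop :=
  partial_sum (fun t : nat * nat * nat => f t.1.1 t.1.2 t.2 : R[i]^o) A
    @[A --> totally] --> (l : R[i]^o).

(* Main.v *)
Require Import Defs.
From HB Require Import structures.
From mathcomp Require Import all_boot all_order all_algebra finmap complex.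
From mathcomp Require Import all_classical all_reals all_analysis.
From mathcomp Require Import summability.
From mathcomp Require Import ring zify.

(* Write Q = q^2 and u(k) = 1 / (Q; Q)_k.  Each exponent is (j - k)^2 +
   (j + k - i)^2 + i^2 plus a linear form.  After the Durfee rectangle formula
     u(j) u(k) = sum_c Q^((j - c) (k - c)) u(c) u(j - c) u(k - c)
   and Euler's expansion of u(c), the variables j - c, k - c, i and j + k - i
   are independent except that their sum is even.  Detecting this parity with a
   sign e turns their sums into three Euler products and a theta function at
   arguments e q^(M + const), e q^(const - M), where M is a shift of the index
   of Euler's expansion.  For M even, e = 1 and e = - 1 give (- q; Q)_oo^5 and
   (q; Q)_oo^5 times sums of Slater's type in q and - q; for M odd, e = - 1
   contributes 0 and e = 1 gives (- Q; Q)_oo^5 times such a sum.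
   The six sums of Slater's type are evaluated by Bailey's method: u(2n) and
   u(2n + 1) are expanded in the products u(n - r) u(n + r + d), d = 0 or 1,
   the sums over n follow from the 1phi1 summation, and the remaining
   quadratic series is the quintuple product in base q^14. *)

Import Order.TTheory GRing.Theory Num.Theory.
Import numFieldNormedType.Exports.
Local Open Scope ring_scope.

Set Implicit Arguments.
Unset Strict Implicit.
Unset Printing Implicit Defensive.

(** * Absolutely summable families of complex numbers *)

(** All sums run over the integers, with u(k) = 0 for k < 0. Then u(k - 1) = (1 - Q^k) u(k) holds
    for every integer k and index shifts leave no boundary terms. Most finite identities below come
    from 1 - Q^(k + l) = (1 - Q^k) + Q^k (1 - Q^l), sometimes with a telescoping remainder. The
    rearrangements need absolute summability of a five-fold family in N (the index of Euler's
    series), i, j - c, k - c and j + k - i. Its quadratic form is only semidefinite on Z^5. It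
    becomes coercive because the factors u(i) and u(N) force i, N >= 0. Let al, be, ga be the linear
    coefficients of i, j, k, and let E be Euler's product. The five factors of a sector are E at e
    q^M, e q^(- M), e q^(al + M), e q^(be - M), e q^(ga - M). In all three identities al = - be, so
    for e = 1 the first four form two pairs E(y) E(1/y), each a power of q times a constant. The
    fifth factor leaves a finite Pochhammer symbol, which is why a series of Slater's type
    remains. *)

Section AbsolutelySummable.
Context {R : realType}.
Local Notation C := R[i].

(** Unordered convergence along finite lists. In the partial order of [C], [0 < e] makes [e] a
    positive real. *)
Definition has_csum {I : choiceType} (f : I -> C) (s : C) : Prop :=
  forall e : C, 0 < e -> exists A : seq I, forall B, uniq B ->
    {subset A <= B} -> `|\sum_(i <- B) f i - s| < e.

Definition abssum {I : choiceType} (f : I -> C) : Prop :=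
  exists M : C, forall B, uniq B -> \sum_(i <- B) `|f i| <= M.

Definition csum {I : choiceType} (f : I -> C) : C :=
  xget 0 [set s | has_csum f s]%classic.

Lemma undup_catl {I : eqType} (s t : seq I) : {subset s <= undup (s ++ t)}.
Proof. by move=> x xs; rewrite mem_undup mem_cat xs. Qed.

Lemma undup_catr {I : eqType} (s t : seq I) : {subset t <= undup (s ++ t)}.
Proof. by move=> x xs; rewrite mem_undup mem_cat xs orbT. Qed.

Lemma has_csum_unique {I : choiceType} (f : I -> C) s t :
  has_csum f s -> has_csum f t -> s = t.
Proof.
move=> fs ft; apply/eqP; rewrite -subr_eq0; apply/negPn/negP => d0.
have e0 : 0 < `|s - t| / 2 by rewrite divr_gt0 ?normr_gt0.
have [A HA] := fs _ e0; have [B HB] := ft _ e0.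
have U := undup_uniq (A ++ B).
have h1 := HA _ U (@undup_catl _ A B); have h2 := HB _ U (@undup_catr _ A B).
have := ltrD h1 h2; rewrite -splitr distrC => h.
have := le_lt_trans (ler_normD _ _) h.
by rewrite addrA subrK ltxx.
Qed.

Lemma csumE {I : choiceType} (f : I -> C) s : has_csum f s -> csum f = s.
Proof.
move=> fs; apply: (has_csum_unique (f := f)) => //.
exact: (@xgetPex _ 0 [set s | has_csum f s]%classic (ex_intro _ s fs)).
Qed.

Lemma has_csumD {I : choiceType} (f g : I -> C) s t :
  has_csum f s -> has_csum g t -> has_csum (fun i => f i + g i) (s + t).
Proof.
move=> fs gt e e0.
have e20 : 0 < e / 2 by rewrite divr_gt0.
have [A HA] := fs _ e20; have [B HB] := gt _ e20.
exists (undup (A ++ B)) => D uD sD; rewrite big_split /=.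
rewrite opprD addrACA [e]splitr (le_lt_trans (ler_normD _ _)) // ltrD //.
  by apply: HA => // x xA; apply/sD/undup_catl.
by apply: HB => // x xA; apply/sD/undup_catr.
Qed.

Lemma has_csum0 {I : choiceType} : has_csum (fun _ : I => 0) 0.
Proof. by move=> e e0; exists [::] => B _ _; rewrite big1 // subrr normr0. Qed.

Lemma has_csumZ {I : choiceType} c (f : I -> C) s :
  has_csum f s -> has_csum (fun i => c * f i) (c * s).
Proof.
have [->|c0] := eqVneq c 0.
  move=> _ e e0; exists [::] => B _ _.
  by rewrite big1 => [|i _]; rewrite mul0r // subrr normr0.
move=> fs e e0; have e1 : 0 < e / `|c| by rewrite divr_gt0 ?normr_gt0.
have [A HA] := fs _ e1; exists A => B uB sB.
rewrite -mulr_sumr -mulrBr normrM mulrC -ltr_pdivlMr ?normr_gt0 //.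
exact: HA.
Qed.

Lemma ler_sum_subseq {I : choiceType} {K : numDomainType} (g : I -> K)
    (A B : seq I) : (forall i, 0 <= g i) -> uniq A -> uniq B ->
  {subset A <= B} -> \sum_(i <- A) g i <= \sum_(i <- B) g i.
Proof.
move=> g0 uA uB sAB.
have pB : perm_eq B (A ++ [seq x <- B | x \notin A]).
  apply: uniq_perm => //.
    rewrite cat_uniq uA filter_uniq // andbT; apply/hasPn => x.
    by rewrite mem_filter => /andP[].
  move=> x; rewrite mem_cat mem_filter.
  by case: (boolP (x \in A)) => //= /sAB ->.
by rewrite (perm_big _ pB) big_cat /= lerDl sumr_ge0.
Qed.

(** Partial sums increase with the index set, so their supremum is the unordered sum. *)
Lemma has_csum_real {I : choiceType} (g : I -> R) (M : R) :
  (forall i, 0 <= g i) -> (forall B, uniq B -> \sum_(i <- B) g i <= M) ->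
  exists s : R, has_csum (fun i => (g i)%:C%C) s%:C%C.
Proof.
move=> g0 gM.
pose E : set R := [set x : R | exists2 B : seq I, uniq B & x = \sum_(i <- B) g i]%classic.
have hE : has_sup E.
  split; first by exists 0, [::]; rewrite ?big_nil.
  by exists M => x [B uB ->]; exact: gM.
exists (sup E) => e e0.
have eR : e = (complex.Re e)%:C%C by rewrite RRe_real // gtr0_real.
have re0 : 0 < complex.Re e by rewrite -ltcR -eR.
have [_ [A uA ->] hA] := sup_adherent re0 hE; exists A => B uB sB.
have h1 : \sum_(i <- B) g i <= sup E.
  by apply: (@sup_upper_bound _ _ hE); exists B.
have h2 := ler_sum_subseq g0 uA uB sB.
rewrite -rmorph_sum -rmorphB eR normc_def /= expr0n addr0 sqrtr_sqr ltcR.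
rewrite distrC ger0_norm ?subr_ge0 // ltrBlDr -ltrBlDl.
exact: lt_le_trans hA h2.
Qed.

Lemma le_norm_Im (x : C) : `|complex.Im x|%:C%C <= `|x|.
Proof.
have := normc_ge_Re ('i%C * x); rewrite normrM.
have -> : `|'i%C : C| = 1 by rewrite normc_def /= expr0n add0r expr1n sqrtr1.
by rewrite mul1r; case: x => a b /=; simpc; rewrite normrN.
Qed.

Lemma abssum_has_csum {I : choiceType} (f : I -> C) :
  abssum f -> has_csum f (csum f).
Proof.
suff ex : abssum f -> exists s, has_csum f s.
  by move=> /ex[s fs]; rewrite (csumE fs).
move=> [M HM].
have M0 : 0 <= M by have := HM [::] isT; rewrite big_nil.
have MR : M = (complex.Re M)%:C%C by rewrite RRe_real // ger0_real.
have key (p : C -> R) : (forall x, `|p x|%:C%C <= `|x|) ->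
    exists s : R, has_csum (fun i => (p (f i))%:C%C) s%:C%C.
  move=> hp.
  have hB B : uniq B -> \sum_(i <- B) `|p (f i)| <= complex.Re M.
    move=> uB; rewrite -lecR -MR rmorph_sum; apply: le_trans (HM _ uB).
    by apply: ler_sum => i _; exact: hp.
  have [s1 h1] := has_csum_real (fun i => normr_ge0 (p (f i))) hB.
  (* A real family is the difference of the nonnegative families |p f| + p f and |p f|. *)
  have [] := @has_csum_real _ (fun i => `|p (f i)| + p (f i))
    (complex.Re M + complex.Re M).
  - by move=> i; rewrite -lerBlDr sub0r -normrN ler_norm.
  - move=> B uB; rewrite big_split lerD ?hB //.
    by apply: le_trans (hB _ uB); apply: ler_sum => i _; exact: ler_norm.
  move=> s2 h2; exists (s2 - s1).
  have := has_csumD h2 (has_csumZ (-1) h1).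
  congr has_csum; last by rewrite mulN1r rmorphB.
  by apply/funext => i; rewrite mulN1r rmorphD /= addrAC subrr add0r.
have [s hs] := key _ (@normc_ge_Re R); have [t ht] := key _ le_norm_Im.
exists (s%:C + 'i * t%:C)%C.
have := has_csumD hs (has_csumZ 'i%C ht).
by congr has_csum; apply/funext => i; rewrite -complexE.
Qed.

Lemma eq_csum {I : choiceType} (f g : I -> C) : f =1 g -> csum f = csum g.
Proof. by move=> /funext ->. Qed.

Lemma eq_abssum {I : choiceType} (f g : I -> C) : f =1 g -> abssum f -> abssum g.
Proof. by move=> /funext ->. Qed.

Lemma csum0 {I : choiceType} : csum (fun _ : I => 0) = 0.
Proof. exact/csumE/has_csum0. Qed.

Lemma csumD {I : choiceType} (f g : I -> C) : abssum f -> abssum g ->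
  csum (fun i => f i + g i) = csum f + csum g.
Proof. by move=> /abssum_has_csum hf /abssum_has_csum hg; exact/csumE/has_csumD. Qed.

Lemma csumZ {I : choiceType} c (f : I -> C) : abssum f ->
  csum (fun i => c * f i) = c * csum f.
Proof. by move=> /abssum_has_csum hf; exact/csumE/has_csumZ. Qed.

Lemma csumB {I : choiceType} (f g : I -> C) : abssum f -> abssum g ->
  csum (fun i => f i - g i) = csum f - csum g.
Proof.
move=> /abssum_has_csum hf /abssum_has_csum hg; apply: csumE.
have := has_csumD hf (has_csumZ (-1) hg).
by congr has_csum; [apply/funext => i|]; rewrite mulN1r.
Qed.

Lemma abssum_le {I : choiceType} (f g : I -> C) :
  (forall i, `|f i| <= `|g i|) -> abssum g -> abssum f.
Proof.
move=> fg [M HM]; exists M => B uB; apply: le_trans (HM _ uB).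
exact: ler_sum.
Qed.

Lemma abssumD {I : choiceType} (f g : I -> C) :
  abssum f -> abssum g -> abssum (fun i => f i + g i).
Proof.
move=> [M HM] [N HN]; exists (M + N) => B uB.
apply: le_trans (lerD (HM _ uB) (HN _ uB)); rewrite -big_split /=.
by apply: ler_sum => i _; exact: ler_normD.
Qed.

Lemma abssumZ {I : choiceType} c (f : I -> C) :
  abssum f -> abssum (fun i => c * f i).
Proof.
move=> [M HM]; exists (`|c| * M) => B uB.
under eq_bigr do rewrite normrM.
by rewrite -mulr_sumr ler_wpM2l // HM.
Qed.

Lemma abssumN {I : choiceType} (f : I -> C) :
  abssum f -> abssum (fun i => - f i).
Proof. by apply: abssum_le => i; rewrite normrN. Qed.

Lemma abssumB {I : choiceType} (f g : I -> C) :
  abssum f -> abssum g -> abssum (fun i => f i - g i).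
Proof. by move=> hf /abssumN; exact: abssumD. Qed.

Lemma abssumM {I J : choiceType} (f : I -> C) (g : J -> C) :
  abssum f -> abssum g -> abssum (fun x => f x.1 * g x.2).
Proof.
move=> [M HM] [N HN]; exists (M * N) => B uB.
pose B1 := undup (map fst B); pose B2 := undup (map snd B).
have N0 : 0 <= N by have := HN [::] isT; rewrite big_nil.
have u12 : uniq [seq (i, j) | i <- B1, j <- B2].
  by apply: allpairs_uniq; rewrite ?undup_uniq // => -[? ?] [? ?] _ _ [-> ->].
apply: (@le_trans _ _ (\sum_(i <- [seq (i, j) | i <- B1, j <- B2])
    `|f i.1 * g i.2|)).
  apply: ler_sum_subseq => // -[i j] ijB; apply/allpairsP; exists (i, j).
  by split=> //=; rewrite mem_undup; apply/mapP; exists (i, j).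
rewrite big_allpairs /=.
apply: (@le_trans _ _ (\sum_(i <- B1) `|f i| * N)).
  apply: ler_sum => i _; under eq_bigr do rewrite normrM.
  by rewrite -mulr_sumr ler_wpM2l // HN // undup_uniq.
by rewrite -mulr_suml ler_wpM2r // HM // undup_uniq.
Qed.

(** The second hypothesis says that [f] vanishes off the range of [phi], so only the points of the
    range contribute. *)
Lemma has_csum_reindex {I J : choiceType} (phi : J -> I) (psi : I -> J)
    (f : I -> C) s : cancel phi psi ->
  (forall i, phi (psi i) != i -> f i = 0) ->
  has_csum f s <-> has_csum (fun j => f (phi j)) s.
Proof.
move=> phiK f0; split=> fs e e0; have [A HA] := fs _ e0.
- exists (map psi A) => B uB sB.
  (* The image of [B] is completed by the points of [A] off the range, where [f] is 0, so that [B']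
     contains [A]. *)
  pose B' := map phi B ++ [seq i <- undup A | phi (psi i) != i].
  have inj := can_inj phiK.
  have := HA B'; rewrite /B' big_cat /= big_map big_filter.
  rewrite [\sum_(i <- undup A | _) _]big1 => [|i /f0 //]; rewrite addr0; apply.
    rewrite cat_uniq map_inj_uniq // uB filter_uniq ?undup_uniq // andbT.
    apply/hasPn => i; rewrite mem_filter => /andP[ni _]; apply/negP.
    by move=> /mapP[j _ ij]; rewrite ij phiK eqxx in ni.
  move=> i iA; rewrite mem_cat mem_filter mem_undup iA andbT.
  case: (eqVneq (phi (psi i)) i) => [<-|]; rewrite ?orbT //= orbF.
  by rewrite mem_map // sB // map_f.
- exists (map phi A) => B uB sB.
  have := HA (map psi [seq i <- B | phi (psi i) == i]).
  rewrite big_map big_filter.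
  rewrite (eq_bigr (fun i => f i)); last by move=> i /eqP ->.

  have -> : \sum_(i <- B | phi (psi i) == i) f i = \sum_(i <- B) f i.
    rewrite [RHS](bigID (fun i => phi (psi i) == i)) /=.
    by rewrite [X in _ = _ + X]big1 ?addr0 // => i /f0.
  apply.
    rewrite map_inj_in_uniq ?filter_uniq // => x y.
    by rewrite !mem_filter => /andP[/eqP xE _] /andP[/eqP yE _] xy; rewrite -xE xy.
  move=> j jA; apply/mapP; exists (phi j); last by rewrite phiK.
  by rewrite mem_filter phiK eqxx sB // map_f.
Qed.

Lemma csum_reindex {I J : choiceType} (phi : J -> I) (psi : I -> J)
    (f : I -> C) : cancel phi psi ->
  (forall i, phi (psi i) != i -> f i = 0) ->
  csum f = csum (fun j => f (phi j)).
Proof.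
move=> phiK f0; congr xget; apply/seteqP.
by split=> s; rewrite /= (has_csum_reindex _ phiK f0).
Qed.

Lemma abssum_reindex {I J : choiceType} (phi : J -> I) (psi : I -> J)
    (f : I -> C) : cancel phi psi -> abssum f -> abssum (fun j => f (phi j)).
Proof.
move=> phiK [M HM]; exists M => B uB.
by rewrite -(big_map phi xpredT (fun i => `|f i|)) HM // map_inj_uniq //; exact: can_inj phiK.
Qed.

Lemma csum_le_norm {I : choiceType} (f : I -> C) (M : C) : 
  (forall B, uniq B -> \sum_(i <- B) `|f i| <= M) -> `|csum f| <= M.
Proof.
move=> HM.
have M0 : 0 <= M by have := HM [::] isT; rewrite big_nil.
have fs : has_csum f (csum f) by apply: abssum_has_csum; exists M.
have h e : 0 < e -> `|csum f| < M + e.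
  move=> e0; have [A HA] := fs _ e0.
  have := HA _ (undup_uniq A) (fun x => etrans (mem_undup _ _)).
  set S := \sum_(i <- _) _ => hS.
  have -> : csum f = S - (S - csum f) by rewrite opprB addrCA subrr addr0.
  apply: le_lt_trans (ler_normB _ _) _; apply: ler_ltD => //.
  by apply: le_trans (ler_norm_sum _ _ _) _; apply: HM; exact: undup_uniq.
(* The order on [C] is partial: the argument by contradiction needs both sides to be real. *)
have rM := ger0_real M0; have rf : `|csum f| \is Num.real by rewrite normr_real.
rewrite real_leNgt //; apply/negP => hlt.
have d0 : 0 < `|csum f| - M by rewrite subr_gt0.
by have := h _ d0; rewrite addrCA subrr addr0 ltxx.
Qed.

Lemma has_csum_sum {I J : choiceType} (B : seq I) (f : I -> J -> C) (s : I -> C) :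
  (forall i, has_csum (f i) (s i)) ->
  has_csum (fun j => \sum_(i <- B) f i j) (\sum_(i <- B) s i).
Proof.
move=> fs; elim: B => [|i B IH].
  have -> : (fun j => \sum_(i <- [::]) f i j) = fun=> 0.
    by apply/funext => j; rewrite big_nil.
  by rewrite big_nil; exact: has_csum0.
rewrite big_cons; have := has_csumD (fs i) IH; congr has_csum.
by apply/funext => j; rewrite big_cons.
Qed.

Lemma abssum_slice {I J : choiceType} (f : I * J -> C) i :
  abssum f -> abssum (fun j => f (i, j)).
Proof.
move=> [M HM]; exists M => B uB.
have := HM (map (pair i) B); rewrite big_map; apply.
by rewrite map_inj_uniq // => x y [].
Qed.

(** Finitely many row sums are approximated at once by a common finite set of columns, which is then
    enlarged until the rectangle contains a good finite set for the double sum. *)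
Lemma has_csum_fubini {I J : choiceType} (f : I * J -> C) :
  abssum f -> has_csum (fun i => csum (fun j => f (i, j))) (csum f).
Proof.
move=> af e e0.
have fs := abssum_has_csum af.
have fi i := abssum_has_csum (abssum_slice i af).
have e20 : 0 < e / 2 by rewrite divr_gt0.
have [A HA] := fs _ e20; exists (map fst A) => B uB sB.
have [D HD] := has_csum_sum B fi e20.
pose E := undup (D ++ map snd A).
have := HD E (undup_uniq _) (@undup_catl _ _ _).
rewrite exchange_big /= -(@big_allpairs _ _ _ _ _ B E f) distrC => h1.
have h2 : `|\sum_(i <- [seq (i, j) | i <- B, j <- E]) f i - csum f| < e / 2.
  apply: HA.
    by apply: allpairs_uniq; rewrite ?undup_uniq // => -[? ?] [? ?] _ _ [-> ->].
  move=> [i j] ijA; apply/allpairsP; exists (i, j); split=> //=.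
    by apply: sB; apply/mapP; exists (i, j).
  by apply: undup_catr; apply/mapP; exists (i, j).
have := ltrD h1 h2; rewrite -splitr => h.
have := le_lt_trans (ler_normD _ _) h.
by rewrite addrA subrK.
Qed.

Lemma csum_fubini {I J : choiceType} (f : I * J -> C) :
  abssum f -> csum f = csum (fun i => csum (fun j => f (i, j))).
Proof. by move=> /has_csum_fubini/csumE. Qed.

Lemma abssum_fubini {I J : choiceType} (f : I * J -> C) :
  abssum f -> abssum (fun i => csum (fun j => f (i, j))).
Proof.
move=> af; have [M HM] := af; exists M => B uB.
(* [c i] is the phase that turns the row sum [s i] into its modulus. A finite sum of moduli is then
   a single [csum], bounded through the double family. *)
pose s i := csum (fun j => f (i, j)); pose c i := `|s i| / s i.
have cs i : c i * s i = `|s i|.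
  by rewrite /c; have [->|?] := eqVneq (s i) 0; rewrite ?mulr0 ?normr0 ?divfK.
have c1 i : `|c i| <= 1.
  rewrite /c normf_div normr_id; have [->|?] := eqVneq (s i) 0.
    by rewrite normr0 mul0r ler01.
  by rewrite divff ?normr_eq0.
have fi i : has_csum (fun j => c i * f (i, j)) (c i * s i).
  exact/has_csumZ/abssum_has_csum/abssum_slice.
rewrite (eq_bigr (fun i => c i * s i)) => [|i _]; last by rewrite cs.
have h0 : 0 <= \sum_(i <- B) c i * s i by apply: sumr_ge0 => i _; rewrite cs.
rewrite -[leLHS]ger0_norm // -(csumE (has_csum_sum B fi)).
apply: csum_le_norm => D uD.
apply: (@le_trans _ _ (\sum_(i <- [seq (i, j) | i <- B, j <- D]) `|f i|)).
  rewrite big_allpairs exchange_big /=; apply: ler_sum => j _.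
  apply: le_trans (ler_norm_sum _ _ _) _; apply: ler_sum => i _.
  by rewrite normrM ler_piMl.
apply: HM; apply: allpairs_uniq => //.
by move=> [? ?] [? ?] _ _ [-> ->].
Qed.
End AbsolutelySummable.

(** * Limits of sequences and a summability criterion by comparison of exponents *)

Section GeometricDecay.
Context {R : realType}.
Local Notation C := R[i].

Definition seqlim (a : nat -> C) (l : C) : Prop :=
  forall e : C, 0 < e -> exists N : nat, forall n, (N <= n)%N -> `|a n - l| < e.

Lemma seqlim_cvg (a : nat -> C) (l : C) : seqlim a l ->
  ((a : nat -> R[i]^o) @ \oo --> (l : R[i]^o))%classic.
Proof.
move=> al; apply/cvgrPdistC_lt => e e0; have [N HN] := al _ e0.
by exists N => // n; exact: HN.
Qed.

Lemma seqlim_lim (a : nat -> C) (l : C) : seqlim a l ->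
  lim ((a : nat -> R[i]^o) @ \oo)%classic = l.
Proof. by move=> /seqlim_cvg al; apply: cvg_lim => //; exact: norm_hausdorff. Qed.

Lemma normr_exprz (x : C) (n : int) : `|x ^ n| = `|x| ^ n.
Proof. by case: n => n; rewrite ?NegzE -?exprnN ?normfV normrX. Qed.

Lemma bernoulli (h : C) (n : nat) : 0 <= h -> 1 + n%:R * h <= (1 + h) ^+ n.
Proof.
move=> h0; elim: n => [|n IH]; first by rewrite mul0r addr0 expr0.
rewrite exprS; apply: le_trans (ler_wpM2l _ IH); last exact: addr_ge0.
have -> : (1 + h) * (1 + n%:R * h) = (1 + n.+1%:R * h) + n%:R * h * h.
  by rewrite -natr1; ring.
by rewrite lerDl !mulr_ge0.
Qed.

Lemma archi_complex (x : C) : exists n : nat, `|x| <= n%:R.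
Proof.
exists (Num.bound (complex.Re `|x|)).
have xR : `|x| = (complex.Re `|x|)%:C%C by rewrite RRe_real // normr_real.
rewrite {1}xR; have -> : (Num.bound (complex.Re `|x|))%:R =
    ((Num.bound (complex.Re `|x|))%:R : R)%:C%C :> C.
  by rewrite rmorph_nat.
rewrite lecR ltW // archi_boundP //.
by have := normr_ge0 x; rewrite xR -[0]/(0%:C%C) lecR.
Qed.

(** With this [L], |x|^n <= r^(- L n): exponential growth is charged to a linear exponent, which a
    quadratic exponent later dominates. *)
Lemma expr_small (r x : C) : 0 < r -> r < 1 ->
  exists L : nat, `|x| * r ^+ L <= 1.
Proof.
move=> r0 r1; pose h := r^-1 - 1.
have h0 : 0 < h by rewrite subr_gt0 invf_gt1.
have [L HL] := archi_complex (x / h); exists L.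
have rL : 0 < r ^+ L by rewrite exprn_gt0.
rewrite -ler_pdivlMr // div1r -exprVn -[r^-1](subrK 1) -/h addrC.
apply: le_trans (bernoulli _ (ltW h0)).
move: HL; rewrite normrM normfV (gtr0_norm h0) ler_pdivrMr // => h1.
by apply: le_trans h1 _; rewrite lerDr ler01.
Qed.

Lemma expr_lim0 (r c : C) : 0 < r -> r < 1 -> forall e, 0 < e ->
  exists N : nat, forall n, (N <= n)%N -> `|c| * r ^+ n < e.
Proof.
move=> r0 r1 e e0; have [L HL] := expr_small (2 * c / e) r0 r1.
exists L => n Ln; apply: (@le_lt_trans _ _ (`|c| * r ^+ L)).
  by apply: ler_wpM2l => //; rewrite ler_iXn2l.
move: HL; rewrite !normrM normfV (gtr0_norm e0) (ger0_norm (ler0n _ _)).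
rewrite -!mulrA [e^-1 * _]mulrC !mulrA ler_pdivrMr // mul1r -mulrA.
have := mulr_ge0 (normr_ge0 c) (exprn_ge0 L (ltW r0)).
rewrite le_eqVlt => /predU1P[<- //|h0]; apply: lt_le_trans.
by rewrite mulr_natl mulr2n ltrDl.
Qed.

(** A gauge for index sets, stable under products. It reduces the summability of multiple series to
    one inequality between integer exponents. *)
Definition geo {I : choiceType} (g : I -> nat) : Prop :=
  forall r : C, 0 <= r -> r < 1 -> abssum (fun i => r ^+ g i).

Lemma sum_geo_le (r : C) (n : nat) : 0 <= r -> r < 1 ->
  \sum_(i <- iota 0 n) r ^+ i <= (1 - r)^-1.
Proof.
move=> r0 r1; have d0 : 0 < 1 - r by rewrite subr_gt0.
rewrite -[leRHS]div1r ler_pdivlMr // mulrC.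
have -> : \sum_(i <- iota 0 n) r ^+ i = \sum_(i < n) r ^+ i.
  by rewrite -(big_mkord xpredT (fun i => r ^+ i)) /index_iota subn0.
have := subrX1 r n; rewrite -opprB -[r - 1]opprB mulNr => /oppr_inj <-.
by rewrite gerBl exprn_ge0.
Qed.

Lemma geo_absz : geo (fun n : int => `|n|%N).
Proof.
move=> r r0 r1; exists ((1 - r)^-1 + (1 - r)^-1) => B uB.
(* Any number above all |n|, n in [B], would do. *)
pose N := (\sum_(n <- B) `|n|).+1%N.
have hN n : n \in B -> (`|n| < N)%N.
  by move=> nB; rewrite /N ltnS (big_rem n) //= leq_addr.
move: (N) hN => {}N hN.
have inj1 : injective Posz by move=> x y [].
have inj2 : injective Negz by move=> x y [].
apply: (@le_trans _ _ (\sum_(n <- map Posz (iota 0 N) ++ map Negz (iota 0 N))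
    `|r ^+ `|n| |)).
  apply: ler_sum_subseq => //.
    rewrite cat_uniq !map_inj_uniq // iota_uniq andbT; apply/hasPn => x.
    by move=> /mapP[y _ ->]; apply/mapP => -[].
  move=> [n|n] /hN nN; rewrite mem_cat; apply/orP.
    by left; rewrite mem_map // mem_iota add0n.
  right; rewrite mem_map // mem_iota add0n /=; move: nN => /=; exact: ltnW.
rewrite big_cat !big_map /=; apply: lerD.
  rewrite (eq_bigr (fun i => r ^+ i)) ?sum_geo_le // => i _.
  by rewrite ger0_norm ?exprn_ge0.
apply: le_trans (sum_geo_le N r0 r1); apply: ler_sum => i _.
by rewrite ger0_norm ?exprn_ge0 // exprS ler_piMl ?exprn_ge0 // ltW.
Qed.

Lemma geo_pair {I J : choiceType} (g : I -> nat) (h : J -> nat) :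
  geo g -> geo h -> geo (fun x : I * J => (g x.1 + h x.2)%N).
Proof.
move=> gg gh r r0 r1; apply: eq_abssum (abssumM (gg _ r0 r1) (gh _ r0 r1)).
by move=> x; rewrite exprD.
Qed.

(* A [K]-th root of [r] turns an exponent growing like [g / K] into [g]. *)
Lemma abssum_geo {I : choiceType} (g : I -> nat) (r D : C) (K : nat) (c : int)
    (X : I -> int) (f : I -> C) :
  geo g -> 0 < r -> r < 1 -> (0 < K)%N ->
  (forall i, f i != 0 -> `|f i| <= D * r ^ X i /\ (g i)%:Z <= K%:Z * X i + c) ->
  abssum f.
Proof.
move=> gg r0 r1 K0 H; pose s := K.-root r.
have sK : s ^+ K = r by exact: rootCK.
have s0 : 0 < s.
  rewrite lt0r rootC_ge0 // (ltW r0) andbT; apply: contraTneq r0 => s0.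
  by rewrite -sK s0 expr0n gtn_eqF // ltxx.
have s1 : s < 1 by rewrite rootC_lt1 // ltW.
pose D' := `|D| * s ^ (- c).
apply: abssum_le (abssumZ D' (gg _ (ltW s0) s1)) => i.
have [->|fi] := eqVneq (f i) 0; first by rewrite normr0.
have [h1 h2] := H _ fi.
have rX : 0 < r ^ X i by rewrite exprz_gt0.
rewrite normrM normrX (gtr0_norm s0) /D' normrM normr_id normr_exprz (gtr0_norm s0).
apply: le_trans h1 _.
apply: (@le_trans _ _ (`|D| * r ^ X i)).
  have nf : 0 <= D * r ^ X i by apply: le_trans (H _ fi).1.
  have D0 : 0 <= D by rewrite -(pmulr_lge0 _ rX).
  by rewrite (ger0_norm D0).
rewrite -mulrA ler_wpM2l // -sK -[s ^+ K]/(s ^ K%:Z) exprz_exp.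
rewrite -[s ^+ g i]/(s ^ (g i)%:Z) -expfzDr ?gt_eqF //.
have -> : K%:Z * X i = (- c + (g i)%:Z) + (K%:Z * X i + c - (g i)%:Z) by ring.
rewrite [X in X <= _]expfzDr ?gt_eqF // ler_piMr ?exprz_ge0 ?(ltW s0) //.
have : 0 <= K%:Z * X i + c - (g i)%:Z by rewrite subr_ge0.
case: (_ - _) => // n _; exact: exprn_ile1 (ltW s0) (ltW s1).
Qed.

Lemma csum_single {I : choiceType} (f : I -> C) i0 :
  (forall i, i != i0 -> f i = 0) -> csum f = f i0.
Proof.
move=> f0; apply: csumE => e e0; exists [:: i0] => B uB sB.
rewrite (bigD1_seq i0) ?sB ?mem_head //= big1 => [|i /f0 //].
by rewrite addr0 subrr normr0.
Qed.

Lemma csum_bij {I J : choiceType} (phi : J -> I) (psi : I -> J) (f : I -> C) :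
  cancel phi psi -> cancel psi phi -> csum f = csum (fun j => f (phi j)).
Proof. by move=> h1 h2; apply: csum_reindex h1 _ => i; rewrite h2 eqxx. Qed.

Lemma csum_shift (c : int) (f : int -> C) : csum f = csum (fun n => f (n + c)).
Proof. by apply: (csum_bij (psi := fun n => n - c)) => n; rewrite ?addrK ?subrK. Qed.

Lemma csum_opp (f : int -> C) : csum f = csum (fun n => f (- n)).
Proof. by apply: (csum_bij (psi := fun n => - n)) => n; rewrite opprK. Qed.

End GeometricDecay.

(** * Euler's series *)

Section Euler.
Context {R : realType}.
Local Notation C := R[i].

(* [1 / (q^2; q^2)_k], extended by 0 to negative [k]. *)
Definition rpoch (q : C) (k : int) : C :=
  if k is Posz n then (qpoch (q ^+ 2) (q ^+ 2) n)^-1 else 0.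

(* Equals [(- q v; q^2)_oo] by Euler. *)
Definition eexp (q v : C) : C :=
  csum (fun k : int => q ^ (k * k) * v ^ k * rpoch q k).

Context (q : C) (q0 : q != 0) (q1 : `|q| < 1).

Lemma normq_gt0 : 0 < `|q|. Proof. by rewrite normr_gt0. Qed.

Lemma rpoch_lt0 k : k < 0 -> rpoch q k = 0. Proof. by case: k. Qed.

Lemma rpoch0 : rpoch q 0 = 1.
Proof. by rewrite /rpoch /= /qpoch big_ord0 invr1. Qed.

Lemma subr1_expn_neq0 (n : nat) : (0 < n)%N -> 1 - q ^+ n != 0.
Proof.
move=> n0; rewrite subr_eq0; apply/negP => /eqP e.
have : `|q ^+ n| < 1 by rewrite normrX exprn_ilt1 ?normr_ge0 -?lt0n.
by rewrite -e normr1 ltxx.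
Qed.

Lemma qpochS (a p : C) n : qpoch a p n.+1 = qpoch a p n * (1 - a * p ^+ n).
Proof. by rewrite /qpoch big_ord_recr. Qed.

Lemma rpoch_pred k : rpoch q (k - 1) = (1 - q ^ (2 * k)) * rpoch q k.
Proof.
case: k => [[|n]|n].
- by rewrite mulr0 expr0z subrr mul0r.
- have -> : n.+1%:Z - 1 = n by rewrite intS addrC addrA addNr add0r.
  rewrite /rpoch qpochS invfM mulrCA -exprS.
  have -> : q ^ (2 * n.+1%:Z) = (q ^+ 2) ^+ n.+1 by rewrite -exprM.
  by rewrite divff ?mulr1 // -exprM subr1_expn_neq0.
- by rewrite (_ : Negz n - 1 = Negz n.+1) ?mulr0 //; lia.
Qed.

(** This is 1 - Q^(k + l) = (1 - Q^k) + Q^k (1 - Q^l), the source of the contiguous relations used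
    in the finite identities. *)
Lemma rpochM_pred k l :
  (1 - q ^ (2 * (k + l))) * (rpoch q k * rpoch q l) =
  rpoch q (k - 1) * rpoch q l + q ^ (2 * k) * (rpoch q k * rpoch q (l - 1)).
Proof. by rewrite !rpoch_pred mulrDr expfzDr //; ring. Qed.

(** Each factor 1 - Q^i has modulus at least 1 - |q|. This exponential bound is enough to make
    Euler's series converge; the uniform bound [rpoch_bounded] is then deduced from that series. *)
Lemma rpoch_crude (n : nat) : `|rpoch q n| <= (1 - `|q|)^-1 ^+ n.
Proof.
have d0 : 0 < 1 - `|q| by rewrite subr_gt0.
have p0 : 0 < `|qpoch (q ^+ 2) (q ^+ 2) n|.
  rewrite normr_gt0 /qpoch; apply/prodf_neq0 => i _.
  by rewrite -exprM -exprD subr1_expn_neq0.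
rewrite /rpoch normfV exprVn lef_pV2 ?posrE ?exprn_gt0 //.
rewrite /qpoch normr_prod -[n in X in X <= _]card_ord -prodr_const.
apply: ler_prod => i _; rewrite ltW //=.
apply: le_trans (lerB_dist _ _); rewrite normr1 lerD2l lerN2.
by rewrite -exprM -exprD normrX addSn exprS ler_piMr // exprn_ile1 // ltW.
Qed.

Lemma abssum_eexp v : abssum (fun k : int => q ^ (k * k) * v ^ k * rpoch q k).
Proof.
have d0 : 0 < 1 - `|q| by rewrite subr_gt0.
have [L HL] := expr_small (`|v| / (1 - `|q|)) normq_gt0 q1.
apply: (abssum_geo (g := fun k : int => `|k|%N) (r := `|q|) (D := 1) (K := 1)
  (c := (L%:Z + 1) * (L%:Z + 1)) (X := fun k => k * k - L%:Z * k)).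
- exact: geo_absz.
- exact: normq_gt0.
- exact: q1.
- by [].
move=> [n|n]; last by rewrite /= mulr0 eqxx.
move=> _; split; last by rewrite /=; nia.
rewrite mul1r !normrM !normr_exprz -mulrA.
rewrite expfzDr ?gt_eqF ?normq_gt0 // ler_wpM2l ?exprz_ge0 //.
have -> : - (L%:Z * n) = - (L * n)%N%:Z by lia.
rewrite -exprnN exprM -exprVn.
apply: (@le_trans _ _ ((`|v| / (1 - `|q|)) ^+ n)).
  by rewrite exprMn ler_wpM2l ?exprn_ge0 ?rpoch_crude.
apply: lerXn2r; rewrite ?nnegrE ?divr_ge0 ?invr_ge0 ?exprn_ge0 ?(ltW d0) //.
rewrite -[leRHS]div1r ler_pdivlMr ?exprn_gt0 ?normq_gt0 //.
by move: HL; rewrite ger0_norm // divr_ge0 // ltW.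
Qed.

Lemma eexp0 : eexp q 0 = 1.
Proof.
rewrite /eexp (csum_single (i0 := 0)) ?rpoch0 ?mulr0 ?expr0z ?mulr1 //.
by move=> k k0; rewrite exp0rz (negPf k0) mulr0 mul0r.
Qed.

(** Comparing coefficients, the difference of the two series replaces u(k) by (1 - Q^k) u(k) = u(k -
    1), which is a shift of the index. *)
Lemma eexp_shift v : eexp q v = (1 + q * v) * eexp q (q ^+ 2 * v).
Proof.
(* The law v^(k + 1) = v^k v for integer k fails at v = 0. *)
have [->|v0] := eqVneq v 0; first by rewrite mulr0 mulr0 addr0 mul1r.
rewrite mulrDl mul1r; apply/eqP; rewrite addrC -subr_eq; apply/eqP.
rewrite -csumB; [|exact: abssum_eexp..].
rewrite (csum_shift 1) -csumZ; last exact: abssum_eexp.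
apply: eq_csum => k.
have E m : (q ^+ 2 * v) ^ m = q ^ (2 * m) * v ^ m.
  by rewrite expfzMl -exprz_exp.
rewrite !E; have := rpoch_pred (k + 1); rewrite addrK => ->.
have -> : q ^ (2 * (k + 1)) = q ^ (2 * k) * q ^ 2.
  by rewrite -expfzDr //; congr (_ ^ _); ring.
have -> : q ^ ((k + 1) * (k + 1)) = q ^ (k * k) * q ^ (2 * k) * q ^ 1.
  by rewrite -!expfzDr //; congr (_ ^ _); ring.
rewrite [v ^ _]expfzDr // !expr1z; ring.
Qed.

Lemma eexp_qpoch v n :
  eexp q v = qpoch (- (q * v)) (q ^+ 2) n * eexp q (v * q ^+ (2 * n)).
Proof.
elim: n => [|n IH]; first by rewrite /qpoch big_ord0 muln0 expr0 mul1r mulr1.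
rewrite qpochS {}IH -mulrA; congr (_ * _); rewrite eexp_shift -exprM.
by rewrite mulnS exprD; congr (_ * eexp q _); ring.
Qed.

(** For |v| <= 1 every term with k >= 1 carries a factor v, and the rest is bounded by the series at
    1. *)
Lemma eexp_near0 : exists M : C, forall v, `|v| <= 1 -> `|eexp q v - 1| <= `|v| * M.
Proof.
have [M HM] := abssum_eexp 1; exists M => v v1.
have af : abssum (fun k : int => if k == 0 then 1 else 0 : C).
  exists 1 => B uB; rewrite (eq_bigr (fun k : int => if k == 0 then 1 else 0 : C)).
    rewrite -big_mkcond /=.
    have [B0|B0] := boolP (0 \in B).
      by rewrite -big_filter filter_pred1_uniq // big_seq1.
    rewrite big1_seq // => k /andP[/eqP -> kB]; by rewrite kB in B0.
  by move=> k _; case: ifP; rewrite ?normr1 ?normr0.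
have -> : 1 = csum (fun k : int => if k == 0 then 1 else 0 : C).
  by rewrite (csum_single (i0 := 0)) // => k /negPf ->.
rewrite -csumB //; last exact: abssum_eexp.
apply: csum_le_norm => B uB; apply: le_trans (ler_wpM2l (normr_ge0 v) (HM B uB)).
rewrite mulr_sumr; apply: ler_sum => -[[|n]|n] _ /=; last first.
- by rewrite !mulr0 subr0 normr0 mulr0.
- rewrite subr0 !normrM !normr_exprz normr1 exp1rz mulr1.
  rewrite mulrAC [leRHS]mulrC ler_wpM2l ?mulr_ge0 ?exprz_ge0 //.
  by rewrite (exprS _ _ : `|v| ^ n.+1%:Z = _) ler_piMr // exprn_ile1.
- by rewrite mulr0 !expr0z !mulr1 /qpoch big_ord0 invr1 ?mul1r subrr normr0 mulr_ge0.
Qed.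

Lemma eexp_lim1 v : seqlim (fun n => eexp q (v * q ^+ (2 * n))) 1.
Proof.
have [M HM] := eexp_near0 => e e0.
have [N1 H1] := expr_lim0 v normq_gt0 q1 ltr01.
have [N2 H2] := expr_lim0 (v * M) normq_gt0 q1 e0.
exists (maxn N1 N2) => n; rewrite geq_max => /andP[n1 n2].
have le2 : (n <= 2 * n)%N by rewrite leq_pmull.
have hv : `|v * q ^+ (2 * n)| <= 1.
  by rewrite normrM normrX ltW // H1 // (leq_trans n1).
apply: le_lt_trans (HM _ hv) _.
have M0 : 0 <= M by have := HM 1; rewrite normr1 mul1r lexx => /(_ isT) /(le_trans (normr_ge0 _)).
have := H2 _ (leq_trans n2 le2); rewrite !normrM normrX (ger0_norm M0).
by rewrite mulrAC.
Qed.

Lemma eexp_lim1_half v : exists N, forall n, (N <= n)%N ->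
  1 / 2 <= `|eexp q (v * q ^+ (2 * n))|.
Proof.
have h : 0 < 1 / 2 :> C by rewrite divr_gt0.
have [N HN] := eexp_lim1 v h; exists N => n /HN; set x := eexp _ _ => hx.
have : 1 - `|x| <= `|x - 1| by rewrite distrC -[X in X - _]normr1 lerB_dist.
move=> /le_lt_trans/(_ hx); rewrite ltrBlDr => h1.
have : 1 / 2 + 1 / 2 < 1 / 2 + `|x| by rewrite -splitr.
by rewrite ltrD2l => /ltW.
Qed.

(** The partial product times E(v Q^n) is the fixed number E(v), and E(v Q^n) tends to 1. The lower
    bound 1/2 keeps the partial products bounded. *)
Lemma qpoch_seqlim v : seqlim (qpoch (- (q * v)) (q ^+ 2)) (eexp q v).
Proof.
move=> e e0; have [N1 H1] := eexp_lim1_half v.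
pose M := 2 * `|eexp q v| + 1.
have M0 : 0 < M by rewrite ltr_wpDl // mulr_ge0.
have e1 : 0 < e / M by rewrite divr_gt0.
have [N2 H2] := eexp_lim1 v e1.
exists (maxn N1 N2) => n; rewrite geq_max => /andP[/H1 h1 /H2 h2].
rewrite (eexp_qpoch v n); set x := eexp q (_ * _) in h1 h2 *.
set p := qpoch _ _ _.
have pM : `|p| <= M.
  have x0 : 0 < `|x| by apply: lt_le_trans h1; rewrite divr_gt0.
  have : `|p| * (1 / 2) <= `|eexp q v|.
    by rewrite (eexp_qpoch v n) normrM ler_wpM2l.
  rewrite mulrA mulr1 ler_pdivrMr // => h; apply: le_trans h _.
  by rewrite /M mulrC lerDl.
rewrite -[X in X - _]mulr1 -mulrBr normrM distrC.
apply: (@le_lt_trans _ _ (M * `|x - 1|)); first by rewrite ler_wpM2r.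
by rewrite mulrC -ltr_pdivlMr.
Qed.

Lemma qpochoo_eexp v : qpochoo (- (q * v)) (q ^+ 2) = eexp q v.
Proof. exact/seqlim_lim/qpoch_seqlim. Qed.

Lemma eexp_neq0 v : (forall n, 1 + q * v * (q ^+ 2) ^+ n != 0) -> eexp q v != 0.
Proof.
move=> h; have [N HN] := eexp_lim1_half v.
rewrite (eexp_qpoch v N) mulf_neq0 //.
  by rewrite /qpoch; apply/prodf_neq0 => i _; rewrite mulNr opprK h.
by rewrite -normr_gt0 (lt_le_trans _ (HN _ (leqnn _))) ?divr_gt0.
Qed.

Lemma qpoch_bounded v : exists M : C, 0 <= M /\
  forall n, `|qpoch (- (q * v)) (q ^+ 2) n| <= M.
Proof.
have [N HN] := qpoch_seqlim v ltr01.
pose p := qpoch (- (q * v)) (q ^+ 2).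
exists (\sum_(k < N) `|p k| + (`|eexp q v| + 1)).
have S0 : 0 <= \sum_(k < N) `|p k| by apply: sumr_ge0.
split; first by rewrite !addr_ge0.
move=> n; have [nN|Nn] := ltnP n N.
  rewrite (bigD1 (Ordinal nN)) //= -addrA lerDl !addr_ge0 //.
  by apply: sumr_ge0.
apply: (@le_trans _ _ (`|eexp q v| + 1)); last by rewrite lerDr.
rewrite -[qpoch _ _ n](subrK (eexp q v)) addrC.
by apply: le_trans (ler_normD _ _) _; rewrite lerD2l ltW // HN.
Qed.

Lemma eexpNq_neq0 : eexp q (- q) != 0.
Proof.
apply: eexp_neq0 => n; rewrite mulrN mulNr -expr2 -exprM -exprD.
by rewrite subr1_expn_neq0.
Qed.

(** The factor of index [n] of the product vanishes, so the product is split after n + 1 factors. *)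
Lemma eexp_eq0 (n : nat) : eexp q (- q ^ (- (2 * n%:Z + 1))) = 0.
Proof.
rewrite (eexp_qpoch _ n.+1) qpochS.
suff -> : - (q * - q ^ (- (2 * n%:Z + 1))) * (q ^+ 2) ^+ n = 1.
  by rewrite subrr mulr0 mul0r.
rewrite mulrN opprK -exprM -[q ^+ (2 * n)]/(q ^ (2 * n)%N%:Z).
rewrite -{1}[q]expr1z -!expfzDr // -[RHS](expr0z q).
by congr (_ ^ _); lia.
Qed.

(** This is (Q; Q)_k = (Q; Q)_oo / (Q^(k + 1); Q)_oo. For negative [k] the numerator on the right
    has a zero factor, in agreement with the convention u(k) = 0. It is the form in which Euler's
    series expands u. *)
Lemma rpoch_eexp k : rpoch q k = eexp q (- q ^ (2 * k + 1)) / eexp q (- q).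
Proof.
have E0 := eexpNq_neq0; case: k => n; last first.
  rewrite (_ : 2 * Negz n + 1 = - (2 * n%:Z + 1)) ?eexp_eq0 ?mul0r //; lia.
move: E0; rewrite [eexp q (- q)](eexp_qpoch _ n) mulf_eq0 negb_or => /andP[p0 e0].
have -> : - q ^ (2 * n%:Z + 1) = - q * q ^+ (2 * n) :> C.
  by rewrite expfzDr // expr1z mulrC mulNr.
rewrite invfM mulrCA divff // mulr1 /=.
by rewrite mulrN opprK -expr2.
Qed.

Lemma rpoch_bounded : exists M : C, 0 <= M /\ forall k, `|rpoch q k| <= M.
Proof.
have [M HM] := eexp_near0.
have M0 : 0 <= M.
  by have := HM 1; rewrite normr1 mul1r lexx => /(_ isT) /(le_trans (normr_ge0 _)).
have E0 : 0 < `|eexp q (- q)| by rewrite normr_gt0 eexpNq_neq0.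
exists ((1 + M) / `|eexp q (- q)|); split; first by rewrite divr_ge0 ?addr_ge0.
case=> n; last by rewrite normr0 divr_ge0 ?addr_ge0.
rewrite rpoch_eexp normf_div ler_wpM2r ?invr_ge0 //.
set v := - _; have v1 : `|v| <= 1.
  rewrite normrN normr_exprz -[2 * n%:Z + 1]/((2 * n + 1)%N%:Z).
  by rewrite exprn_ile1 // ltW.
rewrite -[eexp q v](subrK 1) addrC; apply: le_trans (ler_normD _ _) _.
rewrite normr1 lerD2l; apply: le_trans (HM _ v1) _.
by rewrite ler_piMl.
Qed.

End Euler.

(** * The triple product and the 1phi1 sum *)

Section ThetaFunctions.
Context {R : realType}.
Local Notation C := R[i].

Definition theta (q v : C) : C := csum (fun n : int => q ^ (n * n) * v ^ n).

Lemma csumM {I J : choiceType} (f : I -> C) (g : J -> C) :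
  abssum f -> abssum g ->
  csum (fun x : I * J => f x.1 * g x.2) = csum f * csum g.
Proof.
move=> af ag; rewrite csum_fubini; last exact: abssumM.
rewrite mulrC -csumZ //; apply: eq_csum => i /=.
by rewrite csumZ // mulrC.
Qed.

Lemma abssum_bij {I J : choiceType} (phi : J -> I) (psi : I -> J) (f : I -> C) :
  cancel phi psi -> cancel psi phi -> abssum (fun j => f (phi j)) -> abssum f.
Proof.
move=> h1 h2 /(abssum_reindex h2); apply: eq_abssum => i; by rewrite h2.
Qed.

Lemma abssum_finite {I : choiceType} (A : seq I) (f : I -> C) :
  (forall i, i \notin A -> f i = 0) -> abssum f.
Proof.
move=> f0; exists (\sum_(i <- undup A) `|f i|) => B uB.
rewrite (bigID (mem A)) /= [X in _ + X]big1 ?addr0; last first.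
  by move=> i /f0 ->; rewrite normr0.
rewrite -big_filter; apply: ler_sum_subseq => //; rewrite ?filter_uniq ?undup_uniq //.
by move=> i; rewrite mem_filter mem_undup => /andP[].
Qed.

Context (q : C) (q0 : q != 0) (q1 : `|q| < 1).

Lemma abssum_qpow {I : choiceType} (g : I -> nat) (K : nat) (c : int) (D : C)
    (X : I -> int) (h : I -> C) :
  geo (R := R) g -> (0 < K)%N -> (forall i, `|h i| <= D) ->
  (forall i, h i != 0 -> (g i)%:Z <= K%:Z * X i + c) ->
  abssum (fun i => q ^ X i * h i).
Proof.
move=> gg K0 hD hX; apply: (abssum_geo (r := `|q|) (D := D) gg _ q1 K0).
  exact: normq_gt0.
move=> i; rewrite mulf_eq0 negb_or => /andP[_ /hX h2]; split; last exact: h2.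
by rewrite normrM normr_exprz mulrC ler_wpM2r // exprz_ge0.
Qed.

(** One exponent must serve [v] and [v^-1], as [n] runs over both signs. *)
Lemma exprz_tame v : v != 0 -> exists L : nat, forall n : int,
  `|v ^ n| <= `|q| ^ (- (L * `|n|)%N%:Z).
Proof.
move=> v0; have [L1 H1] := expr_small v (normq_gt0 q0) q1.
have [L2 H2] := expr_small v^-1 (normq_gt0 q0) q1.
have q0' := normq_gt0 q0.
have le1 L x n : `|x| * `|q| ^+ L <= 1 -> forall L', (L <= L')%N ->
    `|x ^+ n| <= `|q| ^ (- (L' * n)%N%:Z).
  move=> h L' LL; rewrite -exprnN -[leRHS]div1r ler_pdivlMr ?exprn_gt0 //.
  rewrite exprM normrX -exprMn exprn_ile1 ?mulr_ge0 ?exprn_ge0 //.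
  by apply: le_trans h; rewrite ler_wpM2l // ler_iXn2l.
exists (maxn L1 L2) => -[n|n].
  by apply: (le1 _ _ _ H1); rewrite leq_maxl.
by rewrite NegzE -exprnN -exprVn; apply: (le1 _ _ _ H2); rewrite leq_maxr.
Qed.

Lemma abssum_theta v : v != 0 -> abssum (fun n : int => q ^ (n * n) * v ^ n).
Proof.
move=> /exprz_tame[L HL].
apply: (abssum_geo (g := fun k : int => `|k|%N) (r := `|q|) (D := 1) (K := 1)
  (c := (L%:Z + 1) * (L%:Z + 1)) (X := fun k => k * k - (L * `|k|)%N%:Z)) => //.
- exact: geo_absz.
- exact: normq_gt0.
move=> n _; split; last by nia.
rewrite mul1r normrM normr_exprz expfzDr ?gt_eqF ?(normq_gt0 q0) //.
by rewrite ler_wpM2l // exprz_ge0.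
Qed.

(* Newton's basis [(v - 1) (v - q^2) (v - q^4) ...]. *)
Definition newton (v : C) (j : int) : C := \prod_(k < `|j|) (v - (q ^+ 2) ^+ k).

Lemma newton_rpochS v (j : int) :
  rpoch q j * newton v (j + 1) = rpoch q j * newton v j * (v - q ^ (2 * j)).
Proof.
case: j => [n|n]; last by rewrite !mul0r.
by rewrite /newton (_ : Posz n + 1 = n.+1) ?big_ord_recr -?mulrA -?exprM //; lia.
Qed.

Lemma abssum_vandermonde v m :
  abssum (fun j : int => rpoch q j * rpoch q (m - j) * newton v j).
Proof.
apply: (@abssum_finite _ (map Posz (iota 0 `|m|.+1))) => -[n|n]; last by rewrite !mul0r.
rewrite mem_map ?mem_iota => [|? ? [] //]; rewrite add0n /= ltnS -ltnNge => mn.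
by rewrite (@rpoch_lt0 _ q (m - n%:Z)) ?mulr0 ?mul0r //; lia.
Qed.

(** Cauchy's expansion of v^m in the basis [newton], with Gaussian binomials written as u(j) u(m -
    j) / u(m). *)
Lemma newton_vandermonde v m :
  csum (fun j : int => rpoch q j * rpoch q (m - j) * newton v j) =
  v ^ m * rpoch q m.
Proof.
case: m => [m|m]; last first.
  rewrite mulr0 -(@csum0 _ int); apply: eq_csum => -[j|j]; rewrite ?mul0r //.
  by rewrite (@rpoch_lt0 _ q (_ - _)) ?mulr0 ?mul0r //; lia.
elim: m => [|m IH].
  rewrite (csum_single (i0 := 0)).
    rewrite -[0%N%:Z]/(0 : int) subr0 rpoch0 expr0z !mulr1 mul1r.
    by rewrite /newton /= big_ord0.
  move=> [j|j] j0; rewrite ?mul0r //.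
  by rewrite (@rpoch_lt0 _ q (_ - _)) ?mulr0 ?mul0r //; lia.
have m0 : 1 - q ^ (2 * m.+1%:Z) != 0.
  by rewrite -[2 * m.+1%:Z]/((2 * m.+1)%N%:Z) subr1_expn_neq0.
apply: (mulfI m0); rewrite -csumZ; last exact: abssum_vandermonde.
have -> : (1 - q ^ (2 * m.+1%:Z)) * (v ^ m.+1%:Z * rpoch q m.+1%:Z) =
    v * (v ^ m%:Z * rpoch q m).
  have := rpoch_pred q0 q1 m.+1%:Z; rewrite (_ : m.+1%:Z - 1 = m); last by lia.
  move=> ->; rewrite (exprS _ _ : v ^ m.+1%:Z = _) -[v ^ m%:Z]/(v ^+ m); ring.
rewrite -IH -csumZ; last exact: abssum_vandermonde.
(* [f] and [g] are the two parts into which [rpochM_pred] splits (1 - Q^(m + 1)) times the sum. By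
   the recurrence of [newton], f(j + 1) + g(j) is [v] times the term for [m], and the shift of [f]
   does not change its sum. *)
pose f (j : int) := rpoch q (j - 1) * rpoch q (m.+1%:Z - j) * newton v j.
pose g (j : int) := q ^ (2 * j) * (rpoch q j * rpoch q (m%:Z - j) * newton v j).
have fE j : f (j + 1) = v * (rpoch q j * rpoch q (m%:Z - j) * newton v j) - g j.
  rewrite /f /g addrK mulrAC newton_rpochS.
  rewrite (_ : m.+1%:Z - (j + 1) = m%:Z - j); last by lia.
  ring.
have ag : abssum g.
  apply: (@abssum_finite _ (map Posz (iota 0 m.+1))) => -[n|n].
    rewrite mem_map ?mem_iota => [|? ? [] //]; rewrite add0n /= ltnS -ltnNge => mn.
    by rewrite /g (@rpoch_lt0 _ q (_ - _)) ?mulr0 ?mul0r ?mulr0 //; lia.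
  by rewrite /g !mul0r mulr0.
have af1 : abssum (fun j => f (j + 1)).
  apply: (eq_abssum (fun j => esym (fE j))); apply: abssumB => //.
  exact/abssumZ/abssum_vandermonde.
have af : abssum f.
  by apply: abssum_bij af1 => n; [exact: addrK | exact: subrK].
rewrite [RHS](@eq_csum _ _ _ (fun j => f (j + 1) + g j)); last first.
  by move=> j; rewrite fE subrK.
rewrite csumD // -(csum_shift 1 f) -csumD //; apply: eq_csum => j.
have := rpochM_pred q0 q1 j (m.+1%:Z - j); rewrite [j + _]addrCA subrr addr0.
rewrite (_ : m.+1%:Z - j - 1 = m%:Z - j); last by lia.
by move=> rp; rewrite mulrA rp /f /g; ring.
Qed.

(* The limiting case [1phi1] of the q-Gauss sum: expand [1 / (q^2; q^2)_(j+t)]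
   by Euler and sum over [j] at fixed total degree. *)
Lemma one_phi_one v t :
  csum (fun j : int => newton v j *
    ((-1) ^ j * q ^ (j * j + j + 2 * t * j) * rpoch q j * rpoch q (j + t))) =
  eexp q (- (v * q ^ (2 * t + 1))) / eexp q (- q).
Proof.
pose H (x : int * int) : C := newton v x.1 * ((-1) ^ (x.1 + x.2) *
  q ^ ((x.1 + x.2) * (x.1 + x.2) + (x.1 + x.2) + 2 * t * (x.1 + x.2)) *
  rpoch q x.1 * rpoch q x.2).
have N10 : (-1 : C) != 0 by rewrite oppr_eq0 oner_eq0.
have nN1 n : `|(-1 : C) ^ n| = 1 by rewrite normr_exprz normrN1 exp1rz.
have aH : abssum H.
  (* Each factor of [newton v j] has modulus at most |v| + 1. *)
  have [L HL] := expr_small (`|v| + 1) (normq_gt0 q0) q1.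
  have [U [U0 HU]] := rpoch_bounded q0 q1.
  apply: (abssum_geo (g := fun x : int * int => (`|x.1| + `|x.2|)%N) (r := `|q|)
    (D := U * U) (K := 1)
    (c := 2 * (L%:Z + 2 * `|t| + 2) * (L%:Z + 2 * `|t| + 2))
    (X := fun x => (x.1 + x.2) * (x.1 + x.2) + (x.1 + x.2)
       + 2 * t * (x.1 + x.2) - (L%:Z * x.1))) => //.
  - by apply: geo_pair; exact: geo_absz.
  - exact: normq_gt0.
  move=> [[j|j] [k|k]]; rewrite /H /= ?mulr0 ?mul0r ?mulr0 ?eqxx // => _; split.
    rewrite [in leRHS]expfzDr ?gt_eqF ?(normq_gt0 q0) // !normrM nN1 normr_exprz mul1r.
    have -> : `|q| ^ (- (L%:Z * j)) = (`|q| ^+ L)^-1 ^+ j.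
      by rewrite -[L%:Z * j]/((L * j)%N%:Z) -exprnN exprM exprVn.
    have hN : `|newton v j| <= (`|q| ^+ L)^-1 ^+ j.
      rewrite /newton normr_prod -[j in X in _ <= X]card_ord -prodr_const.
      apply: ler_prod => i _ /=; rewrite normr_ge0 /=.
      apply: (@le_trans _ _ (`|v| + 1)).
        apply: le_trans (ler_normB _ _) _; rewrite lerD2l -exprM normrX.
        by rewrite exprn_ile1 // ltW.
      rewrite -[leRHS]div1r ler_pdivlMr ?exprn_gt0 ?normq_gt0 //.
      by move: HL; rewrite ger0_norm // addr_ge0.
    rewrite mulrC [leRHS]mulrA; apply: ler_pM => //; rewrite ?mulr_ge0 ?exprz_ge0 //.
    rewrite -mulrA mulrC ler_wpM2r ?exprz_ge0 //.
    by apply: ler_pM => //; [exact: (HU j) | exact: (HU k)].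
  nia.
have E0 := eexpNq_neq0 q0 q1.
have H1 j : csum (fun k => H (j, k)) = eexp q (- q) * (newton v j *
    ((-1) ^ j * q ^ (j * j + j + 2 * t * j) * rpoch q j * rpoch q (j + t))).
  rewrite (rpoch_eexp q0 q1 (j + t)).
  have eK (e n a b : C) : e != 0 -> e * (n * (a * (b / e))) = n * a * b.
    by move=> e0; rewrite mulrCA [e * _]mulrCA [e * _]mulrC divfK // mulrA.
  rewrite eK //.
  rewrite -csumZ; last exact: abssum_eexp.
  apply: eq_csum => k; rewrite /H /= expfzDr // expNrz exprz_exp.
  have -> : q ^ ((j + k) * (j + k) + (j + k) + 2 * t * (j + k)) =
    q ^ (j * j + j + 2 * t * j) * q ^ (k * k) * q ^ ((2 * (j + t) + 1) * k).
    by rewrite -!expfzDr //; congr (_ ^ _); ring.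
  ring.
apply: (mulfI E0); rewrite [RHS]mulrC divfK // -csumZ; last first.
  rewrite (_ : (fun _ => _) = fun j => (eexp q (- q))^-1 * csum (fun k => H (j, k))).
    exact/abssumZ/abssum_fubini.
  by apply/funext => j; rewrite H1 mulKf.
rewrite -(eq_csum H1) -csum_fubini //.
(* New variables m = j + k and j: the power of q depends on m alone, so [newton_vandermonde] sums
   over j and Euler's series in m is left. *)
rewrite (csum_bij (phi := fun x : int * int => (x.2, x.1 - x.2))
  (psi := fun x => (x.1 + x.2, x.1))); first last.
- by move=> [j k] /=; rewrite addrAC subrr add0r.
- by move=> [m j] /=; rewrite addrCA subrr addr0.
rewrite csum_fubini; last first.
  apply: (abssum_reindex (psi := fun x => (x.1 + x.2, x.1))) aH.
  by move=> [m j] /=; rewrite addrCA subrr addr0.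
apply: eq_csum => m; rewrite /H /=.
rewrite (@eq_csum _ _ _ (fun j : int => (-1) ^ m * q ^ (m * m + m + 2 * t * m) *
   (rpoch q j * rpoch q (m - j) * newton v j))); last first.
  by move=> j; rewrite [j + (m - j)]addrCA subrr addr0; ring.
rewrite csumZ; last exact: abssum_vandermonde.
rewrite newton_vandermonde [(- (v * _)) ^ _]expNrz expfzMl exprz_exp.
have -> : q ^ (m * m + m + 2 * t * m) = q ^ (m * m) * q ^ ((2 * t + 1) * m).
  by rewrite -expfzDr //; congr (_ ^ _); ring.
ring.
Qed.

(** The case v = 0 of [one_phi_one], where [newton 0 j] is a signed power of q. *)
Lemma durfee t :
  csum (fun j : int => q ^ (2 * j * j + 2 * t * j) * rpoch q j * rpoch q (j + t)) =
  (eexp q (- q))^-1.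
Proof.
have := one_phi_one 0 t; rewrite mul0r oppr0 eexp0 div1r => <-.
apply: eq_csum => -[j|j]; last by rewrite /= !(mulr0, mul0r).
have -> : newton 0 j = (-1) ^ j%:Z * q ^ (j%:Z * j%:Z - j%:Z).
  rewrite /newton /=; elim: j => [|j IH]; first by rewrite big_ord0 !expr0z mulr1.
  rewrite big_ord_recr {}IH /= sub0r -exprM.
  rewrite (exprS _ _ : (-1) ^ j.+1%:Z = _) -[(-1) ^ j%:Z]/((-1) ^+ j).
  have -> : q ^ (j.+1%:Z * j.+1%:Z - j.+1%:Z) = q ^ (j%:Z * j%:Z - j%:Z) * q ^+ (2 * j).
    by rewrite -[q ^+ (2 * j)]/(q ^ (2 * j)%N%:Z) -expfzDr //; congr (_ ^ _); lia.
  ring.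
have -> : q ^ (2 * j%:Z * j%:Z + 2 * t * j%:Z) =
    q ^ (j%:Z * j%:Z - j%:Z) * q ^ (j%:Z * j%:Z + j%:Z + 2 * t * j%:Z).
  by rewrite -expfzDr //; congr (_ ^ _); ring.
have s1 : (-1) ^ j%:Z * (-1) ^ j%:Z = 1 :> C.
  by rewrite -[(-1) ^ j%:Z]/((-1) ^+ j) -expr2 sqrr_sign.
have h (s x y z w : C) : s * s = 1 -> x * y * z * w = s * x * (s * y * z * w).
  by move=> ss; rewrite -[LHS]mul1r -[X in X * _]ss; ring.
exact: h.
Qed.

(** Multiply the two Euler series and collect v^n: the coefficient is q^(n^2) times the sum in
    [durfee], whose value does not depend on n. *)
Lemma jacobi_triple v : v != 0 ->
  theta q v = eexp q (- q) * eexp q v * eexp q v^-1.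
Proof.
move=> v0; have E0 := eexpNq_neq0 q0 q1.
pose F (x : int * int) : C := (q ^ (x.1 * x.1) * v ^ x.1 * rpoch q x.1) *
  (q ^ (x.2 * x.2) * v^-1 ^ x.2 * rpoch q x.2).
have aF : abssum F := abssumM (abssum_eexp q0 q1 v) (abssum_eexp q0 q1 v^-1).
have -> : eexp q (- q) * eexp q v * eexp q v^-1 = eexp q (- q) * csum F.
  by rewrite -mulrA; congr (_ * _); exact: esym (csumM (abssum_eexp _ _ _) (abssum_eexp _ _ _)).
rewrite (csum_bij (phi := fun x : int * int => (x.1 + x.2, x.2))
  (psi := fun x => (x.1 - x.2, x.2))); first last.
- by move=> [m j] /=; rewrite subrK.
- by move=> [m j] /=; rewrite addrK.
rewrite csum_fubini; last first.
  apply: (abssum_reindex (psi := fun x => (x.1 - x.2, x.2))) aF.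
  by move=> [m j] /=; rewrite addrK.
rewrite /theta -csumZ; last first.
  rewrite (_ : (fun _ => _) = fun n => csum (fun j => F (n + j, j))).
    apply: (abssum_fubini (f := fun x => F (x.1 + x.2, x.2))).
    apply: (abssum_reindex (psi := fun x => (x.1 - x.2, x.2))) aF.
    by move=> [m j] /=; rewrite addrK.
  by [].
apply: eq_csum => n /=.
rewrite (@eq_csum _ _ _ (fun j : int => q ^ (n * n) * v ^ n *
  (q ^ (2 * j * j + 2 * n * j) * rpoch q j * rpoch q (j + n)))); last first.
  move=> j; rewrite /F /= exprz_inv [v ^ (n + j)]expfzDr // [n + j]addrC.
  have qE : q ^ ((j + n) * (j + n)) * q ^ (j * j) =
      q ^ (n * n) * q ^ (2 * j * j + 2 * n * j).
    by rewrite -!expfzDr //; congr (_ ^ _); ring.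
  have vj : v ^ j * v ^ (- j) = 1 by rewrite -expfzDr // subrr expr0z.
  transitivity ((q ^ ((j + n) * (j + n)) * q ^ (j * j)) * (v ^ j * v ^ (- j)) *
    v ^ n * rpoch q (j + n) * rpoch q j); first by ring.
  by rewrite qE vj; ring.
rewrite csumZ.
  by rewrite durfee [RHS]mulrC -mulrA mulVf ?mulr1.
have [U [U0 HU]] := rpoch_bounded q0 q1.
rewrite (_ : (fun _ => _) = fun j : int => q ^ (2 * j * j + 2 * n * j) *
  (rpoch q j * rpoch q (j + n))); last by apply/funext => j; rewrite mulrA.
apply: (abssum_qpow (g := fun j : int => `|j|%N) (K := 1)
  (c := (2 * `|n| + 1) * (2 * `|n| + 1)) (D := U * U)) => //.
- exact: geo_absz.
- by move=> j; rewrite normrM; apply: ler_pM.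
- by move=> j _; nia.
Qed.
End ThetaFunctions.

(** * Bailey pairs relative to (q^2; q^2)_(2n) *)

Section FiniteIdentities.
Context {R : realType}.
Local Notation C := R[i].

(** For nonzero [c] the two families are summable together; otherwise both sides are the default
    value 0 of [csum]. *)
Lemma csum_scale {I : choiceType} (c : C) (f : I -> C) :
  csum (fun i => c * f i) = c * csum f.
Proof.
have [->|c0] := eqVneq c 0.
  by rewrite mul0r -[RHS](@csum0 _ I); apply: eq_csum => i; rewrite mul0r.
have [[s fs]|nf] := pselect (exists s, has_csum f s).
  by rewrite (csumE fs) (csumE (has_csumZ c fs)).
rewrite [X in _ = _ * X]xgetPN; last by move=> s fs; apply: nf; exists s.
rewrite mulr0 [LHS]xgetPN // => s /(has_csumZ c^-1) fs; apply: nf.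
exists (c^-1 * s); move: fs; congr has_csum; apply/funext => i.
by rewrite mulKf.
Qed.

Lemma csum_telescope (f g x : int -> C) : abssum g -> abssum x ->
  (forall n, f n = g n + (x n - x (n - 1))) -> csum f = csum g.
Proof.
move=> ag ax fE; have ax1 : abssum (fun n => x (n - 1)).
  by apply: (abssum_reindex (psi := fun n => n + 1)) ax => n; rewrite subrK.
rewrite (eq_csum fE) csumD //; last exact: abssumB.
by rewrite csumB // -(csum_shift (-1) x) subrr addr0.
Qed.

Context (q : C) (q0 : q != 0) (q1 : `|q| < 1).

Local Notation u := (rpoch q).

Lemma subr1_exprz_neq0 (k : int) : k != 0 -> 1 - q ^ k != 0.
Proof.
case: k => [n|n] n0; first by rewrite subr1_expn_neq0 // lt0n.
rewrite NegzE -exprnN -(inj_eq (mulfI (expf_neq0 n.+1 q0))) mulr0 mulrBr mulr1.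
by rewrite divff ?expf_neq0 // -opprB oppr_eq0 subr1_expn_neq0.
Qed.

Lemma abssum_rpoch2 (X a b : int -> int) (c : int) :
  (forall m, (`|m|%N)%:Z <= X m + c) ->
  abssum (fun m => q ^ X m * (u (a m) * u (b m))).
Proof.
move=> hX; have [U [U0 HU]] := rpoch_bounded q0 q1.
apply: (abssum_qpow q0 q1 (g := fun m : int => `|m|%N) (K := 1) (c := c) (D := U * U)) => //.
- exact: geo_absz.
- by move=> m; rewrite normrM; apply: ler_pM.
- by move=> m _; rewrite mul1r.
Qed.

(** Slater's Bailey pair for u(2n) in base Q, with products u(n - r) u(n + r) at r = 3m and r = 3m -
    1. The class r = 3m + 1 is covered by the symmetry r -> - r. *)
Definition fin_even (n m : int) : C :=
  q ^ (12 * m * m + 2 * m) * (u (n - 3 * m) * u (n + 3 * m)) -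
  q ^ (12 * m * m - 10 * m + 2) * (u (n - (3 * m - 1)) * u (n + (3 * m - 1))).

Definition fin_odd (n m : int) : C :=
  q ^ (12 * m * m + 2 * m) * (u (n - 3 * m) * u (n + 3 * m + 1)) -
  q ^ (12 * m * m - 10 * m + 2) * (u (n - (3 * m - 2)) * u (n + (3 * m - 2) + 1)).

Lemma abssum_fin_even n : abssum (fin_even n).
Proof.
by apply: abssumB; apply: (abssum_rpoch2 _ _ (c := 10)) => m; nia.
Qed.

(** Together with [fin_even_odd] this shows that the sums of [fin_even] and [fin_odd] obey the
    recurrences of u(2n) and u(2n + 1). Here the leftover cross terms belong to neighbouring [m] and
    telescope through [x]. *)
Lemma fin_odd_even n : (1 - q ^ (2 * (2 * n + 1))) * csum (fin_odd n) =
  csum (fin_even n).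
Proof.
rewrite -csum_scale; pose x (m : int) : C :=
  q ^ (12 * m * m + 8 * m + 2 * n + 2) * (u (n - 3 * m - 1) * u (n + 3 * m + 1)).
apply: (csum_telescope (x := x)); first exact: abssum_fin_even.
  by apply: (abssum_rpoch2 _ _ (c := `|2 * n| + 10)) => m; nia.
move=> m; rewrite /fin_odd mulrBr !(mulrCA (1 - _) (q ^ _)).
have h1 := rpochM_pred q0 q1 (n + 3 * m + 1) (n - 3 * m).
have h2 := rpochM_pred q0 q1 (n - (3 * m - 2)) (n + (3 * m - 2) + 1).
have e1 : n + 3 * m + 1 + (n - 3 * m) = 2 * n + 1 by ring.
have e2 : n - (3 * m - 2) + (n + (3 * m - 2) + 1) = 2 * n + 1 by ring.
rewrite e1 in h1; rewrite e2 in h2; rewrite [u (n - 3 * m) * _]mulrC h1 h2.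
rewrite /fin_even /x.
have -> : n + 3 * m + 1 - 1 = n + 3 * m by ring.
have -> : n - (3 * m - 2) - 1 = n - (3 * m - 1) by ring.
have -> : n + (3 * m - 2) + 1 - 1 = n + (3 * m - 2) by ring.
have -> : n + (3 * m - 2) + 1 = n + (3 * m - 1) by ring.
have -> : n - 3 * (m - 1) - 1 = n - (3 * m - 2) by ring.
have -> : n + 3 * (m - 1) + 1 = n + (3 * m - 2) by ring.
have -> : 12 * (m - 1) * (m - 1) + 8 * (m - 1) + 2 * n + 2 =
  (12 * m * m - 10 * m + 2) + 2 * (n - (3 * m - 2)) by ring.
have -> : 12 * m * m + 8 * m + 2 * n + 2 =
  (12 * m * m + 2 * m) + 2 * (n + 3 * m + 1) by ring.
rewrite (expfzDr (12 * m * m - 10 * m + 2) (2 * (n - (3 * m - 2))) q0).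
rewrite (expfzDr (12 * m * m + 2 * m) (2 * (n + 3 * m + 1)) q0).
ring.
Qed.

(** The two products are split in opposite orders, so that the cross terms carry the same power of q
    and cancel for each [m]. *)
Lemma fin_even_odd n : (1 - q ^ (2 * (2 * n + 2))) * csum (fin_even (n + 1)) =
  csum (fin_odd n).
Proof.
rewrite -csum_scale; apply: eq_csum => m.
rewrite /fin_even mulrBr !(mulrCA (1 - _) (q ^ _)).
have h1 := rpochM_pred q0 q1 (n + 1 - 3 * m) (n + 1 + 3 * m).
have h2 := rpochM_pred q0 q1 (n + 1 + (3 * m - 1)) (n + 1 - (3 * m - 1)).
have e1 : n + 1 - 3 * m + (n + 1 + 3 * m) = 2 * n + 2 by ring.
have e2 : n + 1 + (3 * m - 1) + (n + 1 - (3 * m - 1)) = 2 * n + 2 by ring.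
rewrite e1 in h1; rewrite e2 in h2.
rewrite [u (n + 1 - (3 * m - 1)) * _]mulrC h1 h2 /fin_odd.
have -> : n + 1 - 3 * m - 1 = n - 3 * m by ring.
have -> : n + 1 + 3 * m - 1 = n + 3 * m by ring.
have -> : n + 1 + (3 * m - 1) - 1 = n + (3 * m - 2) + 1 by ring.
have -> : n + 1 + (3 * m - 1) = n + 3 * m by ring.
have -> : n + 1 - (3 * m - 1) - 1 = n + 1 - 3 * m by ring.
have -> : n + 1 - (3 * m - 1) = n - (3 * m - 2) by ring.
have -> : n + 1 + 3 * m = n + 3 * m + 1 by ring.
have -> : q ^ (12 * m * m - 10 * m + 2) = q ^ (12 * m * m + 2 * m) * q ^ (2 - 12 * m).
  by rewrite -!expfzDr //; congr (_ ^ _); ring.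
have -> : q ^ (2 * (n + 1 - 3 * m)) = q ^ (2 * (n + 3 * m)) * q ^ (2 - 12 * m).
  by rewrite -!expfzDr //; congr (_ ^ _); ring.
ring.
Qed.

Lemma rpochM_lt0 (k l : int) : k + l < 0 -> u k * u l = 0.
Proof.
move=> kl; have [k0|k0] := ltP k 0; first by rewrite rpoch_lt0 ?mul0r.
by rewrite (@rpoch_lt0 _ q l) ?mulr0 //; lia.
Qed.

Lemma rpochMN (k : int) : k != 0 -> u (- k) * u k = 0.
Proof.
move=> k0; have [kn|kp] := ltP k 0; first by rewrite (@rpoch_lt0 _ q k) ?mulr0.
by rewrite (@rpoch_lt0 _ q (- k)) ?mul0r //; lia.
Qed.

Lemma fin_evenE n : csum (fin_even n) = u (2 * n).
Proof.
case: n => n; last first.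
  rewrite rpoch_lt0 // -[RHS](@csum0 _ int); apply: eq_csum => m.
  by rewrite /fin_even !rpochM_lt0 ?mulr0 ?subrr //; lia.
elim: n => [|n IH].
  (* At n = 0 a product u(- r) u(r) survives only for r = 0, that is m = 0 in the first half of
     [fin_even]. *)
  rewrite -[0%N%:Z]/(0 : int) (csum_single (i0 := 0)) => [|m m0]; rewrite /fin_even.
    rewrite !mulr0 !(sub0r, add0r) expr0z oppr0 !rpoch0; ring.
  rewrite !(sub0r, add0r) !rpochMN ?mulr0 ?subrr //; lia.
have n0 : 1 - q ^ (2 * (2 * n%:Z + 2)) != 0 by apply: subr1_exprz_neq0; lia.
apply: (mulfI n0); rewrite (_ : n.+1%:Z = n%:Z + 1); last by lia.
rewrite fin_even_odd; have n1 : 1 - q ^ (2 * (2 * n%:Z + 1)) != 0.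
  by apply: subr1_exprz_neq0; lia.
apply: (mulfI n1); rewrite fin_odd_even IH.
have := rpoch_pred q0 q1 (2 * n%:Z + 1); rewrite addrK => ->.
rewrite (_ : 2 * (n%:Z + 1) = 2 * n%:Z + 2); last by ring.
have := rpoch_pred q0 q1 (2 * n%:Z + 2).
by rewrite (_ : 2 * n%:Z + 2 - 1 = 2 * n%:Z + 1) => [->|]; last by ring.
Qed.

Lemma fin_oddE n : csum (fin_odd n) = u (2 * n + 1).
Proof.
have n1 : 1 - q ^ (2 * (2 * n + 1)) != 0 by apply: subr1_exprz_neq0; lia.
apply: (mulfI n1); rewrite fin_odd_even fin_evenE.
by have := rpoch_pred q0 q1 (2 * n + 1); rewrite addrK.
Qed.

(** The expansion of u(2n) is moved to the products u(n - r) u(n + r + 1), as needed for the kernel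
    with d = 1, by u(k - 1) = (1 - Q^k) u(k). *)
Lemma fin_even_shifted n : u (2 * n) = csum (fun r =>
  q ^ (12 * r * r - 2 * r) * (u (n - 3 * r) * u (n + 3 * r + 1)) -
  q ^ (12 * r * r + 10 * r + 2) * (u (n - 3 * r) * u (n + 3 * r + 1))).
Proof.
rewrite -fin_evenE csum_opp; apply: eq_csum => r; rewrite /fin_even.
have -> : n - 3 * - r = n + 3 * r + 1 - 1 by ring.
have -> : n + 3 * - r = n - 3 * r by ring.
have -> : n - (3 * - r - 1) = n + 3 * r + 1 by ring.
have -> : n + (3 * - r - 1) = n - 3 * r - 1 by ring.
rewrite !rpoch_pred //.
have -> : 12 * - r * - r + 2 * - r = 12 * r * r - 2 * r by ring.
have -> : 12 * - r * - r - 10 * - r + 2 = 12 * r * r + 10 * r + 2 by ring.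
have qE : q ^ (12 * r * r - 2 * r) * q ^ (2 * (n + 3 * r + 1)) =
    q ^ (12 * r * r + 10 * r + 2) * q ^ (2 * (n - 3 * r)).
  by rewrite -!expfzDr //; congr (_ ^ _); ring.
transitivity (q ^ (12 * r * r - 2 * r) * (u (n - 3 * r) * u (n + 3 * r + 1)) -
  q ^ (12 * r * r + 10 * r + 2) * (u (n - 3 * r) * u (n + 3 * r + 1)) -
  (q ^ (12 * r * r - 2 * r) * q ^ (2 * (n + 3 * r + 1)) -
   q ^ (12 * r * r + 10 * r + 2) * q ^ (2 * (n - 3 * r))) *
  (u (n - 3 * r) * u (n + 3 * r + 1))); first by ring.
by rewrite qE subrr mul0r subr0.
Qed.

(** After multiplication by 1 - Q^(2n + 1) both sides are expansions of Q^n u(2n), and they differ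
    by a telescoping term. *)
Lemma fin_odd_scaled n : q ^ (2 * n) * u (2 * n + 1) = csum (fun r =>
  q ^ (12 * r * r + 8 * r) * (u (n - 3 * r) * u (n + 3 * r + 1)) -
  q ^ (12 * r * r + 8 * r) * (u (n - (3 * r + 1)) * u (n + (3 * r + 1) + 1))).
Proof.
have n1 : 1 - q ^ (2 * (2 * n + 1)) != 0 by apply: subr1_exprz_neq0; lia.
apply: (mulfI n1); rewrite mulrCA -csum_scale.
have := rpoch_pred q0 q1 (2 * n + 1); rewrite addrK => <-.
rewrite -fin_evenE -csum_scale; symmetry.
pose x (m : int) : C := - q ^ (2 * n) * (q ^ (12 * m * m + 14 * m + 4) *
  (u (n - 3 * m - 2) * u (n + 3 * m + 2))).
apply: (csum_telescope (x := x)); first exact/abssumZ/abssum_fin_even.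
  by apply: abssumZ; apply: (abssum_rpoch2 _ _ (c := 20)) => m; nia.
move=> r; rewrite mulrBr !(mulrCA (1 - _) (q ^ _)).
have h1 := rpochM_pred q0 q1 (n - 3 * r) (n + 3 * r + 1).
have h2 := rpochM_pred q0 q1 (n + (3 * r + 1) + 1) (n - (3 * r + 1)).
have e1 : n - 3 * r + (n + 3 * r + 1) = 2 * n + 1 by ring.
have e2 : n + (3 * r + 1) + 1 + (n - (3 * r + 1)) = 2 * n + 1 by ring.
rewrite e1 in h1; rewrite e2 in h2.
rewrite [u (n - (3 * r + 1)) * _]mulrC h1 h2 /fin_even /x.
have -> : n + 3 * r + 1 - 1 = n + 3 * r by ring.
have -> : n + (3 * r + 1) + 1 - 1 = n + 3 * r + 1 by ring.
have -> : n + (3 * r + 1) + 1 = n + 3 * r + 2 by ring.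
have -> : n - (3 * r + 1) - 1 = n - 3 * r - 2 by ring.
have -> : n - (3 * r + 1) = n - 3 * r - 1 by ring.
have -> : n - 3 * (r - 1) - 2 = n - (3 * r - 1) by ring.
have -> : n + 3 * (r - 1) + 2 = n + (3 * r - 1) by ring.
have -> : 12 * (r - 1) * (r - 1) + 14 * (r - 1) + 4 = 12 * r * r - 10 * r + 2 by ring.
have -> : q ^ (2 * (n - 3 * r)) = q ^ (2 * n) * q ^ (- (6 * r)).
  by rewrite -!expfzDr //; congr (_ ^ _); ring.
have -> : q ^ (12 * r * r + 2 * r) = q ^ (12 * r * r + 8 * r) * q ^ (- (6 * r)).
  by rewrite -!expfzDr //; congr (_ ^ _); ring.
have -> : q ^ (2 * (n + 3 * r + 2)) = q ^ (2 * n) * q ^ (6 * r + 4).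
  by rewrite -!expfzDr //; congr (_ ^ _); ring.
have -> : q ^ (12 * r * r + 14 * r + 4) = q ^ (12 * r * r + 8 * r) * q ^ (6 * r + 4).
  by rewrite -!expfzDr //; congr (_ ^ _); ring.
ring.
Qed.

Lemma fin_even_scaled n : q ^ (2 * n) * u (2 * n) = csum (fun r =>
  q ^ (12 * r * r + 4 * r) * (u (n - 3 * r) * u (n + 3 * r)) -
  q ^ (12 * r * r + 4 * r) * (u (n - (3 * r + 1)) * u (n + (3 * r + 1)))).
Proof.
(* The factor 1 - Q^(2n) used below vanishes at n = 0. *)
have [->|n0] := eqVneq n 0.
  rewrite (csum_single (i0 := 0)) => [|m m0].
    by rewrite !mulr0 !(sub0r, add0r) ?oppr0 expr0z !rpoch0 (@rpoch_lt0 _ q (-1)) //; ring.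
  rewrite !(sub0r, add0r) !rpochMN ?mulr0 ?subrr //; lia.
have n1 : 1 - q ^ (2 * (2 * n)) != 0 by apply: subr1_exprz_neq0; lia.
apply: (mulfI n1); rewrite mulrCA -csum_scale.
have := rpoch_pred q0 q1 (2 * n) => <-.
rewrite (_ : 2 * n - 1 = 2 * (n - 1) + 1); last by ring.
rewrite -fin_oddE -csum_scale csum_opp; apply: eq_csum => r.
rewrite [RHS]mulrBr !(mulrCA (1 - _) (q ^ _)).
have h1 := rpochM_pred q0 q1 (n - 3 * r) (n + 3 * r).
have h2 := rpochM_pred q0 q1 (n + (3 * r + 1)) (n - (3 * r + 1)).
have e1 : n - 3 * r + (n + 3 * r) = 2 * n by ring.
have e2 : n + (3 * r + 1) + (n - (3 * r + 1)) = 2 * n by ring.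
rewrite e1 in h1; rewrite e2 in h2.
rewrite [u (n - (3 * r + 1)) * _]mulrC h1 h2 /fin_odd.
have -> : n - 1 - 3 * - r = n + 3 * r - 1 by ring.
have -> : n - 1 + 3 * - r + 1 = n - 3 * r by ring.
have -> : n - 1 - (3 * - r - 2) = n + (3 * r + 1) by ring.
have -> : n - 1 + (3 * - r - 2) + 1 = n - (3 * r + 1) - 1 by ring.
have -> : n + (3 * r + 1) - 1 = n + 3 * r by ring.
have -> : n - (3 * r + 1) = n - 3 * r - 1 by ring.
have -> : 12 * - r * - r + 2 * - r = 12 * r * r - 2 * r by ring.
have -> : 12 * - r * - r - 10 * - r + 2 = 12 * r * r + 10 * r + 2 by ring.
have -> : q ^ (2 * (n - 3 * r)) = q ^ (2 * n) * q ^ (- (6 * r)).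
  by rewrite -!expfzDr //; congr (_ ^ _); ring.
have -> : q ^ (12 * r * r - 2 * r) = q ^ (12 * r * r + 4 * r) * q ^ (- (6 * r)).
  by rewrite -!expfzDr //; congr (_ ^ _); ring.
have -> : q ^ (2 * (n + (3 * r + 1))) = q ^ (2 * n) * q ^ (6 * r + 2).
  by rewrite -!expfzDr //; congr (_ ^ _); ring.
have -> : q ^ (12 * r * r + 10 * r + 2) = q ^ (12 * r * r + 4 * r) * q ^ (6 * r + 2).
  by rewrite -!expfzDr //; congr (_ ^ _); ring.
ring.
Qed.
End FiniteIdentities.

(** * A conjugate Bailey pair *)

Section SlaterSums.
Context {R : realType}.
Local Notation C := R[i].
Context (q : C) (q0 : q != 0) (q1 : `|q| < 1).

Local Notation u := (rpoch q).
Local Notation poch v n := (qpoch (- (q * v)) (q ^+ 2) n).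

Lemma qpoch_add (a p : C) m n :
  qpoch a p (m + n) = qpoch a p m * qpoch (a * p ^+ m) p n.
Proof.
elim: n => [|n IH]; first by rewrite addn0 [qpoch _ _ 0]big_ord0 mulr1.
by rewrite addnS !qpochS IH -mulrA exprD !mulrA.
Qed.

(** At v = - 1 / (q w) the Newton basis becomes the Pochhammer symbol of Slater's sums, up to powers
    and signs. *)
Lemma newtonV (w : C) (j : nat) : w != 0 ->
  newton q (- (q * w)^-1) j = (-1) ^+ j * (q * w) ^- j * poch w j.
Proof.
move=> w0; have qw0 : q * w != 0 by rewrite mulf_neq0.
rewrite /newton /=; elim: j => [|j IH]; first by rewrite /qpoch !big_ord0 !expr0 invr1 !mulr1.
rewrite big_ord_recr {}IH qpochS (exprS (-1) j) (exprSr (q * w) j) [((q * w) ^+ j * _)^-1]invfM /=.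
have -> : - (q * w)^-1 - (q ^+ 2) ^+ j =
    - (q * w)^-1 * (1 - - (q * w) * (q ^+ 2) ^+ j).
  by rewrite !mulNr opprK mulrDr mulr1 mulrA mulVf // mul1r opprD.
move: (q * w)^-1 ((q * w) ^- j) (poch w j) (1 - _) => a b c d; ring.
Qed.

Lemma conj_bailey (w : C) (t : int) : w != 0 ->
  csum (fun j : int => poch w `|j| * w ^ (- j) * q ^ (j * j + 2 * t * j) *
    (u j * u (j + t))) = eexp q (w^-1 * q ^ (2 * t)) / eexp q (- q).
Proof.
move=> w0; have -> : w^-1 * q ^ (2 * t) = - (- (q * w)^-1 * q ^ (2 * t + 1)).
  rewrite mulNr opprK invfM expfzDr // expr1z mulrA mulrAC; congr (_ * _).
  by rewrite mulrAC mulVf ?mul1r.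
rewrite -one_phi_one //; apply: eq_csum => -[j|j]; last by rewrite /= !(mul0r, mulr0).
rewrite newtonV // -exprnN exprMn invfM.
have -> : q ^ (j%:Z * j + j + 2 * t * j) = q ^+ j * q ^ (j%:Z * j + 2 * t * j).
  by rewrite -[q ^+ j]/(q ^ j%:Z) -expfzDr //; congr (_ ^ _); ring.
have qj : q ^- j * q ^+ j = 1 by rewrite mulVf ?expf_neq0.
have s1 : (-1) ^+ j * (-1) ^+ j = 1 :> C by rewrite -expr2 sqrr_sign.
rewrite -[(-1) ^ j%:Z]/((-1) ^+ j); move: (poch w j) => p.
transitivity (((-1) ^+ j * (-1) ^+ j) * (q ^- j * q ^+ j) * (p * w ^- j *
  q ^ (j%:Z * j%:Z + 2 * t * j%:Z) * (u j%:Z * u (j%:Z + t)))); last by ring.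
by rewrite s1 qj !mul1r.
Qed.

(** [conj_bailey] at w = v Q^s with j = n - s: the factor (- q v; Q)_s completes the symbol to
    length n. *)
Lemma conj_bailey_shift (v : C) (s : nat) (t : int) : v != 0 ->
  csum (fun n : int => poch v `|n| * v ^ (- n) *
    q ^ (n * n + (2 * t - 4 * s%:Z) * n) * (u (n - s%:Z) * u (n - s%:Z + t))) =
  poch v s * v ^ (- s%:Z) * q ^ (2 * t * s%:Z - 3 * s%:Z * s%:Z) *
  (eexp q (v^-1 * q ^ (2 * t - 2 * s%:Z)) / eexp q (- q)).
Proof.
move=> v0; have w0 : v * q ^ (2 * s%:Z) != 0 by rewrite mulf_neq0 // expfz_neq0.
have -> : v^-1 * q ^ (2 * t - 2 * s%:Z) = (v * q ^ (2 * s%:Z))^-1 * q ^ (2 * t).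
  by rewrite invfM -mulrA expfzDr // [q ^ (2 * t) * _]mulrC -exprz_inv exprz_inv invr_expz.
rewrite -conj_bailey // -csum_scale (csum_shift s%:Z); apply: eq_csum => j.
rewrite addrK; case: j => [j|j]; last by rewrite !mul0r !mulr0.
have -> : absz (j%:Z + s%:Z) = (s + j)%N by lia.
rewrite qpoch_add.
have -> : - (q * v) * (q ^+ 2) ^+ s = - (q * (v * q ^ (2 * s%:Z))).
  by rewrite mulNr -exprM mulrA.
rewrite expfzMl exprz_exp opprD expfzDr //.
have -> : q ^ ((j%:Z + s%:Z) * (j%:Z + s%:Z) + (2 * t - 4 * s%:Z) * (j%:Z + s%:Z)) =
    q ^ (2 * t * s%:Z - 3 * s%:Z * s%:Z) * q ^ (2 * s%:Z * - j%:Z) *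
    q ^ (j%:Z * j%:Z + 2 * t * j%:Z).
  by rewrite -!expfzDr //; congr (_ ^ _); ring.
rewrite /=; ring.
Qed.

(** With v = q^d and t = 2s + d, the factor (- q v; Q)_s completes E(q^(d + 2s)) to E(q^d). The
    dependence on [s] is then a pure quadratic power, which is what turns Bailey's method into theta
    series. *)
Lemma conj_bailey_nat (d s : nat) :
  csum (fun n : int => q ^ (n * n + d%:Z * n) * poch (q ^+ d) `|n| *
    (u (n - s%:Z) * u (n + s%:Z + d%:Z))) =
  q ^ (s%:Z * s%:Z + d%:Z * s%:Z) * (eexp q (q ^+ d) / eexp q (- q)).
Proof.
have v0 : q ^+ d != 0 by rewrite expf_neq0.
have := conj_bailey_shift s (2 * s%:Z + d%:Z) v0.
have -> : (q ^+ d)^-1 * q ^ (2 * (2 * s%:Z + d%:Z) - 2 * s%:Z) =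
    q ^+ d * q ^+ (2 * s).
  rewrite exprnN -[q ^+ d]/(q ^ d%:Z) -[q ^+ (2 * s)]/(q ^ (2 * s)%N%:Z).
  by rewrite -!expfzDr //; congr (_ ^ _); lia.
have -> A : poch (q ^+ d) s * A * q ^ (2 * (2 * s%:Z + d%:Z) * s%:Z - 3 * s%:Z * s%:Z) *
    (eexp q (q ^+ d * q ^+ (2 * s)) / eexp q (- q)) =
    A * q ^ (2 * (2 * s%:Z + d%:Z) * s%:Z - 3 * s%:Z * s%:Z) *
    (eexp q (q ^+ d) / eexp q (- q)).
  by rewrite (eexp_qpoch q0 q1 (q ^+ d) s); ring.
rewrite -[(q ^+ d) ^ (- s%:Z)]/((q ^ d%:Z) ^ (- s%:Z)) exprz_exp -expfzDr //.
have -> : d%:Z * - s%:Z + (2 * (2 * s%:Z + d%:Z) * s%:Z - 3 * s%:Z * s%:Z) =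
  s%:Z * s%:Z + d%:Z * s%:Z by ring.
move=> <-; apply: eq_csum => n.
rewrite -[(q ^+ d) ^ (- n)]/((q ^ d%:Z) ^ (- n)) exprz_exp.
have -> : n - s%:Z + (2 * s%:Z + d%:Z) = n + s%:Z + d%:Z by ring.
have -> : q ^ (n * n + d%:Z * n) = q ^ (d%:Z * - n) *
    q ^ (n * n + (2 * (2 * s%:Z + d%:Z) - 4 * s%:Z) * n).
  by rewrite -expfzDr //; congr (_ ^ _); ring.
ring.
Qed.

Lemma kernel_even (s : int) :
  csum (fun n : int => q ^ (n * n) * poch 1 `|n| * (u (n - s) * u (n + s))) =
  q ^ (s * s) * (eexp q 1 / eexp q (- q)).
Proof.
have h (k : nat) : csum (fun n : int => q ^ (n * n) * poch 1 `|n| *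
    (u (n - k%:Z) * u (n + k%:Z))) = q ^ (k%:Z * k%:Z) * (eexp q 1 / eexp q (- q)).
  have := conj_bailey_nat 0 k; rewrite mul0r addr0 expr0 => <-.
  by apply: eq_csum => n; rewrite mul0r !addr0.
case: s => k; first exact: h.
(* Negative [s] follow from the symmetry s -> - s of the product u(n - s) u(n + s); in the two
   kernels below the symmetry is s -> - 1 - s. *)
rewrite (_ : Negz k * Negz k = k.+1%:Z * k.+1%:Z); last by lia.
rewrite -h; apply: eq_csum => n; rewrite NegzE opprK; congr (_ * _).
by rewrite mulrC.
Qed.

Lemma kernel_odd (s : int) :
  csum (fun n : int => q ^ (n * n + n) * poch q `|n| * (u (n - s) * u (n + s + 1))) =
  q ^ (s * s + s) * (eexp q q / eexp q (- q)).
Proof.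
have h (k : nat) : csum (fun n : int => q ^ (n * n + n) * poch q `|n| *
    (u (n - k%:Z) * u (n + k%:Z + 1))) = q ^ (k%:Z * k%:Z + k%:Z) *
    (eexp q q / eexp q (- q)).
  have := conj_bailey_nat 1 k; rewrite mul1r expr1 => <-.
  by apply: eq_csum => n; rewrite mul1r.
case: s => k; first exact: h.
rewrite (_ : Negz k * Negz k + Negz k = k%:Z * k%:Z + k%:Z); last by lia.
rewrite -h; apply: eq_csum => n; congr (_ * _); rewrite mulrC.
by congr (u _ * u _); lia.
Qed.

(** [conj_bailey_shift] at v = 1, s + 1 and t = 2s + 1, with n moved by one. The Euler product
    E(q^(2s)) lacks one factor to match the Pochhammer symbol of length s + 1, whence 1 + q^(2s +
    1). *)
Lemma kernel_odd_shift (s : int) :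
  csum (fun n : int => q ^ (n * n) * poch 1 `|n + 1| *
    (u (n - s) * u (n + s + 1))) =
  q ^ (s * s) * (1 + q ^ (2 * s + 1)) * (eexp q 1 / eexp q (- q)).
Proof.
have h (k : nat) : csum (fun n : int => q ^ (n * n) * poch 1 `|n + 1| *
    (u (n - k%:Z) * u (n + k%:Z + 1))) = q ^ (k%:Z * k%:Z) *
    (1 + q ^ (2 * k%:Z + 1)) * (eexp q 1 / eexp q (- q)).
  have := conj_bailey_shift k.+1 (2 * k%:Z + 1) (oner_neq0 C).
  rewrite invr1 exp1rz mul1r.
  have -> : q ^ (2 * (2 * k%:Z + 1) - 2 * k.+1%:Z) = q ^ (2 * k%:Z).
    by congr (_ ^ _); lia.
  have -> : 2 * (2 * k%:Z + 1) * k.+1%:Z - 3 * k.+1%:Z * k.+1%:Z = k%:Z * k%:Z - 1 by lia.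
  rewrite (csum_shift 1) => h1.
  transitivity (q * csum (fun j : int => poch 1 `|j + 1| * 1 ^ (- (j + 1)) *
    q ^ ((j + 1) * (j + 1) + (2 * (2 * k%:Z + 1) - 4 * k.+1%:Z) * (j + 1)) *
    (u (j + 1 - k.+1%:Z) * u (j + 1 - k.+1%:Z + (2 * k%:Z + 1))))).
    rewrite -csum_scale; apply: eq_csum => n; rewrite exp1rz mulr1.
    have -> : n + 1 - k.+1%:Z + (2 * k%:Z + 1) = n + k%:Z + 1 by lia.
    have -> : n + 1 - k.+1%:Z = n - k%:Z by lia.
    have -> : q ^ (n * n) = q ^ 1 *
        q ^ ((n + 1) * (n + 1) + (2 * (2 * k%:Z + 1) - 4 * k.+1%:Z) * (n + 1)).
      by rewrite -expfzDr //; congr (_ ^ _); lia.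
    by rewrite expr1z; ring.
  rewrite h1 (eexp_qpoch q0 q1 1 k.+1) qpochS.
  rewrite (eexp_shift q0 q1 (q ^ (2 * k%:Z))) mul1r.
  have -> : q ^ (k%:Z * k%:Z) = q ^ (k%:Z * k%:Z - 1) * q ^ 1.
    by rewrite -expfzDr //; congr (_ ^ _); ring.
  have -> : q ^ (2 * k%:Z + 1) = q ^ (2 * k%:Z) * q by rewrite expfzDr // expr1z.
  have -> : q ^+ 2 * q ^ (2 * k%:Z) = q ^+ (2 * k.+1).
    by rewrite -[q ^ (2 * k%:Z)]/(q ^+ (2 * k)%N) -exprD; congr (_ ^+ _); lia.
  have -> : q ^ (2 * k%:Z) = (q ^+ 2) ^+ k by rewrite -exprM.
  by rewrite expr1z; ring.
case: s => k; first exact: h.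
have -> : q ^ (Negz k * Negz k) * (1 + q ^ (2 * Negz k + 1)) =
    q ^ (k%:Z * k%:Z) * (1 + q ^ (2 * k%:Z + 1)).
  rewrite !mulrDr !mulr1 -!expfzDr // addrC.
  by congr (_ ^ _ + _ ^ _); lia.
rewrite -h; apply: eq_csum => n; congr (_ * _); rewrite mulrC.
by congr (u _ * u _); lia.
Qed.

Lemma abssum_bailey (h : int -> C) (H : C) (d e c : int) (X s : int -> int) :
  0 <= e <= 1 -> (forall n, `|h n| <= H) ->
  (forall m, (`|m|%N)%:Z <= X m + c) ->
  abssum (fun x : int * int => q ^ (x.1 * x.1 + e * x.1) * h x.1 *
    (q ^ X x.2 * (u (x.1 - s x.2) * u (x.1 + s x.2 + d)))).
Proof.
move=> /andP[e0 e1] hH hX; have [U [U0 HU]] := rpoch_bounded q0 q1.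
rewrite (_ : (fun _ => _) = fun x : int * int => q ^ (x.1 * x.1 + e * x.1 + X x.2) *
  (h x.1 * (u (x.1 - s x.2) * u (x.1 + s x.2 + d)))); last first.
  by apply/funext => -[n m] /=; rewrite (expfzDr (n * n + e * n) (X m) q0); ring.
apply: (abssum_qpow q0 q1 (g := fun x : int * int => (`|x.1| + `|x.2|)%N) (K := 1)
  (c := c + 2) (D := H * (U * U))) => //.
- by apply: geo_pair; exact: geo_absz.
- by move=> [n m] /=; rewrite !normrM; apply: ler_pM; rewrite ?mulr_ge0 //; apply: ler_pM.
by move=> [n m] _ /=; have := hX m; nia.
Qed.

(** Bailey's transform: the order of summation is exchanged, and the inner sum over [n] is the
    kernel [kappa]. *)
Lemma bailey_sum (h : int -> C) (H : C) (d e c : int) (kappa : int -> C)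
    (X1 X2 s1 s2 : int -> int) :
  0 <= e <= 1 -> (forall n, `|h n| <= H) ->
  (forall m, (`|m|%N)%:Z <= X1 m + c) -> (forall m, (`|m|%N)%:Z <= X2 m + c) ->
  (forall s, csum (fun n => q ^ (n * n + e * n) * h n *
     (u (n - s) * u (n + s + d))) = kappa s) ->
  csum (fun n => q ^ (n * n + e * n) * h n * csum (fun m =>
     q ^ X1 m * (u (n - s1 m) * u (n + s1 m + d)) -
     q ^ X2 m * (u (n - s2 m) * u (n + s2 m + d)))) =
  csum (fun m => q ^ X1 m * kappa (s1 m) - q ^ X2 m * kappa (s2 m)).
Proof.
move=> he hH hX1 hX2 hk.
have a1 := abssum_bailey d s1 he hH hX1; have a2 := abssum_bailey d s2 he hH hX2.
pose F (x : int * int) : C := q ^ (x.1 * x.1 + e * x.1) * h x.1 *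
  (q ^ X1 x.2 * (u (x.1 - s1 x.2) * u (x.1 + s1 x.2 + d)) -
   q ^ X2 x.2 * (u (x.1 - s2 x.2) * u (x.1 + s2 x.2 + d))).
have aF : abssum F by apply: eq_abssum (abssumB a1 a2) => x; rewrite -mulrBr.
transitivity (csum F).
  by rewrite csum_fubini //; apply: eq_csum => n; rewrite -csum_scale.
pose sw (x : int * int) := (x.2, x.1).
have sw1 : cancel sw sw by case.
rewrite (csum_bij F sw1 sw1) csum_fubini; last exact: (abssum_reindex sw1 aF).
apply: eq_csum => m; rewrite -!hk -!csum_scale -csumB; first last.
- have := abssum_slice m (abssum_reindex sw1 a2); apply: eq_abssum => n /=; ring.
- have := abssum_slice m (abssum_reindex sw1 a1); apply: eq_abssum => n /=; ring.
by apply: eq_csum => n; rewrite /F /=; ring.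
Qed.
End SlaterSums.

(** * Slater's identities *)

Section SlaterIdentities.
Context {R : realType}.
Local Notation C := R[i].

(** The series side of the quintuple product in base q^14 at z = q^a. The number in the names
    [slater_A1], ..., [slater_B6] is this [a]; A and B refer to the symbols (- q; Q)_n and (- Q;
    Q)_n. *)
Definition quint (q : C) (a : int) : C :=
  csum (fun n : int => q ^ (21 * n * n + (7 - 3 * a) * n)) -
  csum (fun n : int => q ^ (21 * n * n + (7 + 3 * a) * n + a)).

Context (q : C) (q0 : q != 0) (q1 : `|q| < 1).

Local Notation u := (rpoch q).
Local Notation poch v n := (qpoch (- (q * v)) (q ^+ 2) n).
Local Notation A_ratio := (eexp q 1 / eexp q (- q)).
Local Notation B_ratio := (eexp q q / eexp q (- q)).

Lemma abssum_qpow_quadratic (b c : int) :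
  abssum (fun n : int => q ^ (21 * n * n + b * n + c)).
Proof.
apply: (@eq_abssum _ _ (fun n : int => q ^ (21 * n * n + b * n + c) * 1)).
  by move=> n; rewrite mulr1.
apply: (abssum_qpow q0 q1 (g := fun m : int => `|m|%N) (K := 1)
  (c := `|c| + (`|b| + 1) * (`|b| + 1)) (D := 1)) => //.
- exact: geo_absz.
- by move=> n; rewrite normr1.
- by move=> n _; nia.
Qed.

Lemma csum_theta_difference (b1 b2 c2 : int) (K0 : C) (f : int -> C) :
  (forall n, f n = (q ^ (21 * n * n + b1 * n) - q ^ (21 * n * n + b2 * n + c2)) * K0) ->
  csum f = K0 * (csum (fun n => q ^ (21 * n * n + b1 * n)) -
                 csum (fun n => q ^ (21 * n * n + b2 * n + c2))).
Proof.
move=> fE; rewrite -csumB; [|apply: (eq_abssum _ (abssum_qpow_quadratic b1 0)) => n|];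
  rewrite ?addr0 //; last exact: abssum_qpow_quadratic.
by rewrite -csum_scale; apply: eq_csum => n; rewrite fE mulrC.
Qed.

Lemma qpow_opp (b : int) :
  csum (fun n => q ^ (21 * n * n + b * n)) = csum (fun n => q ^ (21 * n * n - b * n)).
Proof. by rewrite csum_opp; apply: eq_csum => n; congr (_ ^ _); ring. Qed.

Lemma qpow_opp_add (b c : int) :
  csum (fun n => q ^ (21 * n * n + b * n + c)) =
  csum (fun n => q ^ (21 * n * n - b * n + c)).
Proof. by rewrite csum_opp; apply: eq_csum => n; congr (_ ^ _); ring. Qed.

(** The substitution n -> - n - 1; it is needed for a = 5 and a = 6, where n -> - n does not reach
    the form in [quint]. *)
Lemma qpow_reflect (b c : int) :
  csum (fun n => q ^ (21 * n * n + b * n + c)) =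
  csum (fun n => q ^ (21 * n * n + (42 - b) * n + (21 - b + c))).
Proof.
rewrite csum_opp (csum_shift 1); apply: eq_csum => n; congr (_ ^ _); ring.
Qed.

Lemma slater_A3 : csum (fun n : int => q ^ (n * n) * poch 1 `|n| * u (2 * n)) =
  A_ratio * quint q 3.
Proof.
have [M [M0 HM]] := qpoch_bounded q0 q1 1.
have := @bailey_sum _ q q0 q1 (fun n => poch 1 `|n|) M 0 0 10
  (fun s => q ^ (s * s) * A_ratio) (fun m => 12 * m * m + 2 * m)
  (fun m => 12 * m * m - 10 * m + 2) (fun m => 3 * m) (fun m => 3 * m - 1)
  isT (fun n => HM _).
move=> /(_ (fun m => ltac:(nia)) (fun m => ltac:(nia))) h.
transitivity (csum (fun n : int => q ^ (n * n + 0 * n) * poch 1 `|n| *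
    csum (fun m => q ^ (12 * m * m + 2 * m) * (u (n - 3 * m) * u (n + 3 * m + 0)) -
      q ^ (12 * m * m - 10 * m + 2) * (u (n - (3 * m - 1)) * u (n + (3 * m - 1) + 0))))).
  apply: eq_csum => n; rewrite mul0r addr0 -fin_evenE //; congr (_ * _).
  by apply: eq_csum => m; rewrite !addr0.
rewrite h => [|s]; last first.
  by rewrite -kernel_even //; apply: eq_csum => n; rewrite mul0r !addr0.
(* The exponents are 12m^2 + 2m + (3m)^2 and 12m^2 - 10m + 2 + (3m - 1)^2. The linear coefficients
   in the other five evaluations arise in the same way. *)
rewrite (@csum_theta_difference 2 (-16) 3 A_ratio).
  rewrite /quint qpow_opp qpow_opp_add.
  by congr (_ * (_ - _)); apply: eq_csum => n; congr (_ ^ _); ring.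
move=> m; move: A_ratio => K; rewrite !mulrA -!expfzDr // -mulrBl.
by congr ((_ ^ _ - _ ^ _) * _); ring.
Qed.

Lemma slater_A1 : csum (fun n : int => q ^ (n * n + 2 * n) * poch 1 `|n| * u (2 * n)) =
  A_ratio * quint q 1.
Proof.
have [M [M0 HM]] := qpoch_bounded q0 q1 1.
have := @bailey_sum _ q q0 q1 (fun n => poch 1 `|n|) M 0 0 10
  (fun s => q ^ (s * s) * A_ratio) (fun m => 12 * m * m + 4 * m)
  (fun m => 12 * m * m + 4 * m) (fun m => 3 * m) (fun m => 3 * m + 1)
  isT (fun n => HM _).
move=> /(_ (fun m => ltac:(nia)) (fun m => ltac:(nia))) h.
transitivity (csum (fun n : int => q ^ (n * n + 0 * n) * poch 1 `|n| *
    csum (fun m => q ^ (12 * m * m + 4 * m) * (u (n - 3 * m) * u (n + 3 * m + 0)) -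
      q ^ (12 * m * m + 4 * m) * (u (n - (3 * m + 1)) * u (n + (3 * m + 1) + 0))))).
  apply: eq_csum => n.
  under [X in _ = _ * X]eq_csum do rewrite !addr0.
  rewrite -fin_even_scaled // mulrA; congr (_ * _).
  by rewrite mulrAC -expfzDr //; congr (_ ^ _ * _); ring.
rewrite h => [|s]; last first.
  rewrite -kernel_even //; apply: eq_csum => n.
  by rewrite mul0r !addr0.
rewrite (@csum_theta_difference (4) (10) (1) (A_ratio)).
  rewrite /quint  .
  by congr (_ * (_ - _)); apply: eq_csum => n; congr (_ ^ _); ring.
move=> m; move: (A_ratio) => K; rewrite !mulrA -!expfzDr // -mulrBl.
by congr ((_ ^ _ - _ ^ _) * _); ring.
Qed.

(** The kernel contributes two powers at each node. Since (3m + 1)^2 = (3m)^2 + 2(3m) + 1, the inner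
    two cancel and q^((3m)^2) - q^((3m + 2)^2) is left. *)
Lemma slater_A5 : csum (fun n : int => q ^ (n * n + 2 * n) * poch 1 `|n + 1| * u (2 * n + 1)) =
  A_ratio * quint q 5.
Proof.
have [M [M0 HM]] := qpoch_bounded q0 q1 1.
have := @bailey_sum _ q q0 q1 (fun n => poch 1 `|n + 1|) M 1 0 10
  (fun s => q ^ (s * s) * (1 + q ^ (2 * s + 1)) * A_ratio) (fun m => 12 * m * m + 8 * m)
  (fun m => 12 * m * m + 8 * m) (fun m => 3 * m) (fun m => 3 * m + 1)
  isT (fun n => HM _).
move=> /(_ (fun m => ltac:(nia)) (fun m => ltac:(nia))) h.
transitivity (csum (fun n : int => q ^ (n * n + 0 * n) * poch 1 `|n + 1| *
    csum (fun m => q ^ (12 * m * m + 8 * m) * (u (n - 3 * m) * u (n + 3 * m + 1)) -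
      q ^ (12 * m * m + 8 * m) * (u (n - (3 * m + 1)) * u (n + (3 * m + 1) + 1))))).
  apply: eq_csum => n.
  rewrite -fin_odd_scaled // mulrA; congr (_ * _).
  by rewrite mulrAC -expfzDr //; congr (_ ^ _ * _); ring.
rewrite h => [|s]; last first.
  rewrite -kernel_odd_shift //; apply: eq_csum => n.
  by rewrite mul0r addr0.
rewrite (@csum_theta_difference (8) (20) (4) (A_ratio)).
  rewrite /quint qpow_opp qpow_reflect.
  by congr (_ * (_ - _)); apply: eq_csum => n; congr (_ ^ _); ring.
move=> m; move: (A_ratio) => K.
have -> : q ^ (21 * m * m + 8 * m) = q ^ (12 * m * m + 8 * m) * q ^ (3 * m * (3 * m)).
  by rewrite -expfzDr //; congr (_ ^ _); ring.
have -> : q ^ (21 * m * m + 20 * m + 4) = q ^ (12 * m * m + 8 * m) *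
    (q ^ ((3 * m + 1) * (3 * m + 1)) * q ^ (2 * (3 * m + 1) + 1)).
  by rewrite -!expfzDr //; congr (_ ^ _); ring.
have -> : q ^ ((3 * m + 1) * (3 * m + 1)) = q ^ (3 * m * (3 * m)) * q ^ (2 * (3 * m) + 1).
  by rewrite -!expfzDr //; congr (_ ^ _); ring.
ring.
Qed.

Lemma slater_B2 : csum (fun n : int => q ^ (n * n + n) * poch q `|n| * u (2 * n)) =
  B_ratio * quint q 2.
Proof.
have [M [M0 HM]] := qpoch_bounded q0 q1 q.
have := @bailey_sum _ q q0 q1 (fun n => poch q `|n|) M 1 1 10
  (fun s => q ^ (s * s + s) * B_ratio) (fun m => 12 * m * m - 2 * m)
  (fun m => 12 * m * m + 10 * m + 2) (fun m => 3 * m) (fun m => 3 * m)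
  isT (fun n => HM _).
move=> /(_ (fun m => ltac:(nia)) (fun m => ltac:(nia))) h.
transitivity (csum (fun n : int => q ^ (n * n + 1 * n) * poch q `|n| *
    csum (fun m => q ^ (12 * m * m - 2 * m) * (u (n - 3 * m) * u (n + 3 * m + 1)) -
      q ^ (12 * m * m + 10 * m + 2) * (u (n - 3 * m) * u (n + 3 * m + 1))))).
  apply: eq_csum => n.
  rewrite -fin_even_shifted //; congr (_ ^ _ * _ * _); ring.
rewrite h => [|s]; last first.
  rewrite -kernel_odd //; apply: eq_csum => n.
  by rewrite mul1r.
rewrite (@csum_theta_difference (1) (13) (2) (B_ratio)).
  rewrite /quint  .
  by congr (_ * (_ - _)); apply: eq_csum => n; congr (_ ^ _); ring.
move=> m; move: (B_ratio) => K; rewrite !mulrA -!expfzDr // -mulrBl.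
by congr ((_ ^ _ - _ ^ _) * _); ring.
Qed.

Lemma slater_B4 : csum (fun n : int => q ^ (n * n + n) * poch q `|n| * u (2 * n + 1)) =
  B_ratio * quint q 4.
Proof.
have [M [M0 HM]] := qpoch_bounded q0 q1 q.
have := @bailey_sum _ q q0 q1 (fun n => poch q `|n|) M 1 1 10
  (fun s => q ^ (s * s + s) * B_ratio) (fun m => 12 * m * m + 2 * m)
  (fun m => 12 * m * m - 10 * m + 2) (fun m => 3 * m) (fun m => 3 * m - 2)
  isT (fun n => HM _).
move=> /(_ (fun m => ltac:(nia)) (fun m => ltac:(nia))) h.
transitivity (csum (fun n : int => q ^ (n * n + 1 * n) * poch q `|n| *
    csum (fun m => q ^ (12 * m * m + 2 * m) * (u (n - 3 * m) * u (n + 3 * m + 1)) -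
      q ^ (12 * m * m - 10 * m + 2) * (u (n - (3 * m - 2)) * u (n + (3 * m - 2) + 1))))).
  apply: eq_csum => n.
  rewrite -fin_oddE //; congr (_ ^ _ * _ * _); ring.
rewrite h => [|s]; last first.
  rewrite -kernel_odd //; apply: eq_csum => n.
  by rewrite mul1r.
rewrite (@csum_theta_difference (5) (-19) (4) (B_ratio)).
  rewrite /quint qpow_opp qpow_opp_add.
  by congr (_ * (_ - _)); apply: eq_csum => n; congr (_ ^ _); ring.
move=> m; move: (B_ratio) => K; rewrite !mulrA -!expfzDr // -mulrBl.
by congr ((_ ^ _ - _ ^ _) * _); ring.
Qed.

Lemma slater_B6 : csum (fun n : int => q ^ (n * n + 3 * n) * poch q `|n| * u (2 * n + 1)) =
  B_ratio * quint q 6.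
Proof.
have [M [M0 HM]] := qpoch_bounded q0 q1 q.
have := @bailey_sum _ q q0 q1 (fun n => poch q `|n|) M 1 1 10
  (fun s => q ^ (s * s + s) * B_ratio) (fun m => 12 * m * m + 8 * m)
  (fun m => 12 * m * m + 8 * m) (fun m => 3 * m) (fun m => 3 * m + 1)
  isT (fun n => HM _).
move=> /(_ (fun m => ltac:(nia)) (fun m => ltac:(nia))) h.
transitivity (csum (fun n : int => q ^ (n * n + 1 * n) * poch q `|n| *
    csum (fun m => q ^ (12 * m * m + 8 * m) * (u (n - 3 * m) * u (n + 3 * m + 1)) -
      q ^ (12 * m * m + 8 * m) * (u (n - (3 * m + 1)) * u (n + (3 * m + 1) + 1))))).
  apply: eq_csum => n.
  rewrite -fin_odd_scaled // mulrA; congr (_ * _).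
  by rewrite mulrAC -expfzDr //; congr (_ ^ _ * _); ring.
rewrite h => [|s]; last first.
  rewrite -kernel_odd //; apply: eq_csum => n.
  by rewrite mul1r.
rewrite (@csum_theta_difference (11) (17) (2) (B_ratio)).
  rewrite /quint qpow_opp qpow_reflect.
  by congr (_ * (_ - _)); apply: eq_csum => n; congr (_ ^ _); ring.
move=> m; move: (B_ratio) => K; rewrite !mulrA -!expfzDr // -mulrBl.
by congr ((_ ^ _ - _ ^ _) * _); ring.
Qed.
End SlaterIdentities.

(** * Infinite products and the quintuple product *)

Section InfiniteProducts.
Context {R : realType}.
Local Notation C := R[i].

Lemma seqlimM (a b : nat -> C) (l m : C) :
  seqlim a l -> seqlim b m -> seqlim (fun n => a n * b n) (l * m).
Proof.
move=> al bm e e0; pose K := `|l| + 1 + `|m|.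
have K0 : 0 < K by rewrite ltr_wpDr // ltr_wpDl.
pose d := e / 2 / K; have d0 : 0 < d by rewrite !divr_gt0.
have [N1 H1] := al _ ltr01; have [N2 H2] := al _ d0; have [N3 H3] := bm _ d0.
exists (maxn N1 (maxn N2 N3)) => n; rewrite !geq_max.
move=> /and3P[/H1 h1 /H2 h2 /H3 h3].
have al1 : `|a n| <= `|l| + 1.
  rewrite -[a n](subrK l) addrC; apply: le_trans (ler_normD _ _) _.
  by rewrite lerD2l ltW.
have -> : a n * b n - l * m = a n * (b n - m) + (a n - l) * m by ring.
apply: (@le_lt_trans _ _ (e / 2)); last by rewrite gtr_pMr // invf_lt1 ?ltr1n.
apply: le_trans (ler_normD _ _) _; rewrite !normrM.
have -> : e / 2 = (`|l| + 1) * d + d * `|m|.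
  by rewrite [d * _]mulrC -mulrDl -/K /d [K * _]mulrC divfK // gt_eqF.
by apply: lerD; apply: ler_pM => //; apply: ltW.
Qed.

Lemma seqlim_unique (a : nat -> C) (l m : C) : seqlim a l -> seqlim a m -> l = m.
Proof. by move=> /seqlim_lim <- /seqlim_lim. Qed.

Lemma seqlim_mul_index (a : nat -> C) (l : C) k : (0 < k)%N ->
  seqlim a l -> seqlim (fun n => a (k * n)%N) l.
Proof.
move=> k0 al e /al[N HN]; exists N => n Nn; apply: HN.
by apply: leq_trans Nn _; rewrite leq_pmull.
Qed.

Lemma qpochoo_seqlim (a p : C) : p != 0 -> `|p| < 1 ->
  seqlim (qpoch a p) (qpochoo a p).
Proof.
(* Euler's product [eexp] has base s^2, so a square root of [p] is taken. *)
move=> p0 p1; pose s := sqrtC p; have sE : s ^+ 2 = p := sqrtCK p.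
have s0 : s != 0 by rewrite sqrtC_eq0.
have s1 : `|s| < 1 by rewrite -(@expr_lt1 _ 2) // -normrX sE.
have -> : a = - (s * (- (s^-1 * a))) by rewrite mulrN opprK mulVKf.
by rewrite -sE qpochoo_eexp //; exact: qpoch_seqlim.
Qed.

Lemma qpochoo_neq0 (a p : C) : p != 0 -> `|p| < 1 ->
  (forall n, 1 - a * p ^+ n != 0) -> qpochoo a p != 0.
Proof.
move=> p0 p1; pose s := sqrtC p; have sE : s ^+ 2 = p := sqrtCK p.
have s0 : s != 0 by rewrite sqrtC_eq0.
have s1 : `|s| < 1 by rewrite -(@expr_lt1 _ 2) // -normrX sE.
have -> : a = - (s * (- (s^-1 * a))) by rewrite mulrN opprK mulVKf.
rewrite -sE qpochoo_eexp // => h; apply: eexp_neq0 => // n.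
by have := h n; rewrite mulNr opprK.
Qed.

Lemma qpoch_dissect (a p : C) k n :
  qpoch a p (k * n) = \prod_(i < k) qpoch (a * p ^+ i) (p ^+ k) n.
Proof.
elim: n => [|n IH].
  by rewrite muln0 big1 => [|i _]; rewrite /qpoch big_ord0.
rewrite mulnS addnC qpoch_add {}IH.
under [RHS]eq_bigr do rewrite qpochS.
rewrite big_split /=; congr (_ * _); apply: eq_bigr => i _.
by rewrite exprM mulrAC.
Qed.

Lemma qpochoo_dissect (a p : C) k : p != 0 -> `|p| < 1 -> (0 < k)%N ->
  qpochoo a p = \prod_(i < k) qpochoo (a * p ^+ i) (p ^+ k).
Proof.
move=> p0 p1 k0; have pk0 : p ^+ k != 0 by rewrite expf_neq0.
have pk1 : `|p ^+ k| < 1 by rewrite normrX exprn_ilt1 ?normr_ge0 // -lt0n.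
have h1 := seqlim_mul_index k0 (qpochoo_seqlim a p0 p1).
apply: (seqlim_unique h1).
have h2 m : seqlim (fun n => \prod_(i < m) qpoch (a * p ^+ i) (p ^+ k) n)
    (\prod_(i < m) qpochoo (a * p ^+ i) (p ^+ k)).
  elim: m => [|m IH].
    by move=> e e0; exists 0%N => n _; rewrite !big_ord0 subrr normr0.
  rewrite big_ord_recr /=.
  have := seqlimM IH (qpochoo_seqlim (a * p ^+ m) pk0 pk1).
  by congr seqlim; apply/funext => n; rewrite big_ord_recr.
by have := h2 k; congr seqlim; apply/funext => n; rewrite qpoch_dissect.
Qed.

Lemma qpochoo_sqr (a p : C) : p != 0 -> `|p| < 1 ->
  qpochoo a p * qpochoo (- a) p = qpochoo (a ^+ 2) (p ^+ 2).
Proof.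
move=> p0 p1; have pk0 : p ^+ 2 != 0 by rewrite expf_neq0.
have pk1 : `|p ^+ 2| < 1 by rewrite normrX exprn_ilt1.
have h1 := seqlimM (qpochoo_seqlim a p0 p1) (qpochoo_seqlim (- a) p0 p1).
apply: (seqlim_unique h1).
have := qpochoo_seqlim (a ^+ 2) pk0 pk1; congr seqlim; apply/funext => n.
rewrite /qpoch -big_split; apply: eq_bigr => i _ /=.
by rewrite -exprM mulnC exprM; ring.
Qed.

Lemma eexp_qpochoo (q v : C) : q != 0 -> `|q| < 1 ->
  eexp q v = qpochoo (- (q * v)) (q ^+ 2).
Proof. by move=> q0 q1; rewrite qpochoo_eexp. Qed.

Lemma csum_ord (d : nat) (f : 'I_d -> C) : csum f = \sum_i f i.
Proof.
apply: csumE => e e0; exists (index_enum 'I_d) => B uB sB.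
rewrite (perm_big (index_enum 'I_d)) /= ?subrr ?normr0 //.
by apply: uniq_perm => //; [exact: index_enum_uniq |
  move=> i; rewrite mem_index_enum sB ?mem_index_enum].
Qed.

Lemma csum_residues (d : nat) (f : int -> C) : (0 < d)%N -> abssum f ->
  csum f = \sum_(r < d) csum (fun k : int => f (d%:Z * k + r%:Z)).
Proof.
case: d => // d _ af.
pose phi (x : 'I_d.+1 * int) : int := d.+1%:Z * x.2 + (x.1 : nat)%:Z.
pose psi (n : int) : 'I_d.+1 * int := (inord `|(n %% d.+1%:Z)%Z|, (n %/ d.+1%:Z)%Z).
have phiK : cancel phi psi.
  move=> [r k]; rewrite /phi /psi /= mulrC; congr pair.
    apply: val_inj; rewrite /= inordK modzMDl.
      by rewrite modz_small ?absz_nat //= ltz_nat ltn_ord.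
    by rewrite modz_small ?absz_nat ?ltn_ord //= ltz_nat ltn_ord.
  by rewrite divzMDl // divz_small ?addr0 //= ltz_nat ltn_ord.
have psiK : cancel psi phi.
  move=> n; rewrite /phi /psi /= inordK.
    by rewrite gez0_abs ?modz_ge0 // mulrC -divz_eq.
  by rewrite -ltz_nat gez0_abs ?modz_ge0 // ltz_pmod.
rewrite (csum_bij f phiK psiK) csum_fubini; last exact: abssum_reindex phiK af.
by rewrite csum_ord.
Qed.

(** Euler's pentagonal number theorem in base q^4: the three factors of the triple product are the
    three residue classes of (q^4; q^4)_oo modulo 3. *)
Lemma eexp_cube (q : C) : q != 0 -> `|q| < 1 ->
  theta (q ^+ 6) (- q ^+ 2) = eexp (q ^+ 2) (- q ^+ 2).
Proof.
move=> q0 q1; have q60 : q ^+ 6 != 0 by rewrite expf_neq0.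
have q61 : `|q ^+ 6| < 1 by rewrite normrX exprn_ilt1.
have q20 : q ^+ 2 != 0 by rewrite expf_neq0.
have q21 : `|q ^+ 2| < 1 by rewrite normrX exprn_ilt1.
have q40 : q ^+ 4 != 0 by rewrite expf_neq0.
have q41 : `|q ^+ 4| < 1 by rewrite normrX exprn_ilt1.
rewrite jacobi_triple ?oppr_eq0 // !eexp_qpochoo // !mulrN !opprK.
have -> : - (q ^+ 6 * (- q ^+ 2)^-1) = q ^+ 4.
  rewrite invrN mulrN opprK (_ : q ^+ 6 = q ^+ 4 * q ^+ 2) ?mulfK //.
  by rewrite -exprD.
rewrite -!exprM -!exprD [RHS](qpochoo_dissect (q ^+ 4) q40 q41 (isT : 0 < 3)%N).
rewrite !big_ord_recr big_ord0 /= expr0 mulr1 mul1r -!exprM -!exprD.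
have rev (x y z : C) : x * y * z = z * y * x by ring.
exact: rev.
Qed.

Lemma exprN1_even (k : int) : (-1) ^ (2 * k) = 1 :> C.
Proof.
by rewrite -exprz_exp -[(-1) ^ 2]/((-1) ^+ 2) sqrrN expr1n exp1rz.
Qed.

Context (q : C) (q0 : q != 0) (q1 : `|q| < 1).

(** The right side times (q^4; q^4)_oo is a product of two theta functions, in z and in z^2. The
    coefficient of z^N in it depends on N modulo 3 only up to an explicit factor. *)
Lemma quintuple (z : C) : z != 0 ->
  csum (fun n : int => q ^ (3 * n * n + n) * z ^ (- (3 * n))) -
  csum (fun n : int => q ^ (3 * n * n + n) * z ^ (3 * n + 1)) =
  qpochoo (q ^+ 2) (q ^+ 2) * qpochoo z (q ^+ 2) * qpochoo (q ^+ 2 / z) (q ^+ 2) *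
  (qpochoo (q ^+ 2 * z ^+ 2) (q ^+ 4) * qpochoo (q ^+ 2 / z ^+ 2) (q ^+ 4)).
Proof.
move=> z0.
have q20 : q ^+ 2 != 0 by rewrite expf_neq0.
have q21 : `|q ^+ 2| < 1 by rewrite normrX exprn_ilt1.
have q60 : q ^+ 6 != 0 by rewrite expf_neq0.
have q61 : `|q ^+ 6| < 1 by rewrite normrX exprn_ilt1.
have N10 : (-1 : C) != 0 by rewrite oppr_eq0 oner_eq0.
have v0 : - (z / q) != 0 by rewrite oppr_eq0 mulf_neq0 ?invr_eq0.
have w0 : - z ^+ 2 != 0 by rewrite oppr_eq0 expf_neq0.
have E0 := eexpNq_neq0 q20 q21; set E := eexp _ _ in E0.
suff key : theta q (- (z / q)) * theta (q ^+ 2) (- z ^+ 2) = E *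
    (csum (fun n : int => q ^ (3 * n * n + n) * z ^ (- (3 * n))) -
     csum (fun n : int => q ^ (3 * n * n + n) * z ^ (3 * n + 1))).
  apply: (mulfI E0); rewrite -key (jacobi_triple q0 q1 v0) (jacobi_triple q20 q21 w0).
  have -> : eexp q (- q) = qpochoo (q ^+ 2) (q ^+ 2).
    by rewrite eexp_qpochoo // mulrN opprK -expr2.
  have -> : eexp q (- (z / q)) = qpochoo z (q ^+ 2).
    by rewrite eexp_qpochoo // mulrN opprK mulrCA divff // mulr1.
  have -> : eexp q (- (z / q))^-1 = qpochoo (q ^+ 2 / z) (q ^+ 2).
    by rewrite (eexp_qpochoo _ q0 q1) invrN mulrN opprK invf_div mulrA -expr2.
  have -> : eexp (q ^+ 2) (- z ^+ 2) = qpochoo (q ^+ 2 * z ^+ 2) (q ^+ 4).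
    by rewrite eexp_qpochoo // mulrN opprK -exprM.
  have -> : eexp (q ^+ 2) (- z ^+ 2)^-1 = qpochoo (q ^+ 2 / z ^+ 2) (q ^+ 4).
    by rewrite eexp_qpochoo // invrN mulrN opprK -exprM.
  have h (a b c e f g : C) : a * b * c * (e * f * g) = e * (a * b * c * (f * g)).
    by ring.
  exact: h.
(* Up to the explicit factor [G N], the coefficient of z^N. Classes 0 and 1 give the pentagonal
   series and class 2 vanishes by antisymmetry under n -> 1 - n. *)
pose c (N : int) : C := csum (fun n : int => (-1) ^ n * q ^ (6 * n * n + 2 * n - 4 * n * N)).
pose F (x : int * int) : C := (q ^ (x.1 * x.1) * (- (z / q)) ^ x.1) *
  ((q ^+ 2) ^ (x.2 * x.2) * (- z ^+ 2) ^ x.2).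
have aF : abssum F := abssumM (abssum_theta q0 q1 v0) (abssum_theta q20 q21 w0).
pose phi (x : int * int) := (x.1 - 2 * x.2, x.2).
pose psi (x : int * int) := (x.1 + 2 * x.2, x.2).
have phiK : cancel phi psi by move=> [N n]; rewrite /phi /psi /= subrK.
have psiK : cancel psi phi by move=> [N n]; rewrite /phi /psi /= addrK.
have aFphi := abssum_reindex phiK aF.
pose G (N : int) : C := (-1) ^ N * z ^ N * q ^ (N * N - N).
have FE N : csum (fun n => F (phi (N, n))) = G N * c N.
  rewrite -csum_scale; apply: eq_csum => n; rewrite /F /phi /G /=.
  rewrite expNrz [(- z ^+ 2) ^ n]expNrz expfzMl -[q^-1]/(q ^ (-1)) !exprz_exp.
  rewrite -[z ^+ 2]/(z ^ 2) -[q ^+ 2]/(q ^ 2) !exprz_exp.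
  have qE : q ^ ((N - 2 * n) * (N - 2 * n)) * q ^ (-1 * (N - 2 * n)) *
      q ^ (2 * (n * n)) = q ^ (N * N - N) * q ^ (6 * n * n + 2 * n - 4 * n * N).
    by rewrite -!expfzDr //; congr (_ ^ _); ring.
  have -> : z ^ N = z ^ (N - 2 * n) * z ^ (2 * n) by rewrite -expfzDr // subrK.
  have -> : (-1) ^ N = (-1) ^ (N - 2 * n) :> C.
    by rewrite expfzDr // -mulrN exprN1_even mulr1.
  transitivity ((q ^ ((N - 2 * n) * (N - 2 * n)) * q ^ (-1 * (N - 2 * n)) *
      q ^ (2 * (n * n))) * ((-1) ^ (N - 2 * n) * (-1) ^ n) *
      (z ^ (N - 2 * n) * z ^ (2 * n))); first by ring.
  by rewrite qE; ring.
have aG : abssum (fun N => G N * c N).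
  by apply: (eq_abssum FE); exact: abssum_fubini aFphi.
have tE : theta q (- (z / q)) * theta (q ^+ 2) (- z ^+ 2) = csum (fun N => G N * c N).
  rewrite -csumM; [|exact: abssum_theta..].
  by rewrite (csum_bij F phiK psiK) csum_fubini //; exact: eq_csum.
have cS (k r : int) : c (3 * k + r) =
    (-1) ^ k * q ^ (2 * k - 6 * k * k - 4 * k * r) * c r.
  rewrite /c -csum_scale (csum_shift k); apply: eq_csum => n.
  rewrite [(-1) ^ (n + k)]expfzDr //.
  have -> : q ^ (6 * (n + k) * (n + k) + 2 * (n + k) - 4 * (n + k) * (3 * k + r)) =
    q ^ (2 * k - 6 * k * k - 4 * k * r) * q ^ (6 * n * n + 2 * n - 4 * n * r).
    by rewrite -expfzDr //; congr (_ ^ _); ring.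
  ring.
have c0 : c 0 = E.
  rewrite /E -eexp_cube // /theta /c; apply: eq_csum => n.
  rewrite [(- q ^+ 2) ^ n]expNrz -[q ^+ 6]/(q ^ 6) -[q ^+ 2]/(q ^ 2) !exprz_exp.
  rewrite mulrCA -expfzDr //; congr (_ * q ^ _); ring.
have c1 : c 1 = E.
  rewrite -c0 /c csum_opp; apply: eq_csum => n.
  rewrite -exprz_inv invrN1; congr (_ * q ^ _); ring.
have c2 : c 2 = 0.
  have : c 2 = - 1 * c 2.
    rewrite {1}/c csum_opp (csum_shift (-1)) /c -csum_scale; apply: eq_csum => n.
    have -> : (-1) ^ (- (n + -1)) = -1 * (-1) ^ n :> C.
      by rewrite -exprz_inv invrN1 addrC expfzDr // -[(-1) ^ (-1)]/((-1)^-1) invrN1.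
    by rewrite -(mulrA (-1 : C)); congr (_ * (_ * _ ^ _)); ring.
  rewrite mulN1r => /eqP; rewrite -addr_eq0 -mulr2n mulrn_eq0 /= => /eqP //.
rewrite tE (csum_residues (d := 3) _ aG) // !big_ord_recr big_ord0 /= add0r.
rewrite [X in _ + X](_ : _ = 0) ?addr0; last first.
  rewrite -[RHS](@csum0 _ int); apply: eq_csum => k.
  by rewrite cS c2 !mulr0.
have e4 (k : int) : (-1) ^ (3 * k) * (-1) ^ k = 1 :> C.
  have -> : (-1) ^ (3 * k) * (-1) ^ k = (-1) ^ (2 * (2 * k)) :> C.
    by rewrite -expfzDr //; congr (_ ^ _); ring.
  exact: exprN1_even.
rewrite mulrBr; congr (_ + _).
  rewrite csum_opp -csum_scale; apply: eq_csum => k.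
  rewrite cS c0 /G (_ : 3 * - k + 0%N%:Z = - (3 * k)); last by ring.
  have -> : q ^ (3 * k * k + k) = q ^ (- (3 * k) * - (3 * k) - - (3 * k)) *
      q ^ (2 * - k - 6 * - k * - k - 4 * - k * 0%N%:Z).
    by rewrite -!expfzDr //; congr (_ ^ _); ring.
  have := e4 (- k); rewrite mulrN => e4k.
  transitivity (((-1) ^ (- (3 * k)) * (-1) ^ (- k)) * E * z ^ (- (3 * k)) *
    (q ^ (- (3 * k) * - (3 * k) - - (3 * k)) *
     q ^ (2 * - k - 6 * - k * - k - 4 * - k * 0%N%:Z))); first by ring.
  by rewrite e4k; ring.
rewrite -mulrN -mulN1r -!csum_scale; apply: eq_csum => k.
rewrite cS c1 /G.
have -> : q ^ (3 * k * k + k) = q ^ ((3 * k + 1%N%:Z) * (3 * k + 1%N%:Z) - (3 * k + 1%N%:Z)) *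
    q ^ (2 * k - 6 * k * k - 4 * k * 1%N%:Z).
  by rewrite -!expfzDr //; congr (_ ^ _); ring.
rewrite [(-1) ^ (3 * k + _)]expfzDr // [(-1) ^ 1%N%:Z]expr1z.
move: (e4 k) => e4k.
transitivity (- (((-1) ^ (3 * k) * (-1) ^ k)) * E * z ^ (3 * k + 1) *
  (q ^ ((3 * k + 1%N%:Z) * (3 * k + 1%N%:Z) - (3 * k + 1%N%:Z)) *
   q ^ (2 * k - 6 * k * k - 4 * k * 1%N%:Z))); first by ring.
rewrite e4k; ring.
Qed.
End InfiniteProducts.

(** * Reduction of the triple sum to a single sum *)

Section TripleSum.
Context {R : realType}.
Local Notation C := R[i].
Context (q : C) (q0 : q != 0) (q1 : `|q| < 1).

Local Notation u := (rpoch q).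

Lemma abssum_durfee_rect (j : int) (f : int -> C) :
  abssum (fun c => f c * u c * u (j - c)).
Proof.
apply: (@abssum_finite _ _ (map Posz (iota 0 `|j|.+1))) => -[n|n]; last by rewrite mulr0 mul0r.
rewrite mem_map ?mem_iota => [|? ? [] //]; rewrite add0n /= ltnS -ltnNge => mn.
by rewrite (@rpoch_lt0 _ q (j - n%:Z)) ?mulr0 //; lia.
Qed.

(** Induction on [j] through multiplication by 1 - Q^(j + 1), with a telescoping remainder in [c];
    [k] may be any integer. *)
Lemma durfee_rectangle (j k : int) :
  csum (fun c => q ^ (2 * ((j - c) * (k - c))) * u (k - c) * u c * u (j - c)) =
  u j * u k.
Proof.
case: j => j; last first.
  rewrite mul0r -[RHS](@csum0 _ int); apply: eq_csum => -[c|c].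
    by rewrite (@rpoch_lt0 _ q (Negz j - c%:Z)) ?mulr0 //; lia.
  by rewrite mulr0 mul0r.
elim: j => [|j IH].
  rewrite (csum_single (i0 := 0)) => [|c c0].
    by rewrite !subr0 mul0r mulr0 expr0z rpoch0 !mulr1.
  rewrite -[0%N%:Z]/(0 : int) sub0r -mulrA [u c * _]mulrC rpochMN ?mulr0 //.
have j0 : 1 - q ^ (2 * j.+1%:Z) != 0 by apply: subr1_exprz_neq0.
apply: (mulfI j0); rewrite mulrA.
have := rpoch_pred q0 q1 j.+1%:Z; rewrite (_ : j.+1%:Z - 1 = j%:Z); last by lia.
move=> <-; rewrite -IH -csum_scale.
pose x (c : int) : C := - (q ^ (2 * ((j%:Z - c) * (k - c))) * (1 - q ^ (2 * (k - c)))
  * u (k - c)) * u c * u (j%:Z - c).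
apply: (csum_telescope (x := x)); [exact: abssum_durfee_rect..|].
move=> c; rewrite /x.
have -> : j%:Z - (c - 1) = j.+1%:Z - c by lia.
have h1 := rpoch_pred q0 q1 (j.+1%:Z - c).
have h2 := rpoch_pred q0 q1 c.
have h3 := rpoch_pred q0 q1 (k - (c - 1)).
have e1 : j.+1%:Z - c - 1 = j%:Z - c by lia.
have e3 : k - (c - 1) - 1 = k - c by lia.
rewrite e1 in h1; rewrite e3 in h3.
rewrite -[_ * (1 - _) * u (k - (c - 1))]mulrA -h3 h2 h1.
have -> : q ^ (2 * j.+1%:Z) = q ^ (2 * (j.+1%:Z - c)) * q ^ (2 * c).
  by rewrite -expfzDr //; congr (_ ^ _); ring.
have -> : q ^ (2 * ((j.+1%:Z - c) * (k - (c - 1)))) =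
    q ^ (2 * ((j.+1%:Z - c) * (k - c))) * q ^ (2 * (j.+1%:Z - c)).
  by rewrite -expfzDr //; congr (_ ^ _); ring.
have -> : q ^ (2 * ((j.+1%:Z - c) * (k - c))) =
    q ^ (2 * ((j%:Z - c) * (k - c))) * q ^ (2 * (k - c)).
  by rewrite -expfzDr //; congr (_ ^ _); lia.
ring.
Qed.

Definition parity (n : int) : C := (1 + (-1) ^ n) / 2.

Lemma parity_even (n : int) : parity (2 * n) = 1.
Proof. by rewrite /parity exprN1_even; apply: divff; rewrite -[1 + 1]/(2 : C) pnatr_eq0. Qed.

Lemma parity_odd (n : int) : parity (2 * n + 1) = 0.
Proof.
rewrite /parity expfzDr ?oppr_eq0 ?oner_eq0 // exprN1_even mul1r expr1z subrr.
by rewrite mul0r.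
Qed.

Lemma norm_parity (n : int) : `|parity n| <= 1.
Proof.
rewrite /parity normf_div (ger0_norm (ler0n _ 2)) ler_pdivrMr // mul1r.
apply: le_trans (ler_normD _ _) _.
by rewrite normr_exprz normrN1 exp1rz normr1 -natr1.
Qed.

(** Completing the square in n, a and b costs 3 N^2 / 4 in all. A fourth square, in i, would use up
    N^2 entirely, so the term (N + t) i is kept as nonnegative instead; this is where i, N >= 0
    enters. *)
Lemma quintic_form_bound (i a b n N t al be ga : int) : 0 <= i -> 0 <= N ->
  0 <= t <= 2 -> `|al| <= 2 -> `|be| <= 2 -> `|ga| <= 2 ->
  ((`|N| + ((`|i| + `|a|) + (`|b| + `|n|)))%N)%:Z <=
  56 * (N * N + N + a * a + b * b + i * i + n * n + al * i + be * a + ga * b +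
        (N + t) * (n + i - a - b)) + 20000.
Proof.
move=> i0 N0 t02 ha hb hc; have sq (m : int) : (`|m|%N)%:Z <= m * m by nia.
have ge7 (x y : int) : 7 * (x * x) - 16 * (y * y) <= 56 * (x * x - y * x).
  have -> : 56 * (x * x - y * x) =
    7 * (x * x) - 16 * (y * y) + (7 * x - 4 * y) * (7 * x - 4 * y) by ring.
  by rewrite lerDl -expr2 sqr_ge0.
have le4 (y : int) : `|y - N| <= 4 -> y * y <= (N + 4) * (N + 4) by move=> hy; nia.
have hn := ge7 n (- (N + t)); have hN : `|- (- (N + t)) - N| <= 4 by lia.
have hA := ge7 a (N + t - be); have hAN : `|N + t - be - N| <= 4 by lia.
have hB := ge7 b (N + t - ga); have hBN : `|N + t - ga - N| <= 4 by lia.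
have := le4 _ hN; have := le4 _ hAN; have := le4 _ hBN; rewrite mulrNN.
have -> : 56 * (N * N + N + a * a + b * b + i * i + n * n + al * i + be * a + ga * b +
    (N + t) * (n + i - a - b)) = 56 * (N * N + N) + 56 * (i * i + al * i + (N + t) * i) +
    56 * (n * n - - (N + t) * n) + 56 * (a * a - (N + t - be) * a) +
    56 * (b * b - (N + t - ga) * b) by ring.
have := sq n; have := sq a; have := sq b; have := sq i.
have hi : 55 * (i * i) - 10000 <= 56 * (i * i + al * i + (N + t) * i).
  have h1 : - (2 * i) <= al * i by nia.
  have h2 : 0 <= (N + t) * i by rewrite mulr_ge0 //; lia.
  have h3 : 0 <= i * i - 112 * i + 3136.
    by rewrite (_ : _ + _ = (i - 56) * (i - 56)) -?expr2 ?sqr_ge0 //; ring.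
  by move: h1 h2 h3; rewrite !mulrDr; move: (al * i) ((N + t) * i) (i * i); lia.
have hNN : N - 10000 <= 56 * (N * N + N) - 48 * ((N + 4) * (N + 4)).
  by nia.
move: hn hA hB hi hNN; rewrite mulrNN.
move: (56 * (i * i + _ + _)) (56 * (n * n - _)) (56 * (a * a - _)) (56 * (b * b - _)).
move: ((N + t) * (N + t)) ((N + t - be) * (N + t - be)) ((N + t - ga) * (N + t - ga)).
move: (56 * (N * N + N)) ((N + 4) * (N + 4)) (n * n) (a * a) (b * b) (i * i).
lia.
Qed.

Section LinearTerms.
Context (al be ga t : int) (t02 : 0 <= t <= 2) (beta_gamma : be + ga = 2 * t).
Context (hal : `|al| <= 2) (hbe : `|be| <= 2) (hga : `|ga| <= 2).

Definition nahm_term (x : int * int * int) : C :=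
  q ^ ((x.1.2 - x.2) * (x.1.2 - x.2) +
    (x.1.2 + x.2 - x.1.1) * (x.1.2 + x.2 - x.1.1) + x.1.1 * x.1.1 +
    al * x.1.1 + be * x.1.2 + ga * x.2) * (u x.1.1 * u x.1.2 * u x.2).

(* The term of [nahm_term] after writing [j = a + c], [k = b + c] with the
   Durfee rectangle formula, [n = a + b + 2 c - i], and expanding [u c] by
   Euler's series, whose summation index is [N]. *)
Definition unfolded_exponent (x : int * (int * int * (int * int))) : int :=
  x.1 * x.1 + x.1 + x.2.1.2 * x.2.1.2 + x.2.2.1 * x.2.2.1 +
  x.2.1.1 * x.2.1.1 + x.2.2.2 * x.2.2.2 + al * x.2.1.1 + be * x.2.1.2 +
  ga * x.2.2.1 + (x.1 + t) * (x.2.2.2 + x.2.1.1 - x.2.1.2 - x.2.2.1).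

Definition unfolded_coef (x : int * (int * int * (int * int))) : C :=
  parity (x.2.2.2 + x.2.1.1 - x.2.1.2 - x.2.2.1) * (-1) ^ x.1 *
  (u x.1 * (u x.2.1.1 * u x.2.1.2 * u x.2.2.1)).

Definition unfolded_term (x : int * (int * int * (int * int))) : C :=
  q ^ unfolded_exponent x * unfolded_coef x.

Lemma abssum_unfolded_term : abssum unfolded_term.
Proof.
have [U [U0 HU]] := rpoch_bounded q0 q1.
apply: (@abssum_qpow _ q q0 q1 _ (fun x : int * (int * int * (int * int)) =>
    (`|x.1| + ((`|x.2.1.1| + `|x.2.1.2|) + (`|x.2.2.1| + `|x.2.2.2|)))%N) 56 20000
  (1 * 1 * (U * (U * U * U))) unfolded_exponent unfolded_coef).
- have g1 := @geo_absz R; have g2 := geo_pair g1 g1.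
  exact: (geo_pair g1 (geo_pair g2 g2)).
- by [].
- have leM (a b c d : C) : `|a| <= c -> `|b| <= d -> `|a * b| <= c * d.
    by move=> ac bd; rewrite normrM; apply: ler_pM.
  move=> x; apply: (leM); first apply: (leM).
  + exact: norm_parity.
  + by rewrite normr_exprz normrN1 exp1rz.
  by apply: (leM) => //; apply: (leM) => //; exact: (leM).
move=> [N [[i a] [b n]]]; rewrite /unfolded_coef /= => h.
apply: quintic_form_bound; [| |exact: t02|exact: hal|exact: hbe|exact: hga].
  by rewrite leNgt; apply: contra_neqN h => h; rewrite (rpoch_lt0 q h) !(mul0r, mulr0).
by rewrite leNgt; apply: contra_neqN h => h; rewrite (rpoch_lt0 q h) !(mul0r, mulr0).
Qed.

(** For fixed [N] the parity factor is a half sum over e = 1, -1, and for each sign the summand is a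
    product over the variables i, a, b, n. The first three sums are Euler series; the fourth is a
    theta function, which the triple product splits into (Q; Q)_oo and two more Euler products. *)
Lemma csum_unfolded_slice (N : int) :
  csum (fun v => unfolded_term (N, v)) =
  eexp q (- q) * ((-1) ^ N * q ^ (N * N + N) * u N / 2 *
   \sum_(e <- [:: 1; -1]) (eexp q (e * q ^ (N + t)) * eexp q (e * q ^ (- (N + t))) *
     eexp q (e * q ^ (al + (N + t))) * eexp q (e * q ^ (be - (N + t))) *
     eexp q (e * q ^ (ga - (N + t))))).
Proof.
pose M := N + t.
pose E (e : C) (c n : int) : C := q ^ (n * n) * (e * q ^ c) ^ n * u n.
pose T (e : C) (n : int) : C := q ^ (n * n) * (e * q ^ M) ^ n.
pose F e (x : int * int * (int * int)) : C :=
  (E e (al + M) x.1.1 * E e (be - M) x.1.2) * (E e (ga - M) x.2.1 * T e x.2.2).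
have aE e c : abssum (E e c) := abssum_eexp q0 q1 (e * q ^ c).
have aT e : e != 0 -> abssum (T e).
  by move=> e0; apply: abssum_theta => //; rewrite mulf_neq0 // expfz_neq0.
have aEE e : abssum (fun x : int * int => E e (al + M) x.1 * E e (be - M) x.2).
  exact: (abssumM (aE e (al + M)) (aE e (be - M))).
have aET e : e != 0 -> abssum (fun x : int * int => E e (ga - M) x.1 * T e x.2).
  by move=> /aT h; exact: (abssumM (aE e (ga - M)) h).
have aF e : e != 0 -> abssum (F e) by move=> /aET h; exact: (abssumM (aEE e) h).
have N10 : (-1 : C) != 0 by rewrite oppr_eq0 oner_eq0.
have cF e : e != 0 -> e^-1 = e -> csum (F e) = eexp q (- q) *
    (eexp q (e * q ^ M) * eexp q (e * q ^ (- M)) * eexp q (e * q ^ (al + M)) *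
     eexp q (e * q ^ (be - M)) * eexp q (e * q ^ (ga - M))).
  move=> e0 eV; rewrite /F (csumM (aEE e) (aET e e0)) (csumM (aE e (al + M)) (aE e (be - M))).
  rewrite (csumM (aE e (ga - M)) (aT e e0)).
  have -> : csum (T e) = theta q (e * q ^ M) by [].
  have cE c : csum (E e c) = eexp q (e * q ^ c) by [].
  rewrite (cE (al + M)) (cE (be - M)) (cE (ga - M)).
  rewrite jacobi_triple ?mulf_neq0 ?expfz_neq0 // invfM eV invr_expz.
  have h (x y z v w p : C) : x * y * (z * (v * w * p)) = v * (w * p * x * y * z).
    by ring.
  exact: h.
pose K := (-1) ^ N * q ^ (N * N + N) * u N / 2.
rewrite (@eq_csum _ _ _ (fun x => K * (F 1 x + F (-1) x))); last first.
  move=> [[i a] [b n]]; rewrite /unfolded_term /unfolded_coef /F /E /T /K /=.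
  rewrite /unfolded_exponent /= -/M.
  have -> : q ^ (N * N + N + a * a + b * b + i * i + n * n + al * i + be * a + ga * b +
      M * (n + i - a - b)) = q ^ (N * N + N) * (q ^ (i * i) * q ^ ((al + M) * i)) *
      (q ^ (a * a) * q ^ ((be - M) * a)) * (q ^ (b * b) * q ^ ((ga - M) * b)) *
      (q ^ (n * n) * q ^ (M * n)).
    by rewrite -!expfzDr //; congr (_ ^ _); ring.
  rewrite !mul1r !mulN1r ![(- q ^ _) ^ _]expNrz !exprz_exp /parity.
  have -> : (-1) ^ (n + i - a - b) = (-1) ^ i * (-1) ^ a * ((-1) ^ b * (-1) ^ n) :> C.
    have -> : n + i - a - b = n + i + a + b - 2 * (a + b) by ring.
    rewrite [LHS]expfzDr // -mulrN exprN1_even mulr1 !expfzDr //; ring.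
  by rewrite /=; field.
rewrite csum_scale csumD; [|exact: aF|exact: aF].
rewrite (cF 1 (oner_neq0 _) (invr1 _)) (cF (-1) N10 (invrN1 _)) big_cons big_seq1.
have h (x e a b : C) : x * (e * a + e * b) = e * (x * (a + b)) by ring.
exact: h.
Qed.

(** Summing over [N] first undoes Euler's expansion and gives back u(c), with 2c = n + i - a - b. *)
Definition folded_term (v : int * int * (int * int)) : C :=
  csum (fun N => unfolded_term (N, v)).

Lemma folded_term_even (i a b n c : int) : n + i - a - b = 2 * c ->
  folded_term ((i, a), (b, n)) = eexp q (- q) *
    (q ^ (a * a + b * b + i * i + n * n + al * i + be * a + ga * b + t * (2 * c)) *
     (u i * u a * u b * u c)).
Proof.
move=> h; rewrite (rpoch_eexp q0 q1 c).
have eK (e x y z : C) : e != 0 -> e * (x * (y * (z / e))) = x * y * z.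
  by move=> e0; rewrite [e * _]mulrC -!mulrA mulVf // mulr1.
rewrite eK ?eexpNq_neq0 // /eexp -csum_scale; apply: eq_csum => N.
rewrite /unfolded_term /unfolded_coef /unfolded_exponent /= h parity_even.
rewrite [(- q ^ _) ^ N]expNrz exprz_exp.
have -> : q ^ (N * N + N + a * a + b * b + i * i + n * n + al * i + be * a + ga * b +
    (N + t) * (2 * c)) = q ^ (a * a + b * b + i * i + n * n + al * i + be * a + ga * b +
    t * (2 * c)) * q ^ (N * N) * q ^ ((2 * c + 1) * N).
  by rewrite -!expfzDr //; congr (_ ^ _); ring.
by ring.
Qed.

Lemma folded_term_odd (i a b n c : int) : n + i - a - b = 2 * c + 1 ->
  folded_term ((i, a), (b, n)) = 0.
Proof.
move=> h; rewrite -[RHS](@csum0 _ int); apply: eq_csum => N.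
by rewrite /unfolded_term /unfolded_coef /= h parity_odd !mul0r mulr0.
Qed.

Let swap (x : int * int * (int * int) * int) := (x.2, x.1).
Let swap' (x : int * (int * int * (int * int))) := (x.2, x.1).

Lemma abssum_folded_term : abssum folded_term.
Proof.
have sw1 : cancel swap swap' by case.
exact: abssum_fubini (abssum_reindex sw1 abssum_unfolded_term).
Qed.

Lemma csum_folded_term : csum folded_term = csum unfolded_term.
Proof.
have sw1 : cancel swap swap' by case.
have sw2 : cancel swap' swap by case.
rewrite (csum_bij unfolded_term sw1 sw2) [RHS]csum_fubini; first exact: eq_csum.
exact: abssum_reindex sw1 abssum_unfolded_term.
Qed.

Let phi (x : int * int * int * int) : int * int * (int * int) :=
  ((x.1.1.1, x.1.1.2 - x.2), (x.1.2 - x.2, x.1.1.2 + x.1.2 - x.1.1.1)).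
Let psi (v : int * int * (int * int)) : int * int * int * int :=
  let c := ((v.2.2 + v.1.1 - v.1.2 - v.2.1) %/ 2)%Z in
  (v.1.1, v.1.2 + c, v.2.1 + c, c).

Lemma phiK : cancel phi psi.
Proof.
move=> [[[i j] k] c]; rewrite /phi /psi /=.
have -> : j + k - i + i - (j - c) - (k - c) = c * 2 by ring.
by rewrite mulzK // !subrK.
Qed.

(** Points outside the range of [phi] have n + i - a - b odd, and there the parity factor is 0. *)
Lemma folded_term_support v : phi (psi v) != v -> folded_term v = 0.
Proof.
case: v => [[i a] [b n]]; rewrite /phi /psi /= => h.
have e := divz_eq (n + i - a - b) 2; move: e h.
set c := ((n + i - a - b) %/ 2)%Z; set d := ((n + i - a - b) %% 2)%Z => e h.
have d0 : 0 <= d by apply: modz_ge0.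
have d2 : d < 2 by apply: ltz_pmod.
have [d1|d1] : d = 0 \/ d = 1 by lia.
  case/negP: h; rewrite !addrK; apply/eqP; congr (_, (_, _)); lia.
by apply: (folded_term_odd (c := c)); rewrite e d1 mulrC.
Qed.

(** The Durfee factor Q^((j - c)(k - c)) completes (j - k)^2 to (j - c)^2 + (k - c)^2. The linear
    terms leave (be + ga) c, and be + ga = 2t turns this into the shift of [N] by [t]. *)
Lemma csum_folded_slice (x : int * int * int) :
  csum (fun c => folded_term (phi (x, c))) = eexp q (- q) * nahm_term x.
Proof.
case: x => [[i j] k]; rewrite /nahm_term /= -[u i * u j * u k]mulrA -durfee_rectangle.
rewrite -!csum_scale; apply: eq_csum => c; rewrite /phi /=.
rewrite (folded_term_even (c := c)); last by ring.
have -> : q ^ ((j - c) * (j - c) + (k - c) * (k - c) + i * i +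
    (j + k - i) * (j + k - i) + al * i + be * (j - c) + ga * (k - c) + t * (2 * c)) =
    q ^ ((j - k) * (j - k) + (j + k - i) * (j + k - i) + i * i +
    al * i + be * j + ga * k) * q ^ (2 * ((j - c) * (k - c))).
  rewrite -expfzDr //; congr (_ ^ _).
  have -> : t * (2 * c) = (be + ga) * c by rewrite beta_gamma; ring.
  ring.
by ring.
Qed.

Lemma abssum_nahm_term : abssum nahm_term.
Proof.
have E0 := eexpNq_neq0 q0 q1.
have := abssumZ (eexp q (- q))^-1 (abssum_fubini (abssum_reindex phiK abssum_folded_term)).
by apply: eq_abssum => x; rewrite csum_folded_slice mulKf.
Qed.

Lemma csum_nahm_term : csum nahm_term = csum (fun N => 
  (-1) ^ N * q ^ (N * N + N) * u N / 2 *
   \sum_(e <- [:: 1; -1]) (eexp q (e * q ^ (N + t)) * eexp q (e * q ^ (- (N + t))) *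
     eexp q (e * q ^ (al + (N + t))) * eexp q (e * q ^ (be - (N + t))) *
     eexp q (e * q ^ (ga - (N + t))))).
Proof.
have E0 := eexpNq_neq0 q0 q1; apply: (mulfI E0); rewrite -[RHS]csum_scale.
transitivity (csum (fun N => csum (fun v => unfolded_term (N, v)))); last first.
  by apply: eq_csum => N; exact: csum_unfolded_slice.
rewrite -(csum_fubini abssum_unfolded_term) -csum_folded_term.
rewrite (csum_reindex phiK folded_term_support) [RHS]csum_fubini.
  by rewrite -csum_scale; apply: eq_csum => x; rewrite csum_folded_slice.
exact: abssum_reindex phiK abssum_folded_term.
Qed.
End LinearTerms.
End TripleSum.

(** * Even and odd sectors *)

Section SectorValues.
Context {R : realType}.
Local Notation C := R[i].

Lemma rpochN (q : C) k : rpoch (- q) k = rpoch q k.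
Proof. by rewrite /rpoch sqrrN. Qed.

(** Because k^2 and k have the same parity. This is what turns the sign e = -1 into the substitution
    q -> - q. *)
Lemma eexpN (q v : C) : eexp q (- v) = eexp (- q) v.
Proof.
apply: eq_csum => k; rewrite [(- v) ^ k]expNrz [(- q) ^ _]expNrz.
have -> : (-1) ^ (k * k) = (-1) ^ k :> C.
  by rewrite !expN1r abszM -signr_odd oddM andbb signr_odd.
by rewrite rpochN; ring.
Qed.

Lemma exprzN_even (q : C) k : (- q) ^ (2 * k) = q ^ (2 * k).
Proof. by rewrite expNrz exprN1_even mul1r. Qed.

Context (q : C) (q0 : q != 0) (q1 : `|q| < 1).

Local Notation u := (rpoch q).
Local Notation poch v n := (qpoch (- (q * v)) (q ^+ 2) n).

Lemma eexp_step (c : int) :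
  eexp q (q ^ (c - 2)) = q ^ (c - 1) * (1 + q ^ (1 - c)) * eexp q (q ^ c).
Proof.
rewrite (eexp_shift q0 q1 (q ^ (c - 2))).
have -> : q ^+ 2 * q ^ (c - 2) = q ^ c.
  by rewrite -[q ^+ 2]/(q ^ 2) -expfzDr // addrC subrK.
have -> : q * q ^ (c - 2) = q ^ (c - 1).
  by rewrite -{1}[q]expr1z -expfzDr //; congr (_ ^ _); ring.
congr (_ * _); rewrite mulrDr mulr1 -expfzDr // addrC; congr (_ + _).
by rewrite -[LHS](expr0z q); congr (_ ^ _); ring.
Qed.

Lemma eexp_even_opp (n : nat) :
  eexp q (q ^ (- (2 * n%:Z))) = q ^ (- (n%:Z * n%:Z)) * poch 1 n * eexp q 1.
Proof.
elim: n => [|n IH]; first by rewrite mulr0 oppr0 !expr0z /qpoch big_ord0 !mul1r.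
rewrite (_ : - (2 * n.+1%:Z) = - (2 * n%:Z) - 2); last by lia.
rewrite eexp_step IH qpochS.
have -> : q ^ (- (n.+1%:Z * n.+1%:Z)) = q ^ (- (2 * n%:Z) - 1) * q ^ (- (n%:Z * n%:Z)).
  by rewrite -!expfzDr //; congr (_ ^ _); lia.
have -> : q ^ (1 - - (2 * n%:Z)) = q * (q ^+ 2) ^+ n.
  by rewrite opprK expfzDr // expr1z -exprM.
rewrite mulNr opprK; ring.
Qed.

Lemma eexp_odd_opp (n : nat) : eexp q (q ^ (- (2 * n%:Z + 1))) =
  2 * q ^ (- (n%:Z * n%:Z + n%:Z)) * poch q n * eexp q q.
Proof.
elim: n => [|n IH].
  have := eexp_step 1; rewrite subrr !expr0z expr1z mul1r => h.
  (* The factor 2 is 1 + q^0, from E(q^(-1)) = 2 E(q). *)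
  rewrite (_ : - (2 * 0%N%:Z + 1) = 1 - 2) // h /qpoch big_ord0.
  by rewrite !mulr1.
rewrite (_ : - (2 * n.+1%:Z + 1) = - (2 * n%:Z + 1) - 2); last by lia.
rewrite eexp_step IH qpochS.
have -> : q ^ (- (n.+1%:Z * n.+1%:Z + n.+1%:Z)) =
    q ^ (- (2 * n%:Z + 1) - 1) * q ^ (- (n%:Z * n%:Z + n%:Z)).
  by rewrite -!expfzDr //; congr (_ ^ _); lia.
have -> : q ^ (1 - - (2 * n%:Z + 1)) = q * q * (q ^+ 2) ^+ n.
  rewrite -expr2 -exprM -exprD -[RHS]/(q ^ (2 + 2 * n)%N%:Z).
  by congr (_ ^ _); lia.
rewrite mulNr opprK; ring.
Qed.

(** The Pochhammer symbol produced by the negative exponent is exactly what completes the other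
    factor to E(1). *)
Lemma eexp_even_pair (n : nat) :
  eexp q (q ^ (2 * n%:Z)) * eexp q (q ^ (- (2 * n%:Z))) =
  q ^ (- (n%:Z * n%:Z)) * eexp q 1 ^+ 2.
Proof.
have h : poch 1 n * eexp q (q ^ (2 * n%:Z)) = eexp q 1.
  by rewrite (eexp_qpoch q0 q1 1 n) mul1r.
rewrite eexp_even_opp mulrC mulrAC -[_ * poch 1 n * _]mulrA h; ring.
Qed.

Lemma eexp_odd_pair (n : nat) :
  eexp q (q ^ (2 * n%:Z + 1)) * eexp q (q ^ (- (2 * n%:Z + 1))) =
  2 * q ^ (- (n%:Z * n%:Z + n%:Z)) * eexp q q ^+ 2.
Proof.
have h : poch q n * eexp q (q ^ (2 * n%:Z + 1)) = eexp q q.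
  have e : q ^ (2 * n%:Z + 1) = q * q ^+ (2 * n).
    by rewrite (expfzDr _ _ q0) expr1z [LHS]mulrC.
  by rewrite e -(eexp_qpoch q0 q1 q n).
rewrite eexp_odd_opp mulrC mulrAC -[_ * poch q n * _]mulrA h; ring.
Qed.

Lemma abssum_slater (v : C) (b : int) (s w : int -> int) : `|b| <= 5 ->
  abssum (fun n : int => q ^ (n * n + b * n) * (poch v `|s n| * u (w n))).
Proof.
move=> hb; have [U [U0 HU]] := rpoch_bounded q0 q1.
have [M [M0 HM]] := qpoch_bounded q0 q1 v.
apply: (@abssum_qpow _ q q0 q1 _ (fun n : int => `|n|%N) 1 36 (M * U)
  (fun n : int => n * n + b * n) (fun n => poch v `|s n| * u (w n))).
- exact: geo_absz.
- by [].
- by move=> n; rewrite normrM; apply: ler_pM.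
- by move=> n _; nia.
Qed.

Lemma eexp_even_pairz (a : int) :
  eexp q (q ^ (2 * a)) * eexp q (q ^ (- (2 * a))) =
  q ^ (- (a * a)) * eexp q 1 ^+ 2.
Proof.
case: a => a; first exact: eexp_even_pair.
rewrite NegzE mulrN opprK mulrNN mulrC; exact: eexp_even_pair.
Qed.

Lemma eexp_odd_pairz (a : int) :
  eexp q (q ^ (2 * a + 1)) * eexp q (q ^ (- (2 * a + 1))) =
  2 * q ^ (- (a * a + a)) * eexp q q ^+ 2.
Proof.
case: a => a; first exact: eexp_odd_pair.
rewrite (_ : 2 * Negz a + 1 = - (2 * a%:Z + 1)) ?opprK; last by lia.
rewrite (_ : Negz a * Negz a + Negz a = a%:Z * a%:Z + a%:Z); last by lia.
by rewrite mulrC; exact: eexp_odd_pair.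
Qed.

Lemma mul3_eq (x y z x' y' z' : C) :
  x = x' -> y = y' -> z = z' -> x * y * z = x' * y' * z'.
Proof. by move=> -> -> ->. Qed.

Lemma mul2_eq (x y x' y' : C) : x = x' -> y = y' -> x * y = x' * y'.
Proof. by move=> -> ->. Qed.

Local Opaque eexp qpoch.

Definition sector (al be ga M : int) (e : C) : C :=
  eexp q (e * q ^ M) * eexp q (e * q ^ (- M)) * eexp q (e * q ^ (al + M)) *
  eexp q (e * q ^ (be - M)) * eexp q (e * q ^ (ga - M)).

Lemma sector_even (al be ga a b : int) (c : nat) :
  al + 2 * a = 2 * b -> be - 2 * a = - (2 * b) -> ga - 2 * a = - (2 * c%:Z) ->
  sector al be ga (2 * a) 1 =
  q ^ (- (a * a + b * b + c%:Z * c%:Z)) * poch 1 c * eexp q 1 ^+ 5.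
Proof.
move=> e1 e2 e3; rewrite /sector e1 e2 e3 !mul1r -[X in X * eexp q (q ^ (- (2 * c%:Z)))]mulrA.
apply: (etrans (mul3_eq (eexp_even_pairz a) (eexp_even_pairz b) (eexp_even_opp c))).
have -> : q ^ (- (a * a + b * b + c%:Z * c%:Z)) =
    q ^ (- (a * a)) * q ^ (- (b * b)) * q ^ (- (c%:Z * c%:Z)).
  by rewrite -!expfzDr //; congr (_ ^ _); ring.
ring.
Qed.

(** Each of the two pairs and the unpaired factor contributes a 2, hence the constant 8. *)
Lemma sector_odd (al be ga a b : int) (c : nat) :
  al + (2 * a + 1) = 2 * b + 1 -> be - (2 * a + 1) = - (2 * b + 1) ->
  ga - (2 * a + 1) = - (2 * c%:Z + 1) ->
  sector al be ga (2 * a + 1) 1 =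
  8 * q ^ (- (a * a + a + (b * b + b) + (c%:Z * c%:Z + c%:Z))) *
  poch q c * eexp q q ^+ 5.
Proof.
move=> e1 e2 e3; rewrite /sector e1 e2 e3 !mul1r -[X in X * eexp q (q ^ (- (2 * c%:Z + 1)))]mulrA.
apply: (etrans (mul3_eq (eexp_odd_pairz a) (eexp_odd_pairz b) (eexp_odd_opp c))).
have -> : q ^ (- (a * a + a + (b * b + b) + (c%:Z * c%:Z + c%:Z))) =
    q ^ (- (a * a + a)) * q ^ (- (b * b + b)) * q ^ (- (c%:Z * c%:Z + c%:Z)).
  by rewrite -!expfzDr //; congr (_ ^ _); ring.
ring.
Qed.

(** The index [N] of [csum_nahm_term] is split by parity. The sector depends on M = N + t, so the
    parity of [t] decides which half has M even. *)
Lemma csum_nahm_split (al be ga t : int) : 0 <= t <= 2 -> be + ga = 2 * t ->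
  `|al| <= 2 -> `|be| <= 2 -> `|ga| <= 2 ->
  csum (nahm_term q al be ga) =
  csum (fun k => q ^ (4 * k * k + 2 * k) * u (2 * k) / 2 *
    (sector al be ga (2 * k + t) 1 + sector al be ga (2 * k + t) (-1))) -
  csum (fun k => q ^ (4 * k * k + 6 * k + 2) * u (2 * k + 1) / 2 *
    (sector al be ga (2 * k + 1 + t) 1 + sector al be ga (2 * k + 1 + t) (-1))).
Proof.
move=> t02 bg hal hbe hga.
have cE := csum_nahm_term q0 q1 t02 bg hal hbe hga.
have E0 := eexpNq_neq0 q0 q1.
set W := (fun N : int => _) in cE.
have aW : abssum W.
  have := abssumZ (eexp q (- q))^-1
    (abssum_fubini (abssum_unfolded_term q0 q1 t02 hal hbe hga)).
  by apply: eq_abssum => N; rewrite csum_unfolded_slice // mulKf.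
rewrite cE (csum_residues (d := 2) _ aW) // !big_ord_recr big_ord0 /= add0r.
congr (_ + _).
  apply: eq_csum => k; rewrite addr0 /W big_cons big_seq1 -[2%N%:Z]/(2 : int).
  apply: mul2_eq; last by [].
  rewrite exprN1_even mul1r; congr (q ^ _ * _ / _); ring.
rewrite -[RHS]mulN1r -csum_scale; apply: eq_csum => k.
rewrite /W big_cons big_seq1 -[2%N%:Z]/(2 : int) -[1%N%:Z]/(1 : int).
rewrite [RHS]mulrA; apply: mul2_eq; last by [].
rewrite expfzDr ?oppr_eq0 ?oner_eq0 // exprN1_even mul1r expr1z.
rewrite (_ : (2 * k + 1) * (2 * k + 1) + (2 * k + 1) = 4 * k * k + 6 * k + 2); last by ring.
by rewrite !mulrA.
Qed.

(** The factor E(- q^(- M)) sits at a zero of Euler's product. *)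
Lemma sector_minus_odd (al be ga : int) (m : nat) :
  sector al be ga (2 * m%:Z + 1) (-1) = 0.
Proof.
by rewrite /sector [-1 * q ^ (- _)]mulN1r (eexp_eq0 q0 q1 m) mulr0 !mul0r.
Qed.
End SectorValues.

Lemma sector_minus_even (R : realType) (q : R[i]) (al be ga m : int) :
  sector q (2 * al) (2 * be) (2 * ga) (2 * m) (-1) =
  sector (- q) (2 * al) (2 * be) (2 * ga) (2 * m) 1.
Proof.
rewrite /sector !mulN1r !mul1r !eexpN -!mulrN -!(mulrDr 2 : forall x y : int, _).
by rewrite !exprzN_even.
Qed.

(** * The three triple sums as combinations of six sums of Slater's type *)

Section ThreeSums.
Context {R : realType}.
Local Notation C := R[i].

Local Notation poch q v n := (qpoch (- (q * v)) (q ^+ 2) n).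

Local Opaque csum eexp qpoch rpoch sector.

Definition sum_A1 (q : C) : C :=
  csum (fun n : int => q ^ (n * n + 2 * n) * poch q 1 `|n| * rpoch q (2 * n)).
Definition sum_A3 (q : C) : C :=
  csum (fun n : int => q ^ (n * n) * poch q 1 `|n| * rpoch q (2 * n)).
Definition sum_A5 (q : C) : C :=
  csum (fun n : int => q ^ (n * n + 2 * n) * poch q 1 `|n + 1| * rpoch q (2 * n + 1)).
Definition sum_B2 (q : C) : C :=
  csum (fun n : int => q ^ (n * n + n) * poch q q `|n| * rpoch q (2 * n)).
Definition sum_B4 (q : C) : C :=
  csum (fun n : int => q ^ (n * n + n) * poch q q `|n| * rpoch q (2 * n + 1)).
Definition sum_B6 (q : C) : C :=
  csum (fun n : int => q ^ (n * n + 3 * n) * poch q q `|n| * rpoch q (2 * n + 1)).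

Lemma abssum_slaterA (q v : C) (b : int) (s w : int -> int) : q != 0 -> `|q| < 1 ->
  `|b| <= 5 ->
  abssum (fun n : int => q ^ (n * n + b * n) * poch q v `|s n| * rpoch q (w n)).
Proof.
move=> q0 q1 hb; have := abssum_slater q0 q1 v s w hb.
by apply: eq_abssum => n; rewrite mulrA.
Qed.

Context (q : C) (q0 : q != 0) (q1 : `|q| < 1).

Let nq0 : - q != 0. Proof. by rewrite oppr_eq0. Qed.
Let nq1 : `|- q| < 1. Proof. by rewrite normrN. Qed.

Lemma csum_combination (x y : C) (f g h : int -> C) : abssum f -> abssum g ->
  (forall n, h n = x * f n + y * g n) -> csum h = x * csum f + y * csum g.
Proof.
move=> af ag hE; rewrite (eq_csum hE) csumD; [|exact: abssumZ|exact: abssumZ].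
by rewrite !csum_scale.
Qed.

(* The zeros [M] even: both signs contribute, exchanged by [q -> - q]. *)
Lemma csum_even_sectors (al be ga b0 c0 : int) (a b s w Y : int -> int) :
  `|b0| <= 5 -> (forall k, k < 0 -> w k < 0) ->
  (forall k, 0 <= k -> 2 * al + 2 * a k = 2 * b k) ->
  (forall k, 0 <= k -> 2 * be - 2 * a k = - (2 * b k)) ->
  (forall k, 0 <= k -> 2 * ga - 2 * a k = - (2 * s k)) ->
  (forall k, 0 <= k -> 0 <= s k) ->
  (forall k, 0 <= k -> k * k + b0 * k + c0 =
     2 * Y k - (a k * a k + b k * b k + s k * s k)) ->
  csum (fun k => q ^ (2 * Y k) * rpoch q (w k) / 2 *
    (sector q (2 * al) (2 * be) (2 * ga) (2 * a k) 1 +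
     sector q (2 * al) (2 * be) (2 * ga) (2 * a k) (-1))) =
  q ^ c0 / 2 * (eexp q 1 ^+ 5 * csum (fun n : int =>
    q ^ (n * n + b0 * n) * poch q 1 `|s n| * rpoch q (w n))) +
  (- q) ^ c0 / 2 * (eexp (- q) 1 ^+ 5 * csum (fun n : int =>
    (- q) ^ (n * n + b0 * n) * poch (- q) 1 `|s n| * rpoch (- q) (w n))).
Proof.
move=> hb hw h1 h2 h3 h4 h5.
have a1 := abssum_slaterA 1 (b := b0) s w q0 q1 hb.
have a2 := abssum_slaterA 1 (b := b0) s w nq0 nq1 hb.
have fin (x y e d c f : C) : x * y * c + e * d * f = x * (y * c) + e * (d * f) by ring.
rewrite -fin; apply: (csum_combination a1 a2) => k.
(* For k < 0 both sides vanish through u(w k); the relations between [a], [b], [s] and [Y] are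
   assumed only for k >= 0. *)
have [k0|k0] := ltP k 0.
  have u0 (p : C) : rpoch p (w k) = 0 by rewrite rpoch_lt0 ?hw.
  have z (x y e d c f g : C) : x * 0 * y * e = d * (c * 0) + f * (g * 0) by ring.
  by rewrite (u0 q) (u0 (- q)); exact: z.
have ev (p : C) : p != 0 -> `|p| < 1 ->
    p ^ (2 * Y k) * rpoch p (w k) / 2 *
    sector p (2 * al) (2 * be) (2 * ga) (2 * a k) 1 =
    p ^ c0 / 2 * eexp p 1 ^+ 5 *
    (p ^ (k * k + b0 * k) * poch p 1 `|s k| * rpoch p (w k)).
  move=> p0 p1; rewrite (@sector_even _ p p0 p1 _ _ _ _ (b k) `|s k|) ?h1 ?h2 //; last first.
    by rewrite h3 // gez0_abs ?h4.
  rewrite gez0_abs ?h4 //.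
  have pE : p ^ c0 * p ^ (k * k + b0 * k) =
      p ^ (2 * Y k) * p ^ (- (a k * a k + b k * b k + s k * s k)).
    by rewrite -!expfzDr // -h5 //; congr (_ ^ _); ring.
  have rearrange (x y v P U E c d : C) : c * d = x * y ->
      x * U * v * (y * P * E) = c * v * E * (d * P * U).
    move=> cd; transitivity ((x * y) * (v * P * E * U)); first by ring.
    by rewrite -cd; ring.
  exact: rearrange.
have e2 := ev (- q) nq0 nq1; rewrite exprzN_even in e2.
apply: (etrans (mulrDr _ _ _)); apply: f_equal2; first exact: (ev q q0 q1).
by rewrite sector_minus_even -(rpochN q); exact: e2.
Qed.

(* The zeros [M] odd: the sign [-1] contributes nothing. *)
Lemma csum_odd_sectors (al be ga b0 c0 : int) (a b s w X : int -> int) :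
  (forall k, k < 0 -> w k < 0) -> (forall k, 0 <= k -> 0 <= a k) ->
  (forall k, 0 <= k -> al + (2 * a k + 1) = 2 * b k + 1) ->
  (forall k, 0 <= k -> be - (2 * a k + 1) = - (2 * b k + 1)) ->
  (forall k, 0 <= k -> ga - (2 * a k + 1) = - (2 * s k + 1)) ->
  (forall k, 0 <= k -> 0 <= s k) ->
  (forall k, 0 <= k -> k * k + b0 * k + c0 =
     X k - (a k * a k + a k + (b k * b k + b k) + (s k * s k + s k))) ->
  csum (fun k => q ^ X k * rpoch q (w k) / 2 *
    (sector q al be ga (2 * a k + 1) 1 + sector q al be ga (2 * a k + 1) (-1))) =
  4 * q ^ c0 * (eexp q q ^+ 5 * csum (fun n : int =>
    q ^ (n * n + b0 * n) * poch q q `|s n| * rpoch q (w n))).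
Proof.
move=> hw h0 h1 h2 h3 h4 h5.
rewrite mulrA -csum_scale; apply: eq_csum => k.
have [k0|k0] := ltP k 0.
  have u0 : rpoch q (w k) = 0 by rewrite rpoch_lt0 ?hw.
  have z (x y e d c : C) : x * 0 * y * e = d * (c * 0) by ring.
  by rewrite u0; exact: z.
have -> : sector q al be ga (2 * a k + 1) (-1) = 0.
  by rewrite -(gez0_abs (h0 k k0)); exact: sector_minus_odd.
rewrite addr0 (@sector_odd _ q q0 q1 _ _ _ _ (b k) `|s k|) ?h1 ?h2 //; last first.
  by rewrite h3 // gez0_abs ?h4.
rewrite gez0_abs ?h4 //.
have pE : q ^ c0 * q ^ (k * k + b0 * k) =
    q ^ X k * q ^ (- (a k * a k + a k + (b k * b k + b k) + (s k * s k + s k))).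
  by rewrite -!expfzDr // -h5 //; congr (_ ^ _); ring.
have rearrange (x y P U E c d : C) : c * d = x * y ->
    x * U / 2 * (8 * y * P * E) = 4 * c * E * (d * P * U).
  move=> cd; transitivity (4 * (x * y) * (P * E * U)); first by field.
  by rewrite -cd; ring.
exact: rearrange.
Qed.

Lemma nahm_sum2 : csum (nahm_term q 0 0 0) =
  1 / 2 * (eexp q 1 ^+ 5 * sum_A1 q) + 1 / 2 * (eexp (- q) 1 ^+ 5 * sum_A1 (- q)) -
  4 * q ^ 2 * (eexp q q ^+ 5 * sum_B6 q).
Proof.
rewrite (csum_nahm_split q0 q1 (t := 0)) //; congr (_ - _).
  (* The data are read off from M = 2a, al + M = 2b (with al the full coefficient), M - ga = 2s, N =
     w and N^2 + N = 2Y; the integers 2 and 0 are the linear and constant coefficients of the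
     resulting exponent. *)
  have := @csum_even_sectors 0 0 0 2 0 id id id (fun k => 2 * k)
    (fun k => 2 * k * k + k) isT.
  rewrite !expr0z => <-; try by move=> k *; lia.
  apply: eq_csum => k; rewrite addr0.
  by rewrite (_ : 4 * k * k + 2 * k = 2 * (2 * k * k + k)) //; ring.
have := @csum_odd_sectors 0 0 0 3 2 id id id (fun k => 2 * k + 1)
  (fun k => 4 * k * k + 6 * k + 2).
move=> <-; try by move=> k *; lia.
by apply: eq_csum => k; rewrite addr0.
Qed.

(** Here t = 1, so even N give odd M and the sum B2, while odd N give even M and the sums A5. *)
Lemma nahm_sum1 : csum (nahm_term q (-2) 2 0) =
  4 * (eexp q q ^+ 5 * sum_B2 q) - 1 / 2 * (eexp q 1 ^+ 5 * sum_A5 q) -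
  1 / 2 * (eexp (- q) 1 ^+ 5 * sum_A5 (- q)).
Proof.
rewrite (csum_nahm_split q0 q1 (t := 1)) // -addrA -opprD; congr (_ - _).
  have := @csum_odd_sectors (-2) 2 0 1 0 id (fun k => k - 1) id (fun k => 2 * k)
    (fun k => 4 * k * k + 2 * k).
  rewrite expr0z mulr1 /sum_B2 => h.
  rewrite h; try by move=> k *; lia.
  by congr (_ * (_ * _)); apply: eq_csum => k; rewrite mul1r.
have := @csum_even_sectors (-1) 1 0 2 0 (fun k => k + 1) id (fun k => k + 1)
  (fun k => 2 * k + 1) (fun k => 2 * k * k + 3 * k + 1) isT.
rewrite !expr0z => <-; try by move=> k *; lia.
apply: eq_csum => k; rewrite (_ : 2 * k + 1 + 1 = 2 * (k + 1)); last by ring.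
by rewrite (_ : 4 * k * k + 6 * k + 2 = 2 * (2 * k * k + 3 * k + 1)) //; ring.
Qed.

Lemma nahm_sum3 : csum (nahm_term q (-2) 2 2) =
  1 / (2 * q) * (eexp q 1 ^+ 5 * sum_A3 q) -
  1 / (2 * q) * (eexp (- q) 1 ^+ 5 * sum_A3 (- q)) -
  4 * (eexp q q ^+ 5 * sum_B4 q).
Proof.
rewrite (csum_nahm_split q0 q1 (t := 2)) //; congr (_ - _).
  (* The residual constant exponent is -1, so q -> - q changes the sign of the prefactor; this
     accounts for the minus sign between the two A3 sums. *)
  have -> : 1 / (2 * q) = q ^ (-1) / 2 by rewrite div1r invfM mulrC.
  have -> (x : C) : - (q ^ (-1) / 2 * x) = (- q) ^ (-1) / 2 * x.
    by rewrite -[q ^ (-1)]/(q^-1) -[(- q) ^ (-1)]/((- q)^-1) invrN !mulNr.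
  have := @csum_even_sectors (-1) 1 1 0 (-1) (fun k => k + 1) id id
    (fun k => 2 * k) (fun k => 2 * k * k + k) isT.
  move=> h; rewrite /sum_A3.
  have e0 (p : C) : csum (fun n : int => p ^ (n * n) * poch p 1 `|n| * rpoch p (2 * n)) =
      csum (fun n : int => p ^ (n * n + 0 * n) * poch p 1 `|n| * rpoch p (2 * n)).
    by apply: eq_csum => n; rewrite mul0r addr0.
  rewrite (e0 q) (e0 (- q)) -h; try by move=> k *; lia.
  apply: eq_csum => k; rewrite (_ : 2 * k + 2 = 2 * (k + 1)); last by ring.
  by rewrite (_ : 4 * k * k + 2 * k = 2 * (2 * k * k + k)) //; ring.
have := @csum_odd_sectors (-2) 2 2 1 0 (fun k => k + 1) id id (fun k => 2 * k + 1)
  (fun k => 4 * k * k + 6 * k + 2).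
rewrite expr0z mulr1 /sum_B4 => h.
rewrite (@eq_csum _ _ (fun n : int => q ^ (n * n + n) * poch q q `|n| * rpoch q (2 * n + 1))
  (fun n : int => q ^ (n * n + 1 * n) * poch q q `|n| * rpoch q (2 * n + 1))); last first.
  by move=> k; rewrite mul1r.
rewrite -h; try by move=> k *; lia.
by apply: eq_csum => k; rewrite (_ : 2 * k + 1 + 2 = 2 * (k + 1) + 1) //; ring.
Qed.
End ThreeSums.

(** * Products modulo 28 *)

Section ProductIdentities.
Context {K : fieldType}.

(* [x a] stands for [(q^a; q^28)_oo]. *)
Definition odd_atoms (x : nat -> K) := x 1%N * x 3%N * x 5%N * x 7%N * x 9%N *
  x 11%N * x 13%N * x 15%N * x 17%N * x 19%N * x 21%N * x 23%N * x 25%N * x 27%N.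
Definition twice_odd_atoms (x : nat -> K) := x 2%N * x 6%N * x 10%N * x 14%N *
  x 18%N * x 22%N * x 26%N.
Definition four_atoms (x : nat -> K) := x 4%N * x 8%N * x 12%N * x 16%N * x 20%N *
  x 24%N * x 28%N.
Definition seven_atoms (x : nat -> K) := x 7%N * x 14%N * x 21%N * x 28%N.
Definition fourteen_atoms (x : nat -> K) := x 14%N * x 28%N.
Definition atoms28 (x : nat -> K) (a : nat) := x a * x (28 - a)%N * x 28%N.
Definition atoms14 (x : nat -> K) (a : nat) :=
  (x a * x (a + 14)%N) * (x (14 - a)%N * x (28 - a)%N) * fourteen_atoms x.
Definition quint_atoms (x : nat -> K) (a : nat) := fourteen_atoms x *
  (x a * x (a + 14)%N) * (x (14 - a)%N * x (28 - a)%N) *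
  (x (14 + 2 * a)%N * x (14 - 2 * a)%N).
(** The quintuple product at - q for odd [a], where (- q^b; q^14)_oo is written as (q^(2b); q^28)_oo
    / (q^b; q^14)_oo. *)
Definition quintN_atoms (x : nat -> K) (a : nat) := fourteen_atoms x *
  (x (2 * a)%N / (x a * x (a + 14)%N)) *
  (x (28 - 2 * a)%N / (x (14 - a)%N * x (28 - a)%N)) *
  (x (14 + 2 * a)%N * x (14 - 2 * a)%N).

Context (x : nat -> K) (x0 : forall a, (0 < a)%N -> x a != 0).

Local Notation O := (odd_atoms x).
Local Notation T := (twice_odd_atoms x).
Local Notation F := (four_atoms x).

Ltac atoms := rewrite /quint_atoms /quintN_atoms /atoms14 /atoms28 /fourteen_atoms
  /seven_atoms /subn /addn /muln /subn_rec /addn_rec /muln_rec /=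
  /odd_atoms /twice_odd_atoms /four_atoms; field; by rewrite !x0 //.

(** Here and in the eight lemmas that follow, both sides are Laurent monomials in the symbols x a,
    so clearing denominators decides the identity. *)
Lemma atoms_B2 : T^-1 ^+ 5 * (T^-1 / (T * F) * quint_atoms x 2) =
  F ^+ 6 * x 28%N ^+ 3 /
  ((T * F) ^+ 6 * atoms28 x 4 * atoms28 x 6 * atoms28 x 8).
Proof. by atoms. Qed.

Lemma atoms_B4 : T^-1 ^+ 5 * (T^-1 / (T * F) * quint_atoms x 4) =
  F ^+ 6 * x 28%N ^+ 3 /
  ((T * F) ^+ 6 * atoms28 x 2 * atoms28 x 8 * atoms28 x 12).
Proof. by atoms. Qed.

Lemma atoms_B6 : T^-1 ^+ 5 * (T^-1 / (T * F) * quint_atoms x 6) =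
  F ^+ 6 * x 28%N ^+ 3 /
  ((T * F) ^+ 6 * atoms28 x 4 * atoms28 x 10 * atoms28 x 12).
Proof. by atoms. Qed.

Lemma atoms_A1 : (T / O) ^+ 5 * (T / O / (T * F) * quint_atoms x 1) =
  (T * F) ^+ 11 * atoms14 x 1 * atoms28 x 12 / ((O * T * F) ^+ 6 * F ^+ 6 * x 28%N).
Proof. by atoms. Qed.

Lemma atoms_A3 : (T / O) ^+ 5 * (T / O / (T * F) * quint_atoms x 3) =
  (T * F) ^+ 11 * fourteen_atoms x * atoms28 x 3 * atoms28 x 11 /
  ((O * T * F) ^+ 6 * F ^+ 5 * x 28%N * atoms28 x 4 * atoms28 x 12).
Proof. by atoms. Qed.

Lemma atoms_A5 : (T / O) ^+ 5 * (T / O / (T * F) * quint_atoms x 5) =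
  (T * F) ^+ 11 * atoms14 x 5 * atoms28 x 4 / ((O * T * F) ^+ 6 * F ^+ 6 * x 28%N).
Proof. by atoms. Qed.

Lemma atoms_A1N : O ^+ 5 * (O / (T * F) * quintN_atoms x 1) =
  (O * T * F) ^+ 5 * seven_atoms x * atoms14 x 3 * atoms14 x 5 /
  ((T * F) ^+ 5 * atoms14 x 4 * atoms14 x 6 * fourteen_atoms x).
Proof. by atoms. Qed.

Lemma atoms_A3N : O ^+ 5 * (O / (T * F) * quintN_atoms x 3) =
  (O * T * F) ^+ 5 * seven_atoms x * atoms14 x 1 * atoms14 x 5 /
  ((T * F) ^+ 5 * atoms14 x 2 * atoms14 x 4 * fourteen_atoms x).
Proof. by atoms. Qed.

Lemma atoms_A5N : O ^+ 5 * (O / (T * F) * quintN_atoms x 5) =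
  (O * T * F) ^+ 5 * seven_atoms x * atoms14 x 1 * atoms14 x 3 /
  ((T * F) ^+ 5 * atoms14 x 2 * atoms14 x 6 * fourteen_atoms x).
Proof. by atoms. Qed.

End ProductIdentities.

(** * The products J_m, J_{a,m} and Euler's products in terms of (q^a; q^28)_oo *)

Section Atoms.
Context {R : realType}.
Local Notation C := R[i].

Definition atom (q : C) (a : nat) : C := qpochoo (q ^+ a) (q ^+ 28).

Context (q : C) (q0 : q != 0) (q1 : `|q| < 1).

Let qX0 n : q ^+ n != 0. Proof. by rewrite expf_neq0. Qed.

Lemma normqX_lt1 n : (0 < n)%N -> `|q ^+ n| < 1.
Proof. by move=> n0; rewrite normrX exprn_ilt1 ?normr_ge0 // -lt0n. Qed.

Lemma qpochooX_neq0 (a m : nat) : (0 < a)%N -> (0 < m)%N ->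
  qpochoo (q ^+ a) (q ^+ m) != 0.
Proof.
move=> a0 m0; apply: qpochoo_neq0 => //; first exact: normqX_lt1.
by move=> n; rewrite -exprM -exprD subr1_expn_neq0 // addn_gt0 a0.
Qed.

Lemma qpochoo_atoms (a m k : nat) (s : seq nat) : (0 < m)%N -> (m * k)%N = 28 ->
  [seq (a + m * i)%N | i <- iota 0 k] = s ->
  qpochoo (q ^+ a) (q ^+ m) = \prod_(j <- s) atom q j.
Proof.
move=> m0 mk <-; have k0 : (0 < k)%N by case: k mk; rewrite ?muln0.
rewrite (qpochoo_dissect _ (qX0 m) (normqX_lt1 m0) k0) big_map.
rewrite -(big_mkord xpredT (fun i => qpochoo (q ^+ a * (q ^+ m) ^+ i) ((q ^+ m) ^+ k))).
rewrite /index_iota subn0; apply: eq_bigr => i _.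
by rewrite /atom -!exprM -exprD mk.
Qed.

Lemma atom_pair (a : nat) : qpochoo (q ^+ a) (q ^+ 14) = atom q a * atom q (a + 14).
Proof.
rewrite (@qpochoo_atoms a 14 2 [:: a; a + 14]%N) //; last by rewrite /= muln0 addn0.
by rewrite !big_cons big_nil mulr1.
Qed.

Lemma J1_atoms : J_ q 1 = odd_atoms (atom q) * twice_odd_atoms (atom q) * four_atoms (atom q).
Proof.
have -> : J_ q 1 = _ :=
  @qpochoo_atoms 1 1 28 [:: 1; 2; 3; 4; 5; 6; 7; 8; 9; 10; 11; 12; 13; 14; 15; 16;
    17; 18; 19; 20; 21; 22; 23; 24; 25; 26; 27; 28]%N isT erefl
    erefl.
rewrite !big_cons big_nil; move: (atom q) => x.
by rewrite /odd_atoms /twice_odd_atoms /four_atoms; ring.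
Qed.

Lemma J2_atoms : J_ q 2 = twice_odd_atoms (atom q) * four_atoms (atom q).
Proof.
have -> : J_ q 2 = _ :=
  @qpochoo_atoms 2 2 14 [:: 2; 4; 6; 8; 10; 12; 14; 16; 18; 20; 22; 24; 26; 28]%N
    isT erefl erefl.
rewrite !big_cons big_nil; move: (atom q) => x.
by rewrite /twice_odd_atoms /four_atoms; ring.
Qed.

Lemma J4_atoms : J_ q 4 = four_atoms (atom q).
Proof.
have -> : J_ q 4 = _ :=
  @qpochoo_atoms 4 4 7 [:: 4; 8; 12; 16; 20; 24; 28]%N isT erefl erefl.
rewrite !big_cons big_nil; move: (atom q) => x.
by rewrite /four_atoms; ring.
Qed.

Lemma J7_atoms : J_ q 7 = seven_atoms (atom q).
Proof.
have -> : J_ q 7 = _ :=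
  @qpochoo_atoms 7 7 4 [:: 7; 14; 21; 28]%N isT erefl erefl.
rewrite !big_cons big_nil; move: (atom q) => x.
by rewrite /seven_atoms; ring.
Qed.

Lemma J14_atoms : J_ q 14 = fourteen_atoms (atom q).
Proof.
have -> : J_ q 14 = _ :=
  @qpochoo_atoms 14 14 2 [:: 14; 28]%N isT erefl erefl.
rewrite !big_cons big_nil; move: (atom q) => x.
by rewrite /fourteen_atoms; ring.
Qed.

Lemma exprzB_nat (m a : nat) : (a <= m)%N -> q ^ (m%:Z - a%:Z) = q ^+ (m - a).
Proof. by move=> am; rewrite subzn. Qed.

Lemma JJ28_atoms (a : nat) : (a <= 28)%N -> JJ q a 28 = atoms28 (atom q) a.
Proof. by move=> am; rewrite /JJ /atoms28 exprzB_nat. Qed.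

Lemma JJ14_atoms (a : nat) : (a <= 14)%N -> JJ q a 14 = atoms14 (atom q) a.
Proof.
move=> am; rewrite /JJ /atoms14 exprzB_nat // !atom_pair.
have e : qpochoo (q ^+ 14) (q ^+ 14) = fourteen_atoms (atom q) by exact: J14_atoms.
by rewrite /fourteen_atoms (_ : 14 - a + 14 = 28 - a)%N //; lia.
Qed.

Lemma odd_atoms_qpochoo : qpochoo (q ^+ 1) (q ^+ 2) = odd_atoms (atom q).
Proof.
have -> : qpochoo (q ^+ 1) (q ^+ 2) = _ :=
  @qpochoo_atoms 1 2 14 [:: 1; 3; 5; 7; 9; 11; 13; 15; 17; 19; 21; 23; 25; 27]%N isT
    erefl erefl.
rewrite !big_cons big_nil; move: (atom q) => x.
by rewrite /odd_atoms; ring.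
Qed.

Lemma twice_odd_atoms_qpochoo : qpochoo (q ^+ 2) (q ^+ 4) = twice_odd_atoms (atom q).
Proof.
have -> : qpochoo (q ^+ 2) (q ^+ 4) = _ :=
  @qpochoo_atoms 2 4 7 [:: 2; 6; 10; 14; 18; 22; 26]%N isT erefl erefl.
rewrite !big_cons big_nil; move: (atom q) => x.
by rewrite /twice_odd_atoms; ring.
Qed.

Lemma atom_neq0 a : (0 < a)%N -> atom q a != 0.
Proof. by move=> a0; exact: qpochooX_neq0. Qed.

Lemma odd_atoms_neq0 : odd_atoms (atom q) != 0.
Proof. by rewrite -odd_atoms_qpochoo qpochooX_neq0. Qed.

Lemma eexpNq_atoms : eexp q (- q) = twice_odd_atoms (atom q) * four_atoms (atom q).
Proof. by rewrite eexp_qpochoo // mulrN opprK -expr2 -J2_atoms. Qed.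

(** From (q; Q)_oo (- q; Q)_oo = (q^2; q^4)_oo. *)
Lemma eexp1_atoms : eexp q 1 = twice_odd_atoms (atom q) / odd_atoms (atom q).
Proof.
have h := qpochoo_sqr (q ^+ 1) (qX0 2) (normqX_lt1 (isT : 0 < 2)%N).
rewrite -!exprM odd_atoms_qpochoo twice_odd_atoms_qpochoo in h.
by rewrite eexp_qpochoo // mulr1 -h expr1 mulrC mulKf // odd_atoms_neq0.
Qed.

(** Euler's theorem on odd and distinct parts, (- Q; Q)_oo = 1 / (Q; Q^2)_oo. *)
Lemma eexpq_atoms : eexp q q = (twice_odd_atoms (atom q))^-1.
Proof.
have h := qpochoo_sqr (q ^+ 2) (qX0 2) (normqX_lt1 (isT : 0 < 2)%N).
have h2 : qpochoo (q ^+ 2) (q ^+ 2) = twice_odd_atoms (atom q) * four_atoms (atom q).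
  exact: J2_atoms.
have h4 : qpochoo ((q ^+ 2) ^+ 2) ((q ^+ 2) ^+ 2) = four_atoms (atom q).
  by rewrite -exprM; exact: J4_atoms.
have T0 : twice_odd_atoms (atom q) != 0.
  by rewrite -twice_odd_atoms_qpochoo qpochooX_neq0.
have F0 : four_atoms (atom q) != 0 by rewrite -J4_atoms qpochooX_neq0.
rewrite h2 h4 in h; apply: (etrans (eexp_qpochoo q q0 q1)); rewrite -expr2.
move: (twice_odd_atoms _) (four_atoms _) (qpochoo _ _) T0 F0 h => T F X T0 F0 h.
apply: (mulfI T0); rewrite divff //; apply: (mulfI F0).
by rewrite mulrA [F * T]mulrC h mulr1.
Qed.

Lemma eexpN1_atoms : eexp (- q) 1 = odd_atoms (atom q).
Proof.
by rewrite eexp_qpochoo ?oppr_eq0 ?normrN // mulr1 opprK sqrrN -odd_atoms_qpochoo expr1.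
Qed.

Lemma eexpNNq_atoms : eexp (- q) (- - q) = twice_odd_atoms (atom q) * four_atoms (atom q).
Proof. by rewrite eexpN opprK eexpNq_atoms. Qed.
End Atoms.

(** * The quintuple product in base q^14, at q and at - q *)

Section QuintupleAtoms.
Context {R : realType}.
Local Notation C := R[i].

Lemma quint_qpochoo (p : C) (a : nat) : p != 0 -> `|p| < 1 -> (a <= 6)%N ->
  quint p a%:Z = qpochoo (p ^+ 14) (p ^+ 14) * qpochoo (p ^+ a) (p ^+ 14) *
    qpochoo (p ^+ (14 - a)) (p ^+ 14) *
    (qpochoo (p ^+ (14 + 2 * a)) (p ^+ 28) * qpochoo (p ^+ (14 - 2 * a)) (p ^+ 28)).
Proof.
move=> p0 p1 a6; have p70 : p ^+ 7 != 0 by rewrite expf_neq0.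
have p71 : `|p ^+ 7| < 1 by rewrite normqX_lt1.
have pa0 : p ^+ a != 0 by rewrite expf_neq0.
(* The quintuple product with p^7 for q and p^a for z. *)
have := quintuple p70 p71 pa0.
have -> : csum (fun n : int => (p ^+ 7) ^ (3 * n * n + n) * (p ^+ a) ^ (- (3 * n))) =
    csum (fun n : int => p ^ (21 * n * n + (7 - 3 * a%:Z) * n)).
  apply: eq_csum => n; rewrite -[p ^+ 7]/(p ^ 7%N%:Z) -[p ^+ a]/(p ^ a%:Z) !exprz_exp.
  by rewrite -expfzDr //; congr (_ ^ _); ring.
have -> : csum (fun n : int => (p ^+ 7) ^ (3 * n * n + n) * (p ^+ a) ^ (3 * n + 1)) =
    csum (fun n : int => p ^ (21 * n * n + (7 + 3 * a%:Z) * n + a%:Z)).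
  apply: eq_csum => n; rewrite -[p ^+ 7]/(p ^ 7%N%:Z) -[p ^+ a]/(p ^ a%:Z) !exprz_exp.
  by rewrite -expfzDr //; congr (_ ^ _); ring.
rewrite -/(quint p a%:Z) => ->; rewrite -!exprM -!exprD.
have -> : p ^+ (7 * 2) / p ^+ a = p ^+ (14 - a).
  by rewrite -expfB // (leq_ltn_trans a6).
have -> : p ^+ (7 * 2) / p ^+ (a * 2) = p ^+ (14 - 2 * a).
  by rewrite mulnC [(a * 2)%N]mulnC -expfB //; lia.
by rewrite [(a * 2)%N]mulnC.
Qed.

Context (q : C) (q0 : q != 0) (q1 : `|q| < 1).

Lemma quint_atomsE (a : nat) : (a <= 6)%N -> quint q a%:Z = quint_atoms (atom q) a.
Proof.
move=> a6; have h14 : qpochoo (q ^+ 14) (q ^+ 14) = fourteen_atoms (atom q) by exact: atom_pair.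
have ha := atom_pair q0 q1 a.
have hb := atom_pair q0 q1 (14 - a).
have e : (14 - a + 14 = 28 - a)%N by lia.
rewrite e in hb; apply: (etrans (quint_qpochoo q0 q1 a6)).
exact: (f_equal2 *%R (f_equal2 *%R (f_equal2 *%R h14 ha) hb) erefl).
Qed.

Local Opaque GRing.exp.

Lemma quintN_atomsE (a : nat) : (0 < a <= 6)%N -> odd a ->
  quint (- q) a%:Z = quintN_atoms (atom q) a.
Proof.
have nq0 : - q != 0 by rewrite oppr_eq0.
have nq1 : `|- q| < 1 by rewrite normrN.
move=> /andP[a0 a6] oa; apply: (etrans (quint_qpochoo nq0 nq1 a6)).
have oX n : odd n -> (- q) ^+ n = - q ^+ n.
  by move=> on; rewrite exprNn -signr_odd on expr1 mulN1r.
have eX n : ~~ odd n -> (- q) ^+ n = q ^+ n.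
  by move=> en; rewrite exprNn -signr_odd (negPf en) expr0 mul1r.
have d0 : (0 < 14 - a)%N by lia.
have e : (14 - a + 14 = 28 - a)%N by lia.
have e2 : (2 * (14 - a) = 28 - 2 * a)%N by lia.
have odd14 : odd (14 - a) by rewrite oddB ?oa //; lia.
have even14D : ~~ odd (14 + 2 * a) by rewrite oddD oddM.
have even14B : ~~ odd (14 - 2 * a) by rewrite oddB ?oddM //; lia.
rewrite (oX a oa) (oX _ odd14) (eX 14 isT) (eX 28 isT) (eX _ even14D) (eX _ even14B).
have p14 := normqX_lt1 q1 (isT : 0 < 14)%N.
have q140 : q ^+ 14 != 0 by rewrite expf_neq0.
have neg b : (0 < b)%N -> qpochoo (- q ^+ b) (q ^+ 14) =
    atom q (2 * b) / (atom q b * atom q (b + 14)).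
  move=> b0; have := qpochoo_sqr (q ^+ b) q140 p14.
  rewrite (atom_pair q0 q1) -!exprM [(b * 2)%N]mulnC => h.
  have n0 : atom q b * atom q (b + 14) != 0.
    by rewrite mulf_neq0 // atom_neq0 // addn_gt0 b0.
  by apply: (mulfI n0); rewrite h mulrC divfK.
have h14 : qpochoo (q ^+ 14) (q ^+ 14) = fourteen_atoms (atom q) by exact: atom_pair.
have ha := neg a a0.
have hb := neg (14 - a)%N d0.
rewrite e e2 in hb.
exact: (f_equal2 *%R (f_equal2 *%R (f_equal2 *%R h14 ha) hb) erefl).
Qed.
End QuintupleAtoms.

(** * Product forms of the Slater sums and passage to [has_sum3] *)

Section TripleSums.
Context {R : realType}.
Local Notation C := R[i].

(** Since [g] vanishes when an index is negative, its sum is one over natural indices, and a finite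
    list witnessing [has_csum] gives the finite set required by the filter [totally]. *)
Lemma has_sum3_csum (f : nat -> nat -> nat -> C) (g : int * int * int -> C) s :
  abssum g -> csum g = s ->
  (forall i j k : int, (i < 0) || (j < 0) || (k < 0) -> g (i, j, k) = 0) ->
  (forall i j k : nat, f i j k = g (i%:Z, j%:Z, k%:Z)) ->
  has_sum3 f s.
Proof.
move=> ag <- g0 fg.
pose phi (x : nat * nat * nat) : int * int * int := (x.1.1%:Z, x.1.2%:Z, x.2%:Z).
pose psi (x : int * int * int) : nat * nat * nat := (`|x.1.1|, `|x.1.2|, `|x.2|)%N.
have phiK : cancel phi psi by move=> [[]].
have gphi i : phi (psi i) != i -> g i = 0.
  case: i => [[i j] k]; rewrite /phi /psi /= => h; apply: g0; apply: contraR h.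
  by rewrite !negb_or -!leNgt => /andP[/andP[i0 j0] k0]; rewrite !gez0_abs.
have [h _] := has_csum_reindex (csum g) phiK gphi.
have {}h := h (abssum_has_csum ag).
have FF : Filter (@totally (nat * nat * nat)%type) by apply: filter_filter; exact: totally_filter.
apply/cvgrPdistC_lt => e e0; have [A HA] := h _ e0.
exists [fset x in A]%fset => // B /= sB.
rewrite /partial_sum -(big_seq_fsetE _ _ predT (fun t : nat * nat * nat => f t.1.1 t.1.2 t.2)) /=.
rewrite (eq_bigr (fun x => g (phi x))) => [|x _]; last exact: fg.
apply: HA; first exact: fset_uniq.
by move=> x xA; apply: (fsubsetP sB); rewrite inE.
Qed.

Lemma nahm_term_lt0 (q : C) al be ga i j k :
  (i < 0) || (j < 0) || (k < 0) -> nahm_term q al be ga (i, j, k) = 0.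
Proof.
rewrite /nahm_term /=.
by case/orP => [/orP[]|] h; rewrite (@rpoch_lt0 _ q _ h) ?(mulr0, mul0r).
Qed.

Lemma nahm_term_nat (q : C) al be ga e (i j k : nat) :
  e = (j%:Z - k%:Z) * (j%:Z - k%:Z) + (j%:Z + k%:Z - i%:Z) * (j%:Z + k%:Z - i%:Z) +
    i%:Z * i%:Z + al * i%:Z + be * j%:Z + ga * k%:Z ->
  q ^ e / (qpoch (q ^+ 2) (q ^+ 2) i * qpoch (q ^+ 2) (q ^+ 2) j *
    qpoch (q ^+ 2) (q ^+ 2) k) = nahm_term q al be ga (i%:Z, j%:Z, k%:Z).
Proof. by move=> ->; rewrite /nahm_term /= !invfM. Qed.

Context (q : C) (q0 : q != 0) (q1 : `|q| < 1).

Local Notation x := (atom q).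
Local Notation O := (odd_atoms x).
Local Notation T := (twice_odd_atoms x).
Local Notation F := (four_atoms x).

Let nq0 : - q != 0. Proof. by rewrite oppr_eq0. Qed.
Let nq1 : `|- q| < 1. Proof. by rewrite normrN. Qed.

Local Opaque csum eexp qpoch qpochoo rpoch GRing.exp.

Lemma sum_A_atoms (s : C) (a : nat) : (a <= 6)%N ->
  s = eexp q 1 / eexp q (- q) * quint q a%:Z ->
  eexp q 1 ^+ 5 * s = (T / O) ^+ 5 * (T / O / (T * F) * quint_atoms x a).
Proof.
by move=> a6 ->; rewrite (quint_atomsE q0 q1 a6) (eexp1_atoms q0 q1) (eexpNq_atoms q0 q1).
Qed.

Lemma sum_AN_atoms (s : C) (a : nat) : (0 < a <= 6)%N -> odd a ->
  s = eexp (- q) 1 / eexp (- q) (- - q) * quint (- q) a%:Z ->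
  eexp (- q) 1 ^+ 5 * s = O ^+ 5 * (O / (T * F) * quintN_atoms x a).
Proof.
move=> a6 oa ->.
by rewrite (quintN_atomsE q0 q1 a6 oa) (eexpN1_atoms q0 q1) (eexpNNq_atoms q0 q1).
Qed.

Lemma sum_B_atoms (s : C) (a : nat) : (a <= 6)%N ->
  s = eexp q q / eexp q (- q) * quint q a%:Z ->
  eexp q q ^+ 5 * s = T^-1 ^+ 5 * (T^-1 / (T * F) * quint_atoms x a).
Proof.
by move=> a6 ->; rewrite (quint_atomsE q0 q1 a6) (eexpq_atoms q0 q1) (eexpNq_atoms q0 q1).
Qed.

Lemma product_B2 : eexp q q ^+ 5 * sum_B2 q =
  J_ q 4 ^+ 6 * J_ q 28 ^+ 3 /
  (J_ q 2 ^+ 6 * JJ q 4 28 * JJ q 6 28 * JJ q 8 28).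
Proof.
rewrite (@sum_B_atoms _ 2 isT (slater_B2 q0 q1)) (atoms_B2 (@atom_neq0 _ _ q0 q1)).
rewrite (J4_atoms q0 q1) (J2_atoms q0 q1) (@JJ28_atoms _ q 4 isT) (@JJ28_atoms _ q 6 isT).
by rewrite (@JJ28_atoms _ q 8 isT).
Qed.

Lemma product_B4 : eexp q q ^+ 5 * sum_B4 q =
  J_ q 4 ^+ 6 * J_ q 28 ^+ 3 /
  (J_ q 2 ^+ 6 * JJ q 2 28 * JJ q 8 28 * JJ q 12 28).
Proof.
rewrite (@sum_B_atoms _ 4 isT (slater_B4 q0 q1)) (atoms_B4 (@atom_neq0 _ _ q0 q1)).
rewrite (J4_atoms q0 q1) (J2_atoms q0 q1) (@JJ28_atoms _ q 2 isT) (@JJ28_atoms _ q 8 isT).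
by rewrite (@JJ28_atoms _ q 12 isT).
Qed.

Lemma product_B6 : eexp q q ^+ 5 * sum_B6 q =
  J_ q 4 ^+ 6 * J_ q 28 ^+ 3 /
  (J_ q 2 ^+ 6 * JJ q 4 28 * JJ q 10 28 * JJ q 12 28).
Proof.
rewrite (@sum_B_atoms _ 6 isT (slater_B6 q0 q1)) (atoms_B6 (@atom_neq0 _ _ q0 q1)).
rewrite (J4_atoms q0 q1) (J2_atoms q0 q1) (@JJ28_atoms _ q 4 isT) (@JJ28_atoms _ q 10 isT).
by rewrite (@JJ28_atoms _ q 12 isT).
Qed.

Lemma product_A1 : eexp q 1 ^+ 5 * sum_A1 q =
  J_ q 2 ^+ 11 * JJ q 1 14 * JJ q 12 28 /
  (J_ q 1 ^+ 6 * J_ q 4 ^+ 6 * J_ q 28).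
Proof.
rewrite (@sum_A_atoms _ 1 isT (slater_A1 q0 q1)) (atoms_A1 (@atom_neq0 _ _ q0 q1)).
rewrite (J2_atoms q0 q1) (J1_atoms q0 q1) (J4_atoms q0 q1).
by rewrite (@JJ14_atoms _ q q0 q1 1 isT) (@JJ28_atoms _ q 12 isT).
Qed.

Lemma product_A5 : eexp q 1 ^+ 5 * sum_A5 q =
  J_ q 2 ^+ 11 * JJ q 5 14 * JJ q 4 28 /
  (J_ q 1 ^+ 6 * J_ q 4 ^+ 6 * J_ q 28).
Proof.
rewrite (@sum_A_atoms _ 5 isT (slater_A5 q0 q1)) (atoms_A5 (@atom_neq0 _ _ q0 q1)).
rewrite (J2_atoms q0 q1) (J1_atoms q0 q1) (J4_atoms q0 q1).
by rewrite (@JJ14_atoms _ q q0 q1 5 isT) (@JJ28_atoms _ q 4 isT).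
Qed.

Lemma product_A3 : eexp q 1 ^+ 5 * sum_A3 q =
  J_ q 2 ^+ 11 * J_ q 14 * JJ q 3 28 * JJ q 11 28 /
  (J_ q 1 ^+ 6 * J_ q 4 ^+ 5 * J_ q 28 * JJ q 4 28 * JJ q 12 28).
Proof.
rewrite (@sum_A_atoms _ 3 isT (slater_A3 q0 q1)) (atoms_A3 (@atom_neq0 _ _ q0 q1)).
rewrite (J2_atoms q0 q1) (J14_atoms q0 q1) (J1_atoms q0 q1) (J4_atoms q0 q1).
rewrite (@JJ28_atoms _ q 3 isT) (@JJ28_atoms _ q 11 isT).
by rewrite (@JJ28_atoms _ q 4 isT) (@JJ28_atoms _ q 12 isT).
Qed.

Lemma product_A1N : eexp (- q) 1 ^+ 5 * sum_A1 (- q) =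
  J_ q 1 ^+ 5 * J_ q 7 * JJ q 3 14 * JJ q 5 14 /
  (J_ q 2 ^+ 5 * JJ q 4 14 * JJ q 6 14 * J_ q 14).
Proof.
rewrite (@sum_AN_atoms _ 1 isT isT (slater_A1 nq0 nq1)).
rewrite (atoms_A1N (@atom_neq0 _ _ q0 q1)) (J1_atoms q0 q1) (J7_atoms q0 q1).
rewrite (J2_atoms q0 q1) (J14_atoms q0 q1).
rewrite (@JJ14_atoms _ q q0 q1 3 isT) (@JJ14_atoms _ q q0 q1 5 isT).
by rewrite (@JJ14_atoms _ q q0 q1 4 isT) (@JJ14_atoms _ q q0 q1 6 isT).
Qed.

Lemma product_A3N : eexp (- q) 1 ^+ 5 * sum_A3 (- q) =
  J_ q 1 ^+ 5 * J_ q 7 * JJ q 1 14 * JJ q 5 14 /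
  (J_ q 2 ^+ 5 * JJ q 2 14 * JJ q 4 14 * J_ q 14).
Proof.
rewrite (@sum_AN_atoms _ 3 isT isT (slater_A3 nq0 nq1)).
rewrite (atoms_A3N (@atom_neq0 _ _ q0 q1)) (J1_atoms q0 q1) (J7_atoms q0 q1).
rewrite (J2_atoms q0 q1) (J14_atoms q0 q1).
rewrite (@JJ14_atoms _ q q0 q1 1 isT) (@JJ14_atoms _ q q0 q1 5 isT).
by rewrite (@JJ14_atoms _ q q0 q1 2 isT) (@JJ14_atoms _ q q0 q1 4 isT).
Qed.

Lemma product_A5N : eexp (- q) 1 ^+ 5 * sum_A5 (- q) =
  J_ q 1 ^+ 5 * J_ q 7 * JJ q 1 14 * JJ q 3 14 /
  (J_ q 2 ^+ 5 * JJ q 2 14 * JJ q 6 14 * J_ q 14).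
Proof.
rewrite (@sum_AN_atoms _ 5 isT isT (slater_A5 nq0 nq1)).
rewrite (atoms_A5N (@atom_neq0 _ _ q0 q1)) (J1_atoms q0 q1) (J7_atoms q0 q1).
rewrite (J2_atoms q0 q1) (J14_atoms q0 q1).
rewrite (@JJ14_atoms _ q q0 q1 1 isT) (@JJ14_atoms _ q q0 q1 3 isT).
by rewrite (@JJ14_atoms _ q q0 q1 2 isT) (@JJ14_atoms _ q q0 q1 6 isT).
Qed.

End TripleSums.

Theorem theorem4p1 (R : realType) (q : R[i]) (hq0 : 0 < `|q|) (hq1 : `|q| < 1) :
  [/\ has_sum3
        (fun i j k : nat =>
           q ^ (2 * i%:Z ^+ 2 + 2 * j%:Z ^+ 2 + 2 * k%:Z ^+ 2
                - 2 * i%:Z * j%:Z - 2 * i%:Z * k%:Z - 2 * i%:Z + 2 * j%:Z)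
           / (qpoch (q ^+ 2) (q ^+ 2) i * qpoch (q ^+ 2) (q ^+ 2) j
              * qpoch (q ^+ 2) (q ^+ 2) k))
        (4 * (J_ q 4 ^+ 6 * J_ q 28 ^+ 3
              / (J_ q 2 ^+ 6 * JJ q 4 28 * JJ q 6 28 * JJ q 8 28))
         - 1 / 2 * (J_ q 1 ^+ 5 * J_ q 7 * JJ q 1 14 * JJ q 3 14
                    / (J_ q 2 ^+ 5 * JJ q 2 14 * JJ q 6 14 * J_ q 14))
         - 1 / 2 * (J_ q 2 ^+ 11 * JJ q 5 14 * JJ q 4 28
                    / (J_ q 1 ^+ 6 * J_ q 4 ^+ 6 * J_ q 28))),
      has_sum3
        (fun i j k : nat =>
           q ^ (2 * i%:Z ^+ 2 + 2 * j%:Z ^+ 2 + 2 * k%:Z ^+ 2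
                - 2 * i%:Z * j%:Z - 2 * i%:Z * k%:Z)
           / (qpoch (q ^+ 2) (q ^+ 2) i * qpoch (q ^+ 2) (q ^+ 2) j
              * qpoch (q ^+ 2) (q ^+ 2) k))
        (1 / 2 * (J_ q 2 ^+ 11 * JJ q 1 14 * JJ q 12 28
                  / (J_ q 1 ^+ 6 * J_ q 4 ^+ 6 * J_ q 28))
         + 1 / 2 * (J_ q 1 ^+ 5 * J_ q 7 * JJ q 3 14 * JJ q 5 14
                    / (J_ q 2 ^+ 5 * JJ q 4 14 * JJ q 6 14 * J_ q 14))
         - 4 * q ^+ 2 * (J_ q 4 ^+ 6 * J_ q 28 ^+ 3
                         / (J_ q 2 ^+ 6 * JJ q 4 28 * JJ q 10 28 * JJ q 12 28)))
    & has_sum3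
        (fun i j k : nat =>
           q ^ (2 * i%:Z ^+ 2 + 2 * j%:Z ^+ 2 + 2 * k%:Z ^+ 2
                - 2 * i%:Z * j%:Z - 2 * i%:Z * k%:Z
                - 2 * i%:Z + 2 * j%:Z + 2 * k%:Z)
           / (qpoch (q ^+ 2) (q ^+ 2) i * qpoch (q ^+ 2) (q ^+ 2) j
              * qpoch (q ^+ 2) (q ^+ 2) k))
        (1 / (2 * q) * (J_ q 2 ^+ 11 * J_ q 14 * JJ q 3 28 * JJ q 11 28
                        / (J_ q 1 ^+ 6 * J_ q 4 ^+ 5 * J_ q 28
                           * JJ q 4 28 * JJ q 12 28))
         - 1 / (2 * q) * (J_ q 1 ^+ 5 * J_ q 7 * JJ q 1 14 * JJ q 5 14
                          / (J_ q 2 ^+ 5 * JJ q 2 14 * JJ q 4 14 * J_ q 14))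
         - 4 * (J_ q 4 ^+ 6 * J_ q 28 ^+ 3
                / (J_ q 2 ^+ 6 * JJ q 2 28 * JJ q 8 28 * JJ q 12 28)))].

Proof.
have q0 : q != 0 by rewrite -normr_gt0.
split.
- have ag : abssum (nahm_term q (-2) 2 0) by apply: (@abssum_nahm_term _ q q0 hq1 _ _ _ 1).
  have e := f_equal2 (fun a b => a - 1 / 2 * b) (f_equal2 (fun a b => 4 * a - 1 / 2 * b)
    (product_B2 q0 hq1) (product_A5 q0 hq1)) (product_A5N q0 hq1).
  (* The statement lists the product coming from - q before the one coming from q, hence the
     exchange by [addrAC]. *)
  apply: (has_sum3_csum ag (etrans (etrans (nahm_sum1 q0 hq1) e) (addrAC _ _ _))).
    by move=> i j k; exact: nahm_term_lt0.
  by move=> i j k; apply: nahm_term_nat; ring.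
- have ag : abssum (nahm_term q 0 0 0) by apply: (@abssum_nahm_term _ q q0 hq1 _ _ _ 0).
  have e := f_equal2 (fun a b => a - 4 * q ^ 2 * b) (f_equal2 (fun a b => 1 / 2 * a + 1 / 2 * b)
    (product_A1 q0 hq1) (product_A1N q0 hq1)) (product_B6 q0 hq1).
  apply: (has_sum3_csum ag (etrans (nahm_sum2 q0 hq1) e)).
    by move=> i j k; exact: nahm_term_lt0.
  by move=> i j k; apply: nahm_term_nat; ring.
- have ag : abssum (nahm_term q (-2) 2 2) by apply: (@abssum_nahm_term _ q q0 hq1 _ _ _ 2).
  have e := f_equal2 (fun a b => a - 4 * b)
    (f_equal2 (fun a b => 1 / (2 * q) * a - 1 / (2 * q) * b)
    (product_A3 q0 hq1) (product_A3N q0 hq1)) (product_B4 q0 hq1).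
  apply: (has_sum3_csum ag (etrans (nahm_sum3 q0 hq1) e)).
    by move=> i j k; exact: nahm_term_lt0.
  by move=> i j k; apply: nahm_term_nat; ring.
Qed.
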